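(* Let $X_t$ be the block Gibbs sampler on $\mathcal{B}_\pi\subset\mathbb{R}^{n-1}$ with block size $k$ and edge weight $w$ (defined in the context), and let $U_\pi$ be the uniform distribution on $\mathcal{B}_\pi$. (Upper bound) If $k=w=55$, then for every $c>0$, every $n>58$, every probability distribution $\pi$ on $\{1,\dots,n\}$ with full support, every initial distribution of $X_0$ on $\mathcal{B}_\pi$, and every integer $t>2cn\log(n)$, $$\|\mathcal{L}(X_t)-U_\pi\|_{TV}\le n^{1-c}.$$ (Lower bound) Conversely, for any fixed integer $k\ge 1$, any fixed $w>0$, any $c>0$, any sequence of distributions $\pi=\pi_n$ on $\{1,\dots,n\}$ with full support, and any deterministic initial states $X_0\in\mathcal{B}_{\pi_n}$, if $t=t_n=\left(\frac1k-c\right)n\log(n)$ (read as $\max(0,\lfloor(\frac1k-c)n\log n\rfloor)$), then $$\liminf_{n\to\infty}\|\mathcal{L}(X_{t_n})-U_{\pi_n}\|_{TV}>0.$$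
   Context: For a probability distribution $\pi$ on $[n]=\{1,\dots,n\}$ with $\pi(i)>0$ for all $i$, let $$\mathcal{B}_{\pi}=\left\{X\in\mathbb{R}^{n-1}:\ 0\le X[i]\le\min\left(1-\tfrac{\pi(i-1)}{\pi(i)}X[i-1],\ \tfrac{\pi(i+1)}{\pi(i)}(1-X[i+1])\right),\ 1\le i\le n-1\right\},$$ with the convention $X[0]=X[n]=0$. (This is the set of super-diagonals $X[i]=K[i,i+1]$ of tridiagonal stochastic matrices $K$ on $[n]$ with $\pi(i)K[i,j]=\pi(j)K[j,i]$ for all $i,j$.) The uniform distribution $U_\pi$ on $\mathcal{B}_\pi$ is normalized Lebesgue measure. Block Gibbs sampler with block size $k\ge1$ (integer) and edge weight $w>0$, for $n>k$ (with $n-k\ge 2$): at each step $t$, choose independently $i(t)\in\{1,\dots,n-k\}$ with $P[i(t)=1]=P[i(t)=n-k]=\frac{w}{n-k-2+2w}$ and $P[i(t)=j]=\frac{1}{n-k-2+2w}$ for $j\ne 1,n-k$. For $j\notin\{i(t),\dots,i(t)+k-1\}$ set $X_{t+1}[j]=X_t[j]$. Choose $U_t$ uniformly from $\mathcal{B}_\pi$ conditioned on $U_t[j]=X_t[j]$ for all $j\notin\{i(t),\dots,i(t)+k-1\}$ (i.e. uniformly on the corresponding compact convex slice of $\mathcal{B}_\pi$), and set $X_{t+1}[j]=U_t[j]$ for $j\in\{i(t),\dots,i(t)+k-1\}$. $\mathcal{L}(X)$ denotes the law of $X$ and $\|\mu-\nu\|_{TV}=\sup_A|\mu(A)-\nu(A)|$.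 *)

(* Defs.v *)
From HB Require Import structures.
From mathcomp Require Import all_boot all_order all_algebra.
From mathcomp Require Import all_classical all_reals all_analysis.

Set Implicit Arguments.
Unset Strict Implicit.
Unset Printing Implicit Defensive.

Import Order.TTheory GRing.Theory Num.Theory.
Import numFieldNormedType.Exports.

Local Open Scope classical_set_scope.
Local Open Scope ring_scope.

Section product_of_measures.
Context d (T : measurableType d) (R : realType).
Local Open Scope ereal_scope.

Definition tuple_cons n (p : T * n.-tuple T) : n.+1.-tuple T :=
  [tuple of p.1 :: p.2].

Fixpoint prod_measure n :
    ('I_n -> {sigma_finite_measure set T -> \bar R}) ->
    set (n.-tuple T) -> \bar R :=
  match n with
  | 0%N => fun _ => \d_ [tuple]
  | m.+1 => fun mu =>
      pushforward (mu ord0 \x prod_measure (fun i : 'I_m => mu (lift ord0 i)))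
                  (@tuple_cons m)
  end.

Lemma measurable_tuple_cons n : measurable_fun setT (@tuple_cons n).
Proof. exact: measurable_cons. Qed.

Lemma prod_measure_sigma_finite n
    (mu : 'I_n -> {sigma_finite_measure set T -> \bar R}) :
  exists m : {sigma_finite_measure set (n.-tuple T) -> \bar R},
    prod_measure mu = m.
Proof.
elim: n mu => [|n IHn] mu; first by exists (\d_ [tuple]).
have [m mE] := IHn (fun i => mu (lift ord0 i)).
rewrite /= mE.
pose nu : {measure set (n.+1.-tuple T) -> \bar R} :=
  measure_function_pushforward__canonical__measure_function_Measure
    (mu ord0 \x m) (@measurable_tuple_cons n).
pose u (t : n.+1.-tuple T) := (thead t, [tuple of behead t] : n.-tuple T).
have mu_ : measurable_fun setT u.
  apply/measurable_fun_pairP; split; last exact: measurable_behead.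
  exact: measurable_tnth.
have nu_sf : sigma_finite setT nu.
  have /sigma_finiteP[F [TF ndF Foo]] := sigma_finiteT (mu ord0).
  have /sigma_finiteP[G [TG ndG Goo]] := sigma_finiteT m.
  exists (fun i => u @^-1` (F i `*` G i)).
    rewrite predeqE => t; split=> // _.
    have : setT (u t).1 by [].
    have : setT (u t).2 by [].
    rewrite TG TF => -[i _ Gi] [j _ Fj]; exists (maxn i j) => //; split.
    - by move: Fj; exact/subsetPset/ndF/leq_maxr.
    - by move: Gi; exact/subsetPset/ndG/leq_maxl.
  move=> i; have [mF oF] := Foo i; have [mG oG] := Goo i; split.
    by rewrite -[X in measurable X]setTI; apply: mu_ => //; exact: measurableX.
  rewrite /nu /= /pushforward (_ : _ @^-1` _ = F i `*` G i).
    by rewrite product_measure1E// lte_mul_pinfty// ge0_fin_numE.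
  rewrite predeqE => -[x t] /=; rewrite /u /tuple_cons /=.
  have -> : [tuple of behead [tuple of x :: t]] = t by exact/val_inj.
  by [].
pose sf := Measure_isSigmaFinite.Build _ _ _ nu nu_sf.
pose nu' : {sigma_finite_measure set (n.+1.-tuple T) -> \bar R} :=
  HB.pack (Measure.sort nu) sf (Measure.class nu).
by exists nu'.
Qed.

Section instances.
Context n (mu : 'I_n -> {sigma_finite_measure set T -> \bar R}).

Let prod_measure0 : prod_measure mu set0 = 0.
Proof. by have [m ->] := prod_measure_sigma_finite mu. Qed.

Let prod_measure_ge0 A : 0 <= prod_measure mu A.
Proof. by have [m ->] := prod_measure_sigma_finite mu. Qed.

Let prod_measure_sigma_additive : semi_sigma_additive (prod_measure mu).
Proof.
have [m ->] := prod_measure_sigma_finite mu.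
exact: measure_semi_sigma_additive.
Qed.

HB.instance Definition _ := isMeasure.Build _ _ _ (prod_measure mu)
  prod_measure0 prod_measure_ge0 prod_measure_sigma_additive.

Let prod_measure_sfT : sigma_finite setT (prod_measure mu).
Proof.
by have [m ->] := prod_measure_sigma_finite mu; exact: sigma_finiteT.
Qed.

HB.instance Definition _ := Measure_isSigmaFinite.Build _ _ _
  (prod_measure mu) prod_measure_sfT.

End instances.

End product_of_measures.

Notation vec R m := (m.-tuple (measurableTypeR R)).

Section gibbs.
Variable R : realType.
Implicit Types (n m k i t : nat) (pi : nat -> R) (w : R).

(* A point of R^(n-1) is an (n-1)-tuple x: X[i] is (crd x i) for 1 <= i <= n-1.
   All other values of (crd x) are 0, hence the convention X[0] = X[n] = 0. *)
Definition crd m (x : vec R m) i : R := nth 0 (0 :: x : seq R) i.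

(* Distributions on {1, ..., n} are functions on nat of which only the values at
   1, ..., n are relevant: in (gibbs_body n pi), the value pi 0 occurs only as a
   factor of X[0] = 0, and pi (n+1) does not occur. *)
Definition full_support_distribution n pi : Prop :=
  (forall i, (1 <= i <= n)%N -> 0 < pi i) /\ \sum_(1 <= i < n.+1) pi i = 1.

Definition gibbs_body n pi : set (vec R n.-1) :=
  [set x | forall i, (1 <= i <= n.-1)%N ->
    0 <= crd x i <= Num.min (1 - pi i.-1 / pi i * crd x i.-1)
                            (pi i.+1 / pi i * (1 - crd x i.+1))].
Arguments gibbs_body n pi : clear implicits.

Definition block_slice m (S : set (vec R m)) k i (x : vec R m) : set (vec R m) :=
  [set u | S u /\ forall j, ~~ (i <= j < i + k)%N -> crd u j = crd x j].

(* Law of the block position i in {1, ..., n-k}; it is 0 for any other i. *)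
Definition block_weight n k w i : R :=
  if (1 <= i <= n - k)%N then
    (if (i == 1)%N || (i == n - k)%N then w else 1) /
    ((n - k)%:R - 2 + 2 * w)
  else 0.

Local Open Scope ereal_scope.

Definition normalized d (T : measurableType d) (mu : set T -> \bar R)
    (S A : set T) : \bar R := mu (A `&` S) / mu S.

Definition lebesgue_tuple m : set (vec R m) -> \bar R :=
  prod_measure (fun _ : 'I_m => @lebesgue_measure R).

Definition uniform_body n pi : set (vec R n.-1) -> \bar R :=
  normalized (@lebesgue_tuple n.-1) (gibbs_body n pi).
Arguments uniform_body n pi : clear implicits.

Definition line_measure (free : bool) (a : measurableTypeR R) :
    {sigma_finite_measure set (measurableTypeR R) -> \bar R} :=
  match free with true => lebesgue_measure | false => \d_a end.

(* Lebesgue measure on the affine subspace through x spanned by the coordinate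
   directions in D. *)
Definition flat_lebesgue m (D : pred 'I_m) (x : vec R m) : set (vec R m) -> \bar R :=
  prod_measure (fun j => line_measure (D j) (tnth x j)).

Definition free_coordinate m (S : set (vec R m)) : pred 'I_m :=
  fun j => `[< exists u v, [/\ S u, S v & tnth u j <> tnth v j] >].

(* Uniform distribution on a compact convex set S whose affine hull is parallel
   to the coordinates in which S is not constant; x is any point of S. Every
   slice S of (gibbs_body n pi) obtained by fixing the coordinates outside a
   block has this property. Its dimension is that of the block, unless the fixed
   values X[i-1] or X[i+k] next to the block {i, ..., i+k-1} are so large that
   they force X[i] = 0, resp. X[i+k-1] = 0, on the whole slice. In these
   degenerate cases the slice has measure 0 for the Lebesgue measure of the
   block, and uniformity refers to the remaining coordinates of the block (if
   there are none, then S = {x} and the distribution is the Dirac mass). *)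
Definition uniform_flat m (S : set (vec R m)) (x : vec R m) : set (vec R m) -> \bar R :=
  normalized (flat_lebesgue (free_coordinate S) x) S.

Section chain.
Context d (Om : measurableType d) (P : probability Om R).

(* The sigma-algebra generated by X_0, ..., X_t and i(0), ..., i(t-1). *)
Definition history m (X : nat -> {RV P >-> vec R m}) (I : nat -> {RV P >-> nat}) t
    : set (set Om) :=
  <<s [set E | (exists s A, [/\ (s <= t)%N, measurable A & E = X s @^-1` A]) \/
               (exists s i, (s < t)%N /\ E = I s @^-1` [set i])] >>.

(* Given the history up to time t, the position I t = i has law
   (block_weight n k w), and given moreover I t = i, X_(t+1) is uniform on the
   slice through X_t in which the block {i, ..., i+k-1} is left free. (The
   coordinates outside of the block are constant on the slice, so the point U_t
   drawn from it is X_(t+1) itself.) *)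
Definition block_gibbs_sampler n pi k w (X : nat -> {RV P >-> vec R n.-1})
    (I : nat -> {RV P >-> nat}) : Prop :=
  P (X 0%N @^-1` gibbs_body n pi) = 1 /\
  forall t i E A, history X I t E -> measurable A ->
    P (E `&` I t @^-1` [set i] `&` X t.+1 @^-1` A) =
    (block_weight n k w i)%:E *
    \int[P]_(om in E)
      uniform_flat (block_slice (gibbs_body n pi) k i (X t om)) (X t om) A.

End chain.

Definition tv_distance d (T : measurableType d) (mu nu : set T -> \bar R)
    : \bar R :=
  ereal_sup [set `|mu A - nu A| | A in measurable].

End gibbs.
Arguments gibbs_body {R} n pi.
Arguments uniform_body {R} n pi.
Arguments block_gibbs_sampler {R d Om P} n pi k w X I.

(* Main.v *)
(* Upper bound. The transition kernel acts on test functions, and their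
   oscillation on the body is measured by a Lipschitz constant for a weighted
   Hamming distance. Two slices of the body along a block of 55 coordinates that
   differ only in the coordinate before the block have uniform distributions
   which are compared coordinate by coordinate. The density of each coordinate
   given the preceding ones is nonincreasing, so with probability at least 1/2
   the coordinate is at most half of its largest possible value. When this
   happens to two consecutive coordinates, the constraint between them is void
   and the change is not felt further along the block. Hence the influence of a
   coordinate on the adjacent blocks is bounded, and smaller than the gain due to
   the 55 block positions that resample it: one step contracts the Lipschitz
   constant by 1 - 2/(n + 53). Starting from an indicator function and using that
   the uniform distribution is stationary, this bounds the total variation
   distance at time t by (1 - 2/(n + 53))^t (n + 23).

   Lower bound. The coordinates 2k, 3k, 4k, ... are resampled by disjoint sets of
   block positions. By the second moment method, the probability that one of them
   has never been resampled before time t_n is bounded away from 0; on this event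
   X_t shares a coordinate with X_0, which is a null event for the uniform
   distribution. *)

Require Import Defs.
From mathcomp Require Import all_boot all_order all_algebra.
From mathcomp Require Import all_classical all_reals all_analysis.
From mathcomp Require Import measurable_realfun ring lra zify.

Set Implicit Arguments.
Unset Strict Implicit.
Unset Printing Implicit Defensive.

Import Order.TTheory GRing.Theory Num.Theory.
Import numFieldNormedType.Exports.

Local Open Scope classical_set_scope.
Local Open Scope ring_scope.

(** * Coordinates and iterated marginals *)

(** No coupling of two chains is built: test functions are compared through their conditional means.
    The price is that the two conditional laws of a coordinate have unrelated normalizations. Both
    are therefore measured against one common level, an infimum over a support, and it is enough
    that the same interval carries at least half of each law. Iterating over two consecutive
    coordinates produces the recursion [d s.+1 + psi s.+1 / 2 + (d s.+2 + psi s.+2) / 4 <= psi s].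
    The ends of the body shape the constants. Coordinate 1 is resampled by position 1 only, and the
    edge weight 55 gives every coordinate a total resampling weight of at least 55. But then the
    extreme blocks also react 55 times as strongly to their outer neighbours, which is paid for by a
    larger Hamming weight there; its extra influence is tracked by a geometric sequence of ratio
    9/10. The other obstacle is a fixed neighbour so large that it pins an end of the block to 0.
    This shortens the block by one coordinate on that side and is handled by cases. That the body is
    a down-set gives meaning to these cases, and lets two points be joined through their minimum. *)

Section coordinates.
Context {R : realType} {m : nat}.
Implicit Types (x y : vec R m) (i j : nat) (u : R).

(* Coordinates are 1-based as in [crd]; updating a coordinate outside of
   {1, ..., m} does nothing. *)
Definition upd x j u : vec R m :=
  [tuple (if i.+1 == j then u else tnth x i) | i < m].

Lemma crdS x (i : 'I_m) : crd x i.+1 = tnth x i.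
Proof. by rewrite (tnth_nth 0). Qed.

Lemma crd0 x : crd x 0 = 0. Proof. by []. Qed.

Lemma crd_out x i : (m < i)%N -> crd x i = 0.
Proof. by case: i => // i mi; apply: nth_default; rewrite size_tuple. Qed.

Lemma crd_mktuple (f : nat -> R) i : (0 < i <= m)%N ->
  crd ([tuple f j.+1 | j < m] : vec R m) i = f i.
Proof.
case: i => // i /= im; rewrite (_ : i = Ordinal im :> nat)//.
by rewrite crdS tnth_mktuple.
Qed.

Lemma crd_upd x j u i : (0 < j <= m)%N ->
  crd (upd x j u) i = if i == j then u else crd x i.
Proof.
move=> jm; case: i => [|i]; first by case: j jm.

have [im|mi] := ltnP i m; last first.
  rewrite crd_out//; case: eqP => [ij|_]; last by rewrite crd_out.
  by move: jm; lia.
by rewrite (_ : i = Ordinal im :> nat)// !crdS tnth_mktuple.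
Qed.

Lemma vecP x y : (forall i, (0 < i <= m)%N -> crd x i = crd y i) -> x = y.
Proof.
move=> xy; apply: eq_from_tnth => i; rewrite -!crdS; apply: xy.
by rewrite /= ltn_ord.
Qed.

Lemma measurable_crd i : measurable_fun setT (fun x => crd x i).
Proof.
case: i => [|i]; first exact: measurable_cst.
have [im|mi] := ltnP i m.
  rewrite (_ : (fun x => _) = (fun x => tnth x (Ordinal im))).
    exact: measurable_tnth.
  by apply/funext => x; rewrite -crdS.
rewrite (_ : (fun x => _) = cst 0); first exact: measurable_cst.
by apply/funext => x; rewrite crd_out.
Qed.

Lemma measurable_upd j :
  measurable_fun setT (fun p : vec R m * measurableTypeR R => upd p.1 j p.2).
Proof.
apply/measurable_fun_tnthP => i.
apply: (@eq_measurable_fun _ _ _ _ _ (fun p : vec R m * measurableTypeR R =>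
    if i.+1 == j then p.2 else tnth p.1 i)).
  by move=> p _ /=; rewrite tnth_mktuple.
case: (i.+1 == j); first exact: measurable_snd.
apply: (measurableT_comp (measurable_tnth (T := measurableTypeR R) i)).
exact: measurable_fst.
Qed.

Lemma measurable_upd1 x j : measurable_fun setT (upd x j : measurableTypeR R -> _).
Proof.
apply: (measurableT_comp (measurable_upd j) (_ : measurable_fun setT (pair x))).
exact: pair1_measurable.
Qed.

End coordinates.

(** * Partial integrals in chosen coordinates, and their commutation *)

Section marginals.
Context {R : realType} {m : nat}.
Local Open Scope ereal_scope.
Implicit Types (x y : vec R m) (F G : vec R m -> \bar R) (s : seq nat).

(** The result is again a function on all of [vec R m], constant in an integrated coordinate [j] of
    the range. Partial integrals thus compose in any order without a change of type, and a slice is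
    described by the point at which the result is evaluated. *)
Definition marg j F x := \int[@lebesgue_measure R]_u F (upd x j u).

Definition margs s F := foldr marg F s.

Definition mnn F := measurable_fun setT F /\ forall x, 0 <= F x.

Lemma measurable_fun_upd F x j : mnn F ->
  measurable_fun setT (fun u : measurableTypeR R => F (upd x j u)).
Proof. by case=> mF _; exact: measurableT_comp (measurable_upd1 x j). Qed.

Lemma mnn_marg j F : mnn F -> mnn (marg j F).
Proof.
move=> [mF F0]; split; last by move=> x; exact: integral_ge0.
apply: (measurable_fun_fubini_tonelli_F
  (fun p : vec R m * measurableTypeR R => F (upd p.1 j p.2))) => //.
exact: measurableT_comp mF (measurable_upd j).
Qed.

Lemma mnn_margs s F : mnn F -> mnn (margs s F).
Proof. by move=> mF; elim: s => //= j s; exact: mnn_marg. Qed.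

Lemma margs_ge0 s F x : mnn F -> 0 <= margs s F x.
Proof. by move=> /(mnn_margs s)[]. Qed.

Lemma updC x i j u v : (0 < i <= m)%N -> (0 < j <= m)%N -> i != j ->
  upd (upd x i u) j v = upd (upd x j v) i u.
Proof.
move=> im jm ij; apply: vecP => l lm; rewrite !crd_upd//.
by case: eqVneq => [->|//]; rewrite eq_sym (negbTE ij).
Qed.

Lemma margC i j F : (0 < i <= m)%N -> (0 < j <= m)%N -> mnn F ->
  marg i (marg j F) = marg j (marg i F).
Proof.
move=> im jm [mF F0]; have [->//|ij] := eqVneq i j.
apply/funext => x.
pose f (p : measurableTypeR R * measurableTypeR R) := F (upd (upd x i p.1) j p.2).
transitivity (\int[@lebesgue_measure R]_u \int[@lebesgue_measure R]_v f (u, v)).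
  by [].
have mf : measurable_fun setT f.
  apply: measurableT_comp => //.
  apply: (measurableT_comp (measurable_upd j)
   (_ : measurable_fun setT (fun p : measurableTypeR R * measurableTypeR R =>
     (upd x i p.1, p.2)))).
  apply/measurable_fun_pairP; split; last exact: measurable_snd.
  by apply: (measurableT_comp (measurable_upd1 x i)); exact: measurable_fst.
rewrite (fubini_tonelli f mf) => [|p]; last exact: F0.
apply: eq_integral => v _; apply: eq_integral => u _.
by rewrite /f /= updC.
Qed.

Lemma margs_cat s t F : margs (s ++ t) F = margs s (margs t F).
Proof. by rewrite /margs foldr_cat. Qed.

Definition coords s := all (fun j => 0 < j <= m)%N s.

Lemma margs_marg s j F : coords s -> (0 < j <= m)%N -> mnn F ->
  margs s (marg j F) = marg j (margs s F).
Proof.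
move=> + jm mF; elim: s => //= i s IHs /andP[im sm].
by rewrite IHs// margC//; exact: mnn_margs.
Qed.

(** Tonelli, applied to transpositions. Later this brings a block innermost, isolates a pinned
    coordinate, and reverses the order of the coordinates. *)
Lemma perm_margs s t F : coords s -> perm_eq s t -> mnn F ->
  margs s F = margs t F.
Proof.
move=> + + mF; elim: s t => [|j s IHs] t.
  by move=> _; rewrite perm_sym => /perm_nilP ->.
move=> /= /andP[jm sm] st.
have jt : j \in t by rewrite -(perm_mem st) mem_head.
move: st; case/splitPr: jt => t1 t2; rewrite -(cat1s j t2) perm_sym perm_catCA.
rewrite perm_cons perm_sym => st.
have tm : coords (t1 ++ t2) by rewrite /coords -(perm_all _ st).
rewrite (IHs _ sm st) !margs_cat /= margs_marg//.
- by move: tm; rewrite /coords all_cat => /andP[].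
- exact: mnn_margs.
Qed.

Lemma eq_margs s F G x : coords s ->
  (forall y, (forall i, i \notin s -> crd y i = crd x i) -> F y = G y) ->
  margs s F x = margs s G x.
Proof.
elim: s x => [|j s IHs] x; first by move=> _; exact.
move=> /= /andP[jm sm] FG; apply: eq_integral => u _; apply: IHs => // y yx.
apply: FG => i; rewrite inE negb_or => /andP[ij /yx ->].
by rewrite crd_upd// (negbTE ij).
Qed.

Lemma le_margs s F G x : coords s -> mnn F -> mnn G ->
  (forall y, (forall i, i \notin s -> crd y i = crd x i) -> F y <= G y) ->
  margs s F x <= margs s G x.
Proof.
move=> + mF mG; elim: s x => [|j s IHs] x; first by move=> _; exact.
move=> /= /andP[jm sm] FG; apply: ge0_le_integral => //.
- by move=> u _; exact: margs_ge0.
- by apply: measurable_fun_upd; exact: mnn_margs.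
- by apply: measurable_fun_upd; exact: mnn_margs.
- move=> u _; apply: IHs => // y yx.
  apply: FG => i; rewrite inE negb_or => /andP[ij /yx ->].
  by rewrite crd_upd// (negbTE ij).
Qed.

Lemma margs_agree s F x y : coords s ->
  (forall i, i \notin s -> crd x i = crd y i) -> margs s F x = margs s F y.
Proof.
elim: s x y => [|j s IHs] x y.
  by move=> _ xy; congr F; apply: vecP => i _; exact: xy.
move=> /= /andP[jm sm] xy; apply: eq_integral => u _; apply: IHs => // i is_.
rewrite !crd_upd//; case: eqVneq => // ij; apply: xy.
by rewrite inE negb_or ij.
Qed.

Lemma margsM s F G x : coords s -> mnn F -> mnn G ->
  (forall y, (forall i, i \notin s -> crd y i = crd x i) -> G y = G x) ->
  margs s (fun y => G y * F y) x = G x * margs s F x.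
Proof.
move=> + mF mG; elim: s x => [//|j s IHs] x /= /andP[jm sm] Gx.
rewrite /marg -ge0_integralZl//.
- apply: eq_integral => u _.
  have Gu : G (upd x j u) = G x.
    apply: Gx => i; rewrite inE negb_or => /andP[ij _].
    by rewrite crd_upd// (negbTE ij).
  rewrite IHs ?Gu// => y yx; rewrite Gx// => i.
  rewrite inE negb_or => /andP[ij /yx ->].
  by rewrite crd_upd// (negbTE ij).
- by apply: measurable_fun_upd; exact: mnn_margs.
- by move=> u _; exact: margs_ge0.
- by case: mG.
Qed.

End marginals.

(** * Flat Lebesgue measures as iterated integrals *)

Section flat_integral.
Context {R : realType}.
Local Open Scope ereal_scope.

Let vcons m (u : R) (v : vec R m) : vec R m.+1 := tuple_cons (u, v).

Let upd_vcons m u (v : vec R m) j a : (0 < j)%N ->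
  upd (vcons u v) j.+1 a = vcons u (upd v j a).
Proof.
move=> j0; apply: eq_from_tnth => i; rewrite tnth_mktuple eqSS.
have [->|] := eqVneq i ord0; first by case: j j0.
case: (unliftP ord0 i) => [k ->|->//] _.
by rewrite !tnthS tnth_mktuple lift0.
Qed.

Let margs_vcons m u (v : vec R m) s F : all (leq 1) s ->
  margs [seq j.+1 | j <- s] F (vcons u v) = margs s (fun v => F (vcons u v)) v.
Proof.
elim: s v => //= j s IHs v /andP[j0 s0]; apply: eq_integral => a _.
by rewrite upd_vcons// IHs.
Qed.

Let measurable_vcons m u : measurable_fun setT (@vcons m u).
Proof.
apply: (measurableT_comp (@measurable_tuple_cons _ _ m)).
exact: pair1_measurable.
Qed.

Lemma integral_flat m (free : pred nat) (x : vec R m) F : mnn F ->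
  \int[flat_lebesgue (fun i : 'I_m => free i.+1) x]_y F y =
  margs [seq j <- iota 1 m | free j] F x.
Proof.
elim: m free x F => [|m IHm] free x F [mF F0].
  rewrite /flat_lebesgue /= integral_dirac// diracT mul1e (tuple0 x)//.
have [x0 [v ->]] : exists x0 v, x = vcons x0 v.
  exists (thead x), [tuple of behead x]; apply: eq_from_tnth => i.
  rewrite [in LHS](tuple_eta x); congr tnth; exact/val_inj.
rewrite /flat_lebesgue.
set mu := fun j : 'I_m.+1 => _.
have nuE : (fun i => mu (lift ord0 i)) =
    (fun i : 'I_m => line_measure (free i.+2) (tnth v i)).
  by apply/funext => i; rewrite /mu /= tnthS.
rewrite [LHS](_ : _ = \int[pushforward (mu ord0 \x
    prod_measure (fun i => mu (lift ord0 i))) (@tuple_cons _ _ m)]_y F y)//.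
rewrite ge0_integral_pushforward//; last exact: measurable_tuple_cons.
rewrite preimage_setT.
have mFc : measurable_fun setT (F \o @tuple_cons _ _ m).
  by apply: measurableT_comp => //; exact: measurable_tuple_cons.
rewrite (fubini_tonelli1 (F \o @tuple_cons _ _ m))//= /fubini_F nuE.
have IH u : \int[prod_measure (fun i : 'I_m => line_measure (free i.+2) (tnth v i))]_y
    (F \o @tuple_cons _ _ m) (u, y) =
    margs [seq j <- iota 1 m | free j.+1] (fun y => F (vcons u y)) v.
  apply: (IHm (fun j => free j.+1)).
  split; last by move=> y; exact: F0.
  exact: (measurableT_comp mF (@measurable_vcons m u)).
under eq_integral do rewrite IH.
have mapE : [seq j <- iota 2 m | free j] =
    [seq j.+1 | j <- [seq j <- iota 1 m | free j.+1]].
  by rewrite (iotaDl 1 1 m) filter_map.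
have s0 : all (leq 1) [seq j <- iota 1 m | free j.+1].
  by apply/allP => j; rewrite mem_filter mem_iota => /and3P[].
rewrite /mu /= mapE; case: (free 1%N) => /=.
- apply: eq_integral => u _.
  rewrite -margs_vcons//; congr margs; apply: eq_from_tnth => i.
  rewrite tnth_mktuple; case: (unliftP ord0 i) => [k ->|->//].
  by rewrite !tnthS.
- rewrite integral_dirac//= ?diracT ?mul1e -?margs_vcons//.
  rewrite (_ : (fun _ => _) = margs [seq j.+1 | j <- [seq j <- iota 1 m | free j.+1]] F \o (fun u => vcons u v)); last first.
    by apply/funext => u /=; rewrite margs_vcons.
  apply: measurableT_comp; first by have [] := mnn_margs [seq j.+1 | j <- [seq j <- iota 1 m | free j.+1]] (conj mF F0).
  apply: (measurableT_comp (@measurable_tuple_cons _ _ m)).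
  exact: pair2_measurable.
Qed.

Lemma flat_box m (D : pred 'I_m) (x : vec R m) (A : 'I_m -> set R) :
  (forall i, measurable (A i)) ->
  flat_lebesgue D x [set y | forall i, A i (tnth y i)] =
  \prod_(i < m) line_measure (D i) (tnth x i) (A i).
Proof.
rewrite /flat_lebesgue; set mu := fun j : 'I_m => _.
rewrite -[RHS]/(\prod_(i < m) mu i (A i)); move: mu => mu {D x}.
elim: m mu A => [|m IHm] mu A mA.
  rewrite big_ord0 /= (_ : [set _ | _] = setT) ?diracT//.
  by apply/seteqP; split => // y _ [].
rewrite big_ord_recl -IHm//.
have -> : prod_measure mu [set y | forall i, A i (tnth y i)] =
   (mu ord0 \x prod_measure (fun i => mu (lift ord0 i)))
     (@tuple_cons _ _ m @^-1` [set y | forall i, A i (tnth y i)]) by [].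
have -> : @tuple_cons _ _ m @^-1` [set y | forall i, A i (tnth y i)] =
    A ord0 `*` [set y | forall i, A (lift ord0 i) (tnth y i)].
  apply/seteqP; split => -[u v] /=.
    by move=> H; split => [|i]; [exact: (H ord0)|have := H (lift ord0 i); rewrite tnthS].
  by move=> [Au Av] i; case: (unliftP ord0 i) => [k ->|->//]; rewrite tnthS.
rewrite product_measure1E//; first exact: mA.
rewrite [X in measurable X](_ : _ = \bigcap_(i in [set: 'I_m])
  ((fun y : vec R m => tnth y i) @^-1` A (lift ord0 i))); last first.
  by apply/seteqP; split => y /= H i; [move=> _; exact: H|exact: (H i)].
apply: fin_bigcap_measurable => // i _.
by rewrite -[X in measurable X]setTI; apply: measurable_tnth => //; exact: mA.
Qed.

End flat_integral.

(** * Comparison of weighted averages *)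

Section two_scale.
Context {R : realType}.
Local Open Scope ereal_scope.
Local Notation mu := (@lebesgue_measure R).

(** By monotonicity both halves of [[0, U]] compare with the constant [w (U / 2)], and they have
    equal length. *)
Lemma half_mass (U : R) (w : measurableTypeR R -> \bar R) :
  measurable_fun setT w -> (forall u, 0 <= w u) -> (0 <= U)%R ->
  (forall u, (u < 0)%R -> w u = 0) -> (forall u, (U < u)%R -> w u = 0) ->
  (forall u v, (0 <= u)%R -> (u <= v)%R -> w v <= w u) ->
  \int[mu]_(u in ~` `[0%R, (U / 2)%R]) w u <= \int[mu]_(u in `[0%R, (U / 2)%R]) w u.
Proof.
move=> mw w0 U0 wN wU wd; set S := [set` _].
have mS : measurable S by exact: measurable_itv.
pose K := `](U / 2)%R, U]%classic : set R.
have mK : measurable K by exact: measurable_itv.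
have mwD D : measurable_fun D w by exact: measurable_funTS.
have muS : mu S = (U / 2)%:E.
  by rewrite lebesgue_measure_itv/= lte_fin; case: ltP => [_|]; rewrite ?EFinN ?sube0// => ?; congr EFin; lra.
have muK : mu K = (U / 2)%:E.
  rewrite lebesgue_measure_itv/= lte_fin; case: ltP => [_|?].
    by rewrite -EFinB; congr EFin; lra.
  by congr EFin; lra.
apply: (@le_trans _ _ (\int[mu]_(u in K) w u)).
  rewrite integral_mkcond [leRHS]integral_mkcond.
  apply: ge0_le_integral => //.
  - by move=> u _; exact: erestrict_ge0.
  - by apply/measurable_restrict => //; exact: measurableC.
  - exact/measurable_restrict.
  - move=> u _; rewrite /patch; case: ifPn => [|_]; last by case: ifP.
    rewrite in_setC notin_setE /S /= in_itv/= => /negP/nandP uS.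
    case: ifPn => //; rewrite notin_setE /K /= in_itv/= => /negP/nandP uK.
    suff -> : w u = 0 by [].
    case: (ltP u 0%R) => [/wN//|u0]; case: (ltP U u) => [/wU//|uU].
    by move: uS uK; rewrite u0 uU -ltNge => -[//|->] [|].
apply: (@le_trans _ _ (w (U / 2)%R * (U / 2)%:E)).
  have <- : \int[mu]_(u in K) cst (w (U / 2)%R) u = w (U / 2)%R * (U / 2)%:E.
    by rewrite integral_cst//; congr (_ * _); exact: muK.
  apply: ge0_le_integral => //.
  by move=> u; rewrite /K /= in_itv/= => /andP[uU _]; apply: wd; lra.
have <- : \int[mu]_(u in S) cst (w (U / 2)%R) u = w (U / 2)%R * (U / 2)%:E.
  by rewrite integral_cst//; congr (_ * _); exact: muS.
apply: ge0_le_integral => //; last first.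
  by move=> u; rewrite /S /= in_itv/= => /andP[u0 uU]; apply: wd.
by move=> u _ /=.
Qed.

(** Here [s] and [r] are the masses of the favourable set and of its complement. If [a <= b], mass
    beyond one half on the favourable set only helps; if [b < a], the bound [b] holds everywhere and
    is below the mean of [a] and [b]. *)
Let avg_half_le (a b s r v1 v2 : R) : (0 <= r <= s -> v1 <= a * s ->
  v1 <= b * s -> v2 <= b * r -> v1 + v2 <= (a + b) / 2 * (s + r))%R.
Proof. by move=> rs h1 h2 h3; have [ab|ba] := leP a b; nra. Qed.

Let avg_half_ge (a b s r v1 v2 : R) : (0 <= r <= s -> a * s <= v1 ->
  b * s <= v1 -> b * r <= v2 -> (a + b) / 2 * (s + r) <= v1 + v2)%R.
Proof. by move=> rs h1 h2 h3; have [ab|ba] := leP a b; nra. Qed.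

Definition mnn1 (w : measurableTypeR R -> \bar R) :=
  measurable_fun setT w /\ forall u, 0 <= w u.

Let split_integral (S : set R) w : measurable S -> mnn1 w ->
  \int[mu]_u w u = \int[mu]_(u in S) w u + \int[mu]_(u in ~` S) w u.
Proof.
move=> mS [mw w0]; rewrite -ge0_integral_setU ?setUv//; first exact: measurableC.
by apply/disj_setPCl => u.
Qed.

Let integral_le (S : set R) (a : R) (v w : measurableTypeR R -> \bar R) :
  measurable S -> mnn1 v -> mnn1 w -> (0 <= a)%R ->
  (forall u, v u <= a%:E * w u) ->
  \int[mu]_(u in S) v u <= a%:E * \int[mu]_(u in S) w u.
Proof.
move=> mS [mv v0] [mw w0] a0 vw.
rewrite -ge0_integralZl_EFin//; last exact: measurable_funTS.
apply: ge0_le_integral => //; first exact: measurable_funTS.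
by apply: measurable_funeM; exact: measurable_funTS.
Qed.

Let integral_ge (S : set R) (a : R) (v w : measurableTypeR R -> \bar R) :
  measurable S -> mnn1 v -> mnn1 w -> (0 <= a)%R ->
  (forall u, a%:E * w u <= v u) ->
  a%:E * \int[mu]_(u in S) w u <= \int[mu]_(u in S) v u.
Proof.
move=> mS [mv v0] [mw w0] a0 vw.
rewrite -ge0_integralZl_EFin//; last exact: measurable_funTS.
apply: ge0_le_integral => //; last exact: measurable_funTS.
- by move=> u _; rewrite mule_ge0.
- by apply: measurable_funeM; exact: measurable_funTS.
Qed.

(* [t] and [t'] are the averages of [T] and [T'] with weights [w] and [w']. On
   the set [S], which carries at least half of each weight, the comparison is
   made in average, up to [e1]; elsewhere it is the pointwise comparison up to
   [e2]. *)
Lemma two_scale (S : set R) (v w v' w' : measurableTypeR R -> \bar R)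
    (T T' : R -> R) (t t' A e1 e2 : R) :
  measurable S -> mnn1 v -> mnn1 w -> mnn1 v' -> mnn1 w' ->
  (forall u, v u = (T u)%:E * w u) -> (forall u, v' u = (T' u)%:E * w' u) ->
  (forall u, 0 <= T u)%R -> (forall u, 0 <= T' u)%R ->
  (0 <= e1)%R -> (0 <= e2)%R -> (0 <= A)%R ->
  0 < \int[mu]_u w u < +oo -> 0 < \int[mu]_u w' u < +oo ->
  \int[mu]_(u in ~` S) w u <= \int[mu]_(u in S) w u ->
  \int[mu]_(u in ~` S) w' u <= \int[mu]_(u in S) w' u ->
  \int[mu]_u v u = t%:E * \int[mu]_u w u ->
  \int[mu]_u v' u = t'%:E * \int[mu]_u w' u ->
  (forall u u', w u != 0 -> w' u' != 0 -> T u <= T' u' + e2)%R ->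
  \int[mu]_(u in S) v u <= (A + e1)%:E * \int[mu]_(u in S) w u ->
  A%:E * \int[mu]_(u in S) w' u <= \int[mu]_(u in S) v' u ->
  (t <= t' + (e1 + e2) / 2)%R.
Proof.
move=> mS mv mw mv' mw' vE v'E T0 T'0 e10 e20 A0 W W' wS w'S tE v'E' Te VA VA'.
have mCS := measurableC mS.
(* The infimum [i] of [T'] on the support of [w'] turns the pairwise comparison into [T <= i + e2]
   and [i <= T']. Both averages are then compared with the same numbers [A] and [i], although [w]
   and [w'] may give different proportions of mass to [S]. *)
pose J := [set T' u' | u' in [set u' | w' u' != 0]].
have J0 : J !=set0.
  apply: contrapT => J0; move: W'; rewrite integral0_eq ?ltxx// => u _.
  apply: contrapT => /eqP w'u; apply: J0; exists (T' u); by exists u.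
have lbJ : has_lbound J by exists 0%R => _ [u _ <-].
pose i := inf J.
have i0 : (0 <= i)%R by apply: lb_le_inf => // _ [u _ <-].
have iT' u : i%:E * w' u <= v' u.
  rewrite v'E; have [->|w'u] := eqVneq (w' u) 0; first by rewrite !mule0.
  apply: lee_wpmul2r; first by case: mw' => _; exact.
  by rewrite lee_fin; apply: ge_inf => //; exists u.
have iT u : v u <= (i + e2)%:E * w u.
  rewrite vE; have [->|wu] := eqVneq (w u) 0; first by rewrite !mule0.
  apply: lee_wpmul2r; first by case: mw => _; exact.
  rewrite lee_fin -lerBlDr; apply: lb_le_inf => // _ [u' w'u' <-].
  by rewrite lerBlDr; exact: Te.
have ie0 : (0 <= i + e2)%R by rewrite addr_ge0.
have finD v1 (D : set R) : mnn1 v1 -> measurable D ->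
    \int[mu]_u v1 u \is a fin_num -> exists2 r : R, (0 <= r)%R &
    \int[mu]_(u in D) v1 u = r%:E.
  move=> [mv1 v10] mD voo.
  have Doo : \int[mu]_(u in D) v1 u \is a fin_num.
    rewrite ge0_fin_numE ?integral_ge0//.
    apply: (@le_lt_trans _ _ (\int[mu]_u v1 u)).
      exact: ge0_subset_integral.
    by rewrite -ge0_fin_numE ?integral_ge0.
  exists (fine (\int[mu]_(u in D) v1 u)); last by rewrite fineK.
  by rewrite fine_ge0// integral_ge0.
have fW : \int[mu]_u w u \is a fin_num by rewrite gt0_fin_numE; case/andP: W.
have fW' : \int[mu]_u w' u \is a fin_num by rewrite gt0_fin_numE; case/andP: W'.
have fV : \int[mu]_u v u \is a fin_num by rewrite tE fin_numM.
have fV' : \int[mu]_u v' u \is a fin_num by rewrite v'E' fin_numM.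
have ve1 D mD := @integral_le D _ _ _ mD mv mw ie0 iT.
have ve2 D mD := @integral_ge D _ _ _ mD mv' mw' i0 iT'.
move: (ve1 _ mS) (ve1 _ mCS) (ve2 _ mS) (ve2 _ mCS) tE v'E' W W' wS w'S VA VA'.
rewrite !(split_integral mS)//.
have [s s0 ->] := finD _ _ mw mS fW; have [r r0 ->] := finD _ _ mw mCS fW.
have [s' s'0 ->] := finD _ _ mw' mS fW'; have [r' r'0 ->] := finD _ _ mw' mCS fW'.
have [a a0 ->] := finD _ _ mv mS fV; have [b b0 ->] := finD _ _ mv mCS fV.
have [a' a'0 ->] := finD _ _ mv' mS fV'; have [b' b'0 ->] := finD _ _ mv' mCS fV'.
rewrite -!EFinD -!EFinM !lee_fin !lte_fin => h1 h2 h3 h4 [tE] [t'E].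
rewrite !ltry !andbT => W W' rs rs' h5 h6.
have := @avg_half_le _ _ _ _ _ _ _ h5 h1 h2; rewrite r0 rs => /(_ isT).
have := @avg_half_ge _ _ _ _ _ _ _ h6 h3 h4; rewrite r'0 rs' => /(_ isT).
rewrite tE t'E !ler_pM2r// => h7 h8; lra.
Qed.

End two_scale.

Section two_scale_corollaries.
Context {R : realType}.
Local Open Scope ereal_scope.
Local Notation mu := (@lebesgue_measure R).
Variables (S : set R) (v w v' w' : measurableTypeR R -> \bar R).
Variables (T T' : R -> R) (t t' e1 e2 : R).
Hypotheses (mS : measurable S) (mv : mnn1 v) (mw : mnn1 w)
  (mv' : mnn1 v') (mw' : mnn1 w').
Hypotheses (vE : forall u, v u = (T u)%:E * w u)
  (v'E : forall u, v' u = (T' u)%:E * w' u).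
Hypotheses (T0 : forall u, (0 <= T u)%R) (T'0 : forall u, (0 <= T' u)%R).
Hypotheses (e10 : (0 <= e1)%R) (e20 : (0 <= e2)%R).
Hypotheses (W : 0 < \int[mu]_u w u < +oo) (W' : 0 < \int[mu]_u w' u < +oo).
Hypotheses (wS : \int[mu]_(u in ~` S) w u <= \int[mu]_(u in S) w u)
  (w'S : \int[mu]_(u in ~` S) w' u <= \int[mu]_(u in S) w' u).
Hypotheses (tE : \int[mu]_u v u = t%:E * \int[mu]_u w u)
  (t'E : \int[mu]_u v' u = t'%:E * \int[mu]_u w' u).
Hypothesis Te : forall u u', w u != 0 -> w' u' != 0 -> (T u <= T' u' + e2)%R.

Let integral_le (a : R) (f g : measurableTypeR R -> \bar R) :
  mnn1 f -> mnn1 g -> (0 <= a)%R -> (forall u, S u -> f u <= a%:E * g u) ->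
  \int[mu]_(u in S) f u <= a%:E * \int[mu]_(u in S) g u.
Proof.
move=> [mf f0] [mg g0] a0 vw.
rewrite -ge0_integralZl_EFin//; last exact: measurable_funTS.
apply: ge0_le_integral => //; first exact: measurable_funTS.
by apply: measurable_funeM; exact: measurable_funTS.
Qed.

Let integral_ge (a : R) (f g : measurableTypeR R -> \bar R) :
  mnn1 f -> mnn1 g -> (0 <= a)%R -> (forall u, S u -> a%:E * g u <= f u) ->
  a%:E * \int[mu]_(u in S) g u <= \int[mu]_(u in S) f u.
Proof.
move=> [mf f0] [mg g0] a0 vw.
rewrite -ge0_integralZl_EFin//; last exact: measurable_funTS.
apply: ge0_le_integral => //; last exact: measurable_funTS.
- by move=> u _; rewrite mule_ge0.
- by apply: measurable_funeM; exact: measurable_funTS.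
Qed.

Let w'S_gt0 : 0 < \int[mu]_(u in S) w' u < +oo.
Proof.
case/andP: W' => W'0 W'oo; case: (mw') => mw1 w10; apply/andP; split; last first.
  by apply: le_lt_trans W'oo; exact: ge0_subset_integral.
rewrite lt0e integral_ge0// andbT; apply/eqP => S0.
move: W'0; rewrite -(setUv S) ge0_integral_setU//; [|exact: measurableC|
  by rewrite setUv|by apply/disj_setPCl => u].
rewrite S0 add0e ltNge => /negP; apply.
by apply: (le_trans w'S); rewrite S0.
Qed.

(** The common level [A] of [two_scale] is the infimum of [T'] over the part of [S] that [w']
    charges; this part is nonempty because [S] carries at least half of a positive mass. *)
Lemma two_scale_pointwise :
  (forall u u', S u -> S u' -> w u != 0 -> w' u' != 0 -> (T u <= T' u' + e1)%R) ->
  (t <= t' + (e1 + e2) / 2)%R.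
Proof.
move=> Te1.
pose J := [set T' u' | u' in [set u' | S u' /\ w' u' != 0]].
have J0 : J !=set0.
  apply: contrapT => J0; move: w'S_gt0; rewrite integral0_eq ?ltxx// => u Su.
  apply: contrapT => /eqP w'u; apply: J0; exists (T' u); by exists u.
have lbJ : has_lbound J by exists 0%R => _ [u _ <-].
have i0 : (0 <= inf J)%R by apply: lb_le_inf => // _ [u _ <-].
apply: (two_scale mS mv mw mv' mw' vE v'E T0 T'0 e10 e20 i0 W W' wS w'S tE t'E Te).
- apply: integral_le => //; first by rewrite addr_ge0.
  move=> u Su; rewrite vE; have [->|wu] := eqVneq (w u) 0; first by rewrite !mule0.
  apply: lee_wpmul2r; first by case: mw => _; exact.
  rewrite lee_fin -lerBlDr; apply: lb_le_inf => // _ [u' [Su' w'u'] <-].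
  by rewrite lerBlDr; exact: Te1.
- apply: integral_ge => // u Su; rewrite v'E.
  have [->|w'u] := eqVneq (w' u) 0; first by rewrite !mule0.
  apply: lee_wpmul2r; first by case: mw' => _; exact.
  by rewrite lee_fin; apply: ge_inf => //; exists u.
Qed.

(** The common level [A] of [two_scale] is the mean of [T'] over [S]; equal weights on [S] allow the
    two integrals over [S] to be compared directly. *)
Lemma two_scale_same_weight :
  (forall u, S u -> w u = w' u) ->
  (forall u, S u -> v u <= v' u + e1%:E * w' u) ->
  (t <= t' + (e1 + e2) / 2)%R.
Proof.
move=> ww' vv'.
have fV' : \int[mu]_(u in S) v' u \is a fin_num.
  case: (mv') => mv1 v10; rewrite ge0_fin_numE ?integral_ge0//.
  apply: (@le_lt_trans _ _ (\int[mu]_u v' u)); first exact: ge0_subset_integral.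
  case/andP: W' => W'0 W'oo.
  by rewrite t'E -ge0_fin_numE ?fin_numM// ?gt0_fin_numE// -t'E integral_ge0.
have fW' : \int[mu]_(u in S) w' u \is a fin_num.
  by case/andP: w'S_gt0 => h1 h2; rewrite gt0_fin_numE.
pose A := (fine (\int[mu]_(u in S) v' u) / fine (\int[mu]_(u in S) w' u))%R.
have A0 : (0 <= A)%R.
  by rewrite divr_ge0// fine_ge0// integral_ge0//; [case: mv'|case: mw'].
have AE : A%:E * \int[mu]_(u in S) w' u = \int[mu]_(u in S) v' u.
  rewrite -{1}(fineK fW') -EFinM /A divfK ?fineK//.
  by rewrite gt_eqF// fine_gt0.
apply: (two_scale mS mv mw mv' mw' vE v'E T0 T'0 e10 e20 A0 W W' wS w'S tE t'E Te).
- have -> : \int[mu]_(u in S) w u = \int[mu]_(u in S) w' u.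
    by apply: eq_integral => u; rewrite inE => Su; exact: ww'.
  rewrite EFinD muleDl ?fin_num_adde_defr// AE.
  case: (mv') => mv1 v10; case: (mw') => mw1 w10; case: (mv) => mv2 v20.
  rewrite -ge0_integralZl_EFin//; last exact: measurable_funTS.
  rewrite -ge0_integralD//.
  + apply: ge0_le_integral => //; first exact: measurable_funTS.
    apply: emeasurable_funD; first exact: measurable_funTS.
    by apply: measurable_funeM; exact: measurable_funTS.
  + exact: measurable_funTS.
  + by move=> u _; rewrite mule_ge0.
  + by apply: measurable_funeM; exact: measurable_funTS.
- by rewrite AE.
Qed.

End two_scale_corollaries.

(** * Polytopes *)

Section marginal_updates.
Context {R : realType} {m : nat}.
Local Open Scope ereal_scope.
Implicit Types (x y : vec R m) (F G : vec R m -> \bar R) (t : seq nat).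

Definition agree_off t x y := forall i, i \notin t -> crd x i = crd y i.

Lemma agree_off_upd t j x y u : (0 < j <= m)%N ->
  agree_off t y (upd x j u) -> agree_off (j :: t) y x.
Proof.
move=> jm yx i; rewrite inE negb_or => /andP[ij it].
by rewrite yx// crd_upd// (negbTE ij).
Qed.

Lemma margs_upd t j F x u : coords (m := m) t -> (0 < j <= m)%N -> j \notin t ->
  margs t F (upd x j u) = margs t (fun y => F (upd y j u)) x.
Proof.
move=> + jm; elim: t x => //= i t IHt x /andP[im tm].
rewrite inE negb_or => /andP[ji jt]; apply: eq_integral => a _.
by rewrite updC// IHt.
Qed.

Lemma margs_eq0 t F x : coords (m := m) t ->
  (forall y, agree_off t y x -> F y = 0) -> margs t F x = 0.
Proof.
elim: t x => [|j t IHt] x /=; first by move=> _; exact.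
move=> /andP[jm tm] F0; apply: integral0_eq => u _; apply: IHt => // y yx.
by apply: F0; exact: agree_off_upd yx.
Qed.

Lemma margs_neq0 t F x : coords (m := m) t -> margs t F x != 0 ->
  exists2 y, agree_off t y x & F y != 0.
Proof.
move=> tm; apply: contra_neqP => noy; apply: margs_eq0 => // y yx.
by apply: contrapT => /eqP Fy; apply: noy; exists y.
Qed.

End marginal_updates.

Section polytope.
Context {R : realType} (m : nat) (al be ga : nat -> R).
Implicit Types (x y : vec R m) (i j s e h : nat) (t : seq nat).

(* With weights [al i = pi i], [be i = ga i = pi i.+1] this is the body of the
   birth and death chains; the class is closed under reversing the order of the
   coordinates. *)
Definition poly : set (vec R m) :=
  [set x | (forall i, (0 < i <= m)%N -> 0 <= crd x i) /\
    (forall i, (i <= m)%N -> al i * crd x i + be i * crd x i.+1 <= ga i)].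

Definition pos_coefs :=
  forall i, (i <= m)%N -> [/\ 0 < al i, 0 < be i & 0 < ga i].
Hypothesis coefs : pos_coefs.

Lemma poly_ge0 x i : poly x -> 0 <= crd x i.
Proof.
move=> [x0 _]; case: i => [|i]; first by rewrite crd0.
have [im|mi] := leqP i.+1 m; first exact: x0.
by rewrite crd_out.
Qed.

(** The constraints have positive coefficients, hence are monotone in each coordinate. *)
Lemma poly_down x y : poly x ->
  (forall i, (0 < i <= m)%N -> 0 <= crd y i <= crd x i) -> poly y.
Proof.
move=> [x0 xg] yx.
have yx' i : 0 <= crd y i <= crd x i.
  case: i => [|i]; first by rewrite !crd0 lexx.
  have [im|mi] := leqP i.+1 m; first exact: yx.
  by rewrite !crd_out// lexx.
split=> [i /yx/andP[]//|i im]; apply: le_trans (xg _ im).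
have [a0 b0 _] := coefs im.
by apply: lerD; rewrite ler_pM2l//; [case/andP: (yx' i)|case/andP: (yx' i.+1)].
Qed.

Lemma poly_glue h a b q : (h <= m)%N -> poly a -> poly b ->
  (forall i, (i <= h)%N -> crd q i = crd a i) ->
  (forall i, (h < i)%N -> crd q i = crd b i) ->
  al h * crd q h + be h * crd q h.+1 <= ga h -> poly q.
Proof.
move=> hm pa pb qa qb qh; split=> [i im|i im].
  by have [/qa ->|/qb ->] := leqP i h; exact: poly_ge0.
have [ih|hi|->//] := ltngtP i h.
  by rewrite !qa// 1?ltnW//; case: pa => _; exact.
by rewrite !qb// 1?ltnW//; case: pb => _; exact.
Qed.

Lemma poly_lcap x i : poly x -> (i <= m)%N -> al i * crd x i <= ga i.
Proof.
move=> px im; have [_ b0 _] := coefs im; case: (px) => _ /(_ _ im).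
by apply: le_trans; rewrite lerDl mulr_ge0 ?(ltW b0) ?(poly_ge0 _ px).
Qed.

Lemma poly_rcap x i : poly x -> (i <= m)%N -> be i * crd x i.+1 <= ga i.
Proof.
move=> px im; have [a0 _ _] := coefs im; case: (px) => _ /(_ _ im).
by apply: le_trans; rewrite lerDr mulr_ge0 ?(ltW a0) ?(poly_ge0 _ px).
Qed.

Lemma measurable_poly : measurable poly.
Proof.
have mle (f g : vec R m -> R) : measurable_fun setT f -> measurable_fun setT g ->
    measurable [set x | f x <= g x].
  by move=> mf mg; rewrite -[X in measurable X]setTI; exact: measurable_fun_le.
rewrite (_ : poly =
  (\bigcap_(i in [set i | (0 < i <= m)%N]) [set x | 0 <= crd x i]) `&`
  (\bigcap_(i in [set i | (i <= m)%N])
     [set x | al i * crd x i + be i * crd x i.+1 <= ga i])); last first.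
  by apply/seteqP; split => x [h1 h2]; split.
apply: measurableI; apply: bigcap_measurableType => i _; apply: mle => //.
- exact: measurable_crd.
- by apply: measurable_funD; apply: measurable_funM => //; exact: measurable_crd.
Qed.

Local Open Scope ereal_scope.

Definition ind x : \bar R := (\1_poly x)%:E.

Lemma ind1 x : poly x -> ind x = 1.
Proof. by move=> px; rewrite /ind indicE mem_set. Qed.

Lemma ind0 x : ~ poly x -> ind x = 0.
Proof. by move=> px; rewrite /ind indicE memNset. Qed.

Lemma ind_neq0 x : ind x != 0 -> poly x.
Proof. by move=> ix; apply: contrapT => /ind0 ix0; rewrite ix0 eqxx in ix. Qed.

Lemma mnn_ind : mnn ind.
Proof.
split; last by move=> x; rewrite lee_fin.
by apply/measurable_EFinP; apply: measurable_indic; exact: measurable_poly.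
Qed.

Lemma le_ind x y : (poly x -> poly y) -> ind x <= ind y.
Proof.
move=> xy; have [/[dup] px /xy py|/ind0 ->] := pselect (poly x).
  by rewrite !ind1.
by have [_] := mnn_ind; exact.
Qed.

Lemma margs_ind_neq0 t x : coords (m := m) t -> margs t ind x != 0 ->
  exists2 y, agree_off t y x & poly y.
Proof. by move=> tm /(margs_neq0 tm)[y yx /ind_neq0 py]; exists y. Qed.

(** Lowering a coordinate keeps a point in the down-set. This is the monotonicity of conditional
    densities on which [half_mass] relies. *)
Lemma margs_ind_upd_le t x j u v : coords (m := m) t -> (0 < j <= m)%N ->
  j \notin t -> (0 <= u <= v)%R ->
  margs t ind (upd x j v) <= margs t ind (upd x j u).
Proof.
move=> tm jm jt /andP[u0 uv]; rewrite !margs_upd//.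
have mnnu a : mnn (fun y => ind (upd y j a)).
  split; last by move=> y; have [_] := mnn_ind; exact.
  have [mi _] := mnn_ind; apply: (measurableT_comp mi).
  apply: (measurableT_comp (measurable_upd j)
    (_ : measurable_fun setT (fun y : vec R m => (y, a)))).
  exact: pair2_measurable.
apply: le_margs => // y _; apply: le_ind => pv; apply: (poly_down pv) => i im.
rewrite !crd_upd//; case: eqVneq => [_|ij]; first by rewrite u0.
by have := poly_ge0 i pv; rewrite crd_upd// (negbTE ij) lexx andbT.
Qed.

Lemma margs_ind_upd_neq0 t x j u : coords (m := m) t -> (0 < j <= m)%N ->
  j \notin t -> margs t ind (upd x j u) != 0 ->
  [/\ (0 <= u)%R, (al j * u <= ga j)%R & (be j.-1 * u <= ga j.-1)%R].
Proof.
move=> tm jm jt /(margs_ind_neq0 tm)[y yx py].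
have <- : crd y j = u by rewrite yx// crd_upd// eqxx.
have [j0 jm'] := andP jm.
split; [exact: poly_ge0|exact: poly_lcap|].
by rewrite -{2}(prednK j0) poly_rcap// (leq_trans (leq_pred _)).
Qed.

Lemma margs_ind_fin t : coords (m := m) t -> uniq t ->
  exists C : R, (0 <= C)%R /\ forall x, margs t ind x <= C%:E.
Proof.
elim: t => [_ _|j t IHt /= /andP[jm tm] /andP[jt ut]].
  exists 1%R; split => // x /=; rewrite lee_fin indicE.
  by case: (_ \in _).
have [C [C0 HC]] := IHt tm ut.
have [j0 jm'] := andP jm; have [a0 b0 g0] := coefs jm'.
pose U := (ga j / al j)%R; have U0 : (0 <= U)%R by rewrite divr_ge0// ltW.
exists (C * U)%R; split => [|x]; first exact: mulr_ge0.
apply: (@le_trans _ _ (\int[@lebesgue_measure R]_u (C%:E * (\1_(`[0%R, U]%classic) u)%:E))).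
  apply: ge0_le_integral => //.
  - by move=> u _; apply: margs_ge0; exact: mnn_ind.
  - by apply: measurable_fun_upd; apply: mnn_margs; exact: mnn_ind.
  - apply: measurable_funeM; apply/measurable_EFinP.
    by apply: measurable_indic; exact: measurable_itv.
  - move=> u _; have [->|/(margs_ind_upd_neq0 tm jm jt)[u0 uU _]] :=
      eqVneq (margs t ind (upd x j u)) 0; first by rewrite mule_ge0// lee_fin.
    rewrite indicE mem_set ?mule1// /= in_itv /= u0 /U.
    by rewrite ler_pdivlMr// mulrC.
rewrite ge0_integralZl_EFin//; last first.
  by apply/measurable_EFinP; apply: measurable_indic; exact: measurable_itv.
have -> : \int[@lebesgue_measure R]_u (\1_(`[0%R, U]%classic) u)%:E = U%:E.
  rewrite integral_indic// setIT.
  have := lebesgue_measure_itv `[0%R, U]; rewrite /= lte_fin => ->.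
  by case: ltP => U'; rewrite ?oppr0 ?adde0//; congr EFin; apply/le_anti/andP.
by rewrite EFinM.
Qed.

Lemma margs_ind_lty t x : coords (m := m) t -> uniq t -> margs t ind x < +oo.
Proof.
by move=> tm ut; have [C [_ /(_ x) h]] := margs_ind_fin tm ut;
  apply: le_lt_trans h _; rewrite ltry.
Qed.

End polytope.

(** * Influence of a coordinate on a chain of coordinates *)

Section chain.
Context {R : realType} (m : nat) (al be ga : nat -> R).
Implicit Types (x y : vec R m) (i j s e h : nat) (t : seq nat).
Hypothesis coefs : pos_coefs m al be ga.
Variables (F : vec R m -> \bar R) (d : nat -> R).
Local Notation poly := (poly al be ga).
Local Notation ind := (ind al be ga).
Local Notation mu := (@lebesgue_measure R).
Hypothesis mF : mnn F.
Hypothesis F1 : forall x, (F x <= 1)%E.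
Hypothesis d0 : forall i, 0 <= d i.

Definition hamming x y : R :=
  \sum_(i < m) d i.+1 * (crd x i.+1 != crd y i.+1)%:R.

Lemma hamming_ge0 x y : 0 <= hamming x y.
Proof. by apply: sumr_ge0 => i _; rewrite mulr_ge0. Qed.

Lemma le_hamming x y x' y' :
  (forall i, (0 < i <= m)%N -> crd x i = crd y i -> crd x' i = crd y' i) ->
  hamming x' y' <= hamming x y.
Proof.
move=> xy; apply: ler_sum => i _; apply: ler_wpM2l => //.
have im : (0 < i.+1 <= m)%N by rewrite /= ltn_ord.
rewrite ler_nat; have [/(xy _ im) ->|_] := eqVneq (crd x i.+1) (crd y i.+1).
  by rewrite eqxx.
by rewrite leq_b1.
Qed.

Lemma hamming_upd x y j u u' : (0 < j <= m)%N ->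
  hamming (upd x j u) (upd y j u') <= hamming x y + d j.
Proof.
move=> jm; have jm' : (j.-1 < m)%N by case: j jm.
have jE : (Ordinal jm').+1 = j by case: j jm jm'.
rewrite /hamming (bigD1 (Ordinal jm'))//= [in leRHS](bigD1 (Ordinal jm'))//= jE addrAC.
apply: lerD; last first.
  apply: ler_sum => i ij; rewrite !crd_upd//.
  suff -> : (i.+1 == j) = false by [].
  by apply: contraNF ij => /eqP ij; apply/eqP/val_inj; rewrite /= -ij.
apply: (@le_trans _ _ (d j)); last by rewrite lerDr mulr_ge0.
by rewrite -[leRHS]mulr1 ler_wpM2l// lern1 leq_b1.
Qed.

Lemma hamming_upd_same x y j u : (0 < j <= m)%N ->
  hamming (upd x j u) (upd y j u) <= hamming x y.
Proof.
move=> jm; apply: le_hamming => i im; rewrite !crd_upd//.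
by case: eqP.
Qed.

Hypothesis lipF : forall x y, poly x -> poly y ->
  (F x <= F y + (hamming x y)%:E)%E.

Local Open Scope ereal_scope.

Definition Find x := F x * ind x.

Lemma mnn_Find : mnn Find.
Proof.
have [mi i0] := mnn_ind m al be ga; have [mf f0] := mF.
by split => [|x]; [exact: emeasurable_funM|exact: mule_ge0].
Qed.

Lemma margs_le_ind t x : coords (m := m) t -> margs t Find x <= margs t ind x.
Proof.
move=> tm; apply: le_margs => //; [exact: mnn_Find|exact: mnn_ind|].
move=> y _; rewrite /Find -[leRHS]mul1e lee_wpmul2r//.
by have [_] := mnn_ind m al be ga; exact.
Qed.

(** The conditional mean of [F] on the slice through [x]. On a null slice the quotient is 0, and
    [avgE] still holds there because [Find] is dominated by [ind]. *)
Definition avg t x : R := (fine (margs t Find x) / fine (margs t ind x))%R.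

Lemma avg_ge0 t x : (0 <= avg t x)%R.
Proof.
rewrite divr_ge0// fine_ge0//; apply: margs_ge0; [exact: mnn_Find|exact: mnn_ind].
Qed.

Lemma margs_ind_fin_num t x : coords (m := m) t -> uniq t -> margs t ind x \is a fin_num.
Proof.
move=> tm ut; rewrite ge0_fin_numE ?margs_ind_lty//.
by apply: margs_ge0; exact: mnn_ind.
Qed.

Lemma margs_Find_fin_num t x : coords (m := m) t -> uniq t -> margs t Find x \is a fin_num.
Proof.
move=> tm ut; rewrite ge0_fin_numE; last by apply: margs_ge0; exact: mnn_Find.
by apply: le_lt_trans (margs_le_ind _ tm) _; exact: margs_ind_lty.
Qed.

Lemma avgE t x : coords (m := m) t -> uniq t ->
  margs t Find x = (avg t x)%:E * margs t ind x.
Proof.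
move=> tm ut; have fW := margs_ind_fin_num x tm ut.
have fV := margs_Find_fin_num x tm ut.
have [W0|W0] := eqVneq (margs t ind x) 0.
  rewrite W0 mule0; apply/eqP; rewrite eq_le.
  rewrite -{1}W0 margs_le_ind//=.
  by apply: margs_ge0; exact: mnn_Find.
rewrite -{1}(fineK fV) -{1}(fineK fW) -EFinM /avg divfK//.
by rewrite fine_eq0.
Qed.

(** The points of the two slices are paired by giving them the same coordinates in [t], so
    everything reduces to the integrands. *)
Let margs_compare t x y (c : R) : coords (m := m) t -> (0 <= c)%R ->
  (forall x' y', agree_off t x' x -> agree_off t y' y ->
    (forall i, i \in t -> crd x' i = crd y' i) ->
    (poly x' <-> poly y') /\ (poly x' -> F x' <= F y' + c%:E)) ->
  margs t ind x = margs t ind y /\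
  margs t Find x <= margs t Find y + c%:E * margs t ind y.
Proof.
move=> + c0; elim: t x y => [|j t IHt] x y /=.
  move=> _ /(_ x y)[]// pxy Fxy; rewrite /Find.
  have [px|px] := pselect (poly x); last first.
    by rewrite !ind0 ?mule0 ?adde0// -pxy.
  by rewrite !ind1 -?pxy// !mule1; split => //; exact: Fxy.
move=> /andP[jm tm] xy.
have xyu u : margs t ind (upd x j u) = margs t ind (upd y j u) /\
    margs t Find (upd x j u) <=
    margs t Find (upd y j u) + c%:E * margs t ind (upd y j u).
  apply: IHt => // x' y' x'x y'y x'y'; apply: xy.
  - exact: agree_off_upd x'x.
  - exact: agree_off_upd y'y.
  - move=> i; rewrite inE => /predU1P[->|]; last exact: x'y'.
    have [/x'y'//|jt] := boolP (j \in t).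
    by rewrite x'x// y'y// !crd_upd// !eqxx.
split; first by apply: eq_integral => u _; exact: (xyu u).1.
have mV z : measurable_fun setT (fun u : measurableTypeR R => margs t Find (upd z j u)).
  by apply: measurable_fun_upd; apply: mnn_margs; exact: mnn_Find.
have mW z : measurable_fun setT (fun u : measurableTypeR R => margs t ind (upd z j u)).
  by apply: measurable_fun_upd; apply: mnn_margs; exact: mnn_ind.
have V0 z : 0 <= margs t Find z by apply: margs_ge0; exact: mnn_Find.
have W0 z : 0 <= margs t ind z by apply: margs_ge0; exact: mnn_ind.
rewrite /marg -ge0_integralZl_EFin// -ge0_integralD//.
- apply: ge0_le_integral => //.
  + by apply: emeasurable_funD => //; exact: measurable_funeM.
  + by move=> u _; exact: (xyu u).2.
- by move=> u _; rewrite mule_ge0.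
- exact: measurable_funeM.
Qed.

Definition blk s e := iota s.+1 (e - s).

Lemma mem_blk s e i : (i \in blk s e) = (s < i <= e)%N.
Proof. by rewrite mem_iota; lia. Qed.

Lemma coords_blk s e : (e <= m)%N -> coords (m := m) (blk s e).
Proof. by move=> em; apply/allP => i; rewrite mem_blk; lia. Qed.

Lemma uniq_blk s e : uniq (blk s e). Proof. exact: iota_uniq. Qed.

Lemma blk_cons s e : (s < e)%N -> blk s e = s.+1 :: blk s.+1 e.
Proof.
by move=> se; rewrite /blk (_ : e - s = (e - s.+1).+1)%N //; lia.
Qed.

(* The constraint between the coordinates [h] and [h.+1] is the only one through
   which the coordinates up to [h] act on the others. *)
Lemma cut_compare h s e x y (a b : vec R m) : (h <= s)%N -> (s <= e <= m)%N ->
  poly a -> poly b ->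
  (forall i, (i <= h)%N -> crd x i = crd a i) ->
  (forall i, (i <= h)%N -> crd y i = crd b i) ->
  (forall i, (h < i <= s)%N || (e < i)%N -> crd x i = crd y i) ->
  (forall v, (h < s)%N -> v = crd x h.+1 ->
     (al h * crd x h + be h * v <= ga h)%R /\ (al h * crd y h + be h * v <= ga h)%R) ->
  (h = s -> crd x h = crd y h) ->
  margs (blk s e) ind x = margs (blk s e) ind y /\
  margs (blk s e) Find x <=
    margs (blk s e) Find y + (hamming x y)%:E * margs (blk s e) ind y.
Proof.
move=> hs /andP[se em] pa pb xa yb xy hlt heq.
apply: margs_compare; [exact: coords_blk|exact: hamming_ge0|].
move=> x' y' x'x y'y x'y'.
have x'_off i : ~~ (s < i <= e)%N -> crd x' i = crd x i.
  by rewrite -mem_blk; exact: x'x.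
have y'_off i : ~~ (s < i <= e)%N -> crd y' i = crd y i.
  by rewrite -mem_blk; exact: y'y.
have x'y'_r i : (h < i)%N -> crd x' i = crd y' i.
  move=> hi; have [ib|ib] := boolP (i \in blk s e); first exact: x'y'.
  by move: ib; rewrite mem_blk => ib; rewrite x'_off// y'_off// xy//; lia.
have x'_l i : (i <= h)%N -> crd x' i = crd x i by move=> ih; apply: x'_off; lia.
have y'_l i : (i <= h)%N -> crd y' i = crd y i by move=> ih; apply: y'_off; lia.
have hx : (h < s)%N -> crd x' h.+1 = crd x h.+1 by move=> ?; apply: x'_off; lia.
(* Beyond [h] the two points coincide; the left part of the other point comes from [a] or [b], and
   [poly_glue] only asks for the one constraint across the cut. *)
have pxy : poly x' <-> poly y'.
  split=> p'.
  - apply: (poly_glue (h := h) _ pb p').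
    + lia.
    + by move=> i ih; rewrite y'_l// yb.
    + by move=> i /x'y'_r.
    + rewrite -(x'y'_r h.+1)// y'_l//; move: hs; rewrite leq_eqVlt => /predU1P[hs|hs].
        by rewrite -heq// -(x'_l h)//; case: p' => _; apply; lia.
      by rewrite hx//; case: (hlt _ hs erefl).
  - apply: (poly_glue (h := h) _ pa p').
    + lia.
    + by move=> i ih; rewrite x'_l// xa.
    + by move=> i /x'y'_r.
    + rewrite x'_l//; move: hs; rewrite leq_eqVlt => /predU1P[hs|hs].
        by rewrite heq// -(y'_l h)// (x'y'_r h.+1)//; case: p' => _; apply; lia.
      by rewrite hx//; case: (hlt _ hs erefl).
split => // px'; apply: (le_trans (lipF px' (pxy.1 px'))).
apply: leeD => //; rewrite lee_fin; apply: le_hamming => i im xyi.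
have [ih|hi] := leqP i h; last exact: x'y'_r.
by rewrite x'_l// y'_l.
Qed.

(** The averages over the block ignore its coordinates, so these may be set to 0. Then any value of
    coordinate [s.+1] that leaves a nonnull slice yields a point of the polytope again, which keeps
    the induction going. *)
Definition adm s e x := poly x /\ forall i, (s < i <= e)%N -> crd x i = 0%R.

Lemma adm_upd s e x u : (s < e <= m)%N -> adm s e x ->
  margs (blk s.+1 e) ind (upd x s.+1 u) != 0 -> adm s.+1 e (upd x s.+1 u).
Proof.
move=> /andP[se em] [px x0] /(margs_ind_neq0 (coords_blk _ em))[y yx py].
have sm : (0 < s.+1 <= m)%N by lia.
split; last by move=> i ie; rewrite crd_upd// ifN ?x0//; lia.
apply: (poly_down coefs py) => i im.
have [ib|ib] := boolP (i \in blk s.+1 e).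
  move: (ib); rewrite mem_blk => ie.
  by rewrite crd_upd// ifN ?x0 ?lexx ?(poly_ge0 _ py)//; lia.
by rewrite -yx// lexx (poly_ge0 _ py).
Qed.

Let mnn1_upd G x j : mnn G -> mnn1 (fun u => G (upd x j u)).
Proof. by move=> mG; split; [exact: measurable_fun_upd|move=> u; case: mG]. Qed.

Let mnn1_ind t x j : mnn1 (fun u => margs t ind (upd x j u)).
Proof. by apply: (mnn1_upd x j); apply: mnn_margs; exact: mnn_ind. Qed.

Let mnn1_Find t x j : mnn1 (fun u => margs t Find (upd x j u)).
Proof. by apply: (mnn1_upd x j); apply: mnn_margs; exact: mnn_Find. Qed.

Let margs_blkS s e G x : (s < e)%N ->
  margs (blk s e) G x = \int[mu]_u margs (blk s.+1 e) G (upd x s.+1 u).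
Proof. by move=> se; rewrite blk_cons. Qed.

Let W_gt0 s e x : (e <= m)%N -> margs (blk s e) ind x != 0 ->
  0 < margs (blk s e) ind x < +oo.
Proof.
move=> em W0; rewrite margs_ind_lty ?uniq_blk ?coords_blk// andbT lt0e W0.
by apply: margs_ge0; exact: mnn_ind.
Qed.

Lemma avg_le s e x (c : R) : (s < e <= m)%N -> (0 <= c)%R ->
  margs (blk s e) ind x != 0 ->
  (forall u, margs (blk s.+1 e) ind (upd x s.+1 u) != 0 ->
    avg (blk s.+1 e) (upd x s.+1 u) <= c)%R ->
  (avg (blk s e) x <= c)%R.
Proof.
move=> /andP[se em] c0 W0 Tc.
have cb := coords_blk _ em; have ub := uniq_blk.
have /andP[Wp _] := W_gt0 em W0.
rewrite -lee_fin -(lee_pmul2r _ Wp) ?margs_ind_fin_num//.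
rewrite -avgE// !margs_blkS// -ge0_integralZl_EFin//; last by case: (mnn1_ind (blk s.+1 e) x s.+1).
- apply: ge0_le_integral => //.
  + by move=> u _; case: (mnn1_Find (blk s.+1 e) x s.+1).
  + by case: (mnn1_Find (blk s.+1 e) x s.+1).
  + by apply: measurable_funeM; case: (mnn1_ind (blk s.+1 e) x s.+1).
  + move=> u _; rewrite avgE//.
    have [->|Wu] := eqVneq (margs (blk s.+1 e) ind (upd x s.+1 u)) 0.
      by rewrite !mule0.
    apply: lee_wpmul2r; first by case: (mnn1_ind (blk s.+1 e) x s.+1).
    by rewrite lee_fin Tc.
- by move=> u _; case: (mnn1_ind (blk s.+1 e) x s.+1).
Qed.

Lemma avg_ge s e x (c : R) : (s < e <= m)%N ->
  margs (blk s e) ind x != 0 ->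
  (forall u, margs (blk s.+1 e) ind (upd x s.+1 u) != 0 ->
    c <= avg (blk s.+1 e) (upd x s.+1 u))%R ->
  (c <= avg (blk s e) x)%R.
Proof.
move=> /andP[se em] W0 Tc.
have [c0|/ltW c0] := leP 0%R c; last by apply: le_trans c0 (avg_ge0 _ _).
have cb := coords_blk _ em; have ub := uniq_blk.
have /andP[Wp _] := W_gt0 em W0.
rewrite -lee_fin -(lee_pmul2r _ Wp) ?margs_ind_fin_num//.
rewrite -avgE// !margs_blkS// -ge0_integralZl_EFin//; last by case: (mnn1_ind (blk s.+1 e) x s.+1).
- apply: ge0_le_integral => //.
  + by move=> u _; rewrite mule_ge0//; case: (mnn1_ind (blk s.+1 e) x s.+1).
  + by apply: measurable_funeM; case: (mnn1_ind (blk s.+1 e) x s.+1).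
  + by case: (mnn1_Find (blk s.+1 e) x s.+1).
  + move=> u _; rewrite avgE//.
    have [->|Wu] := eqVneq (margs (blk s.+1 e) ind (upd x s.+1 u)) 0.
      by rewrite !mule0.
    apply: lee_wpmul2r; first by case: (mnn1_ind (blk s.+1 e) x s.+1).
    by rewrite lee_fin Tc.
- by move=> u _; case: (mnn1_ind (blk s.+1 e) x s.+1).
Qed.

Let half_blk s e x (U : R) : (s < e <= m)%N -> (0 <= U)%R ->
  (forall u, margs (blk s.+1 e) ind (upd x s.+1 u) != 0 -> u <= U)%R ->
  \int[mu]_(u in ~` `[0%R, (U / 2)%R]) margs (blk s.+1 e) ind (upd x s.+1 u) <=
  \int[mu]_(u in `[0%R, (U / 2)%R]) margs (blk s.+1 e) ind (upd x s.+1 u).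
Proof.
move=> /andP[se em] U0 WU.
have cb := coords_blk s.+1 em.
have sm : (0 < s.+1 <= m)%N by lia.
have sb : s.+1 \notin blk s.+1 e by rewrite mem_blk; lia.
have [mW W0] := mnn1_ind (blk s.+1 e) x s.+1.
apply: (half_mass mW W0 U0).
- move=> u u0; apply: contrapT => /eqP /(margs_ind_upd_neq0 coefs cb sm sb)[].
  by rewrite leNgt u0.
- by move=> u Uu; apply: contrapT => /eqP /WU; rewrite leNgt Uu.
- by move=> u v u0 uv; apply: margs_ind_upd_le => //; rewrite u0.
Qed.

Variable psi : nat -> R.
Hypothesis psi0 : forall s, (0 <= psi s)%R.
Hypothesis psi_step : forall s,
  (d s.+1 + psi s.+1 / 2 + (d s.+2 + psi s.+2) / 4 <= psi s)%R.

(** An empty block transmits nothing: this is what makes the induction on the length start. *)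
Let psi' s e := (if (s < e)%N then psi s else 0)%R.

Let psi'0 s e : (0 <= psi' s e)%R. Proof. by rewrite /psi'; case: ifP. Qed.

Let psi'_le s e : (psi' s e <= psi s)%R. Proof. by rewrite /psi'; case: ifP. Qed.

(** Induction on the length of the block. The first coordinate may disagree, at cost [d s.+1]. If it
    lies in the lower half of its range in both slices, the second coordinate is compared with the
    same weight on the lower half of its own range, and only [(d s.+2 + psi s.+2) / 2] remains;
    otherwise the price is [psi s.+1]. Averaging the two prices gives the left side of
    [psi_step]. *)
Let chain_influence' s e x y : (s <= e <= m)%N -> adm s e x -> adm s e y ->
  (forall i, (e < i)%N -> crd x i = crd y i) ->
  margs (blk s e) ind x != 0 -> margs (blk s e) ind y != 0 ->
  (avg (blk s e) x <= avg (blk s e) y + (hamming x y + psi' s e))%R.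
Proof.
have [n] := ubnP (e - s)%N; elim: n s x y => // n IHn s x y.
rewrite ltnS => esn /andP[se em] ax ay xye Wx Wy.
move: se; rewrite leq_eqVlt => /predU1P[seE|se].
  subst e; rewrite /psi' ltnn addr0.
  have avg0 z : poly z -> avg (blk s s) z = fine (F z).
    move=> pz; rewrite /avg /blk subnn.
    rewrite -[margs _ Find z]/(F z * ind z) -[margs _ ind z]/(ind z) ind1// mule1.
    exact: divr1.
  have [px _] := ax; have [py _] := ay; rewrite !avg0//.
  have fF z : F z \is a fin_num.
    have [_ f0] := mF; rewrite ge0_fin_numE//.
    by apply: le_lt_trans (F1 z) _; rewrite ltry.
  by rewrite -lee_fin EFinD !fineK//; exact: lipF.
have sem : (s < e <= m)%N by rewrite se.
have en1 : (e - s.+1 < n)%N by lia.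
have en2 : (s.+1 < e)%N -> (e - s.+2 < n)%N by lia.
have sm : (0 < s.+1 <= m)%N by lia.
have [px x0] := ax; have [py y0] := ay.
have C0 := hamming_ge0 x y.
have sb : s.+1 \notin blk s.+1 e by rewrite mem_blk; lia.
have cb k := coords_blk k em.
have ub := uniq_blk.
have hu u u' : (hamming (upd x s.+1 u) (upd y s.+1 u') <= hamming x y + d s.+1)%R.
  exact: hamming_upd.
have agr u u' i : (e < i)%N -> crd (upd x s.+1 u) i = crd (upd y s.+1 u') i.
  by move=> ei; rewrite !crd_upd// !ifN ?xye//; lia.
have step1 u u' : margs (blk s.+1 e) ind (upd x s.+1 u) != 0 ->
    margs (blk s.+1 e) ind (upd y s.+1 u') != 0 ->
    (avg (blk s.+1 e) (upd x s.+1 u) <= avg (blk s.+1 e) (upd y s.+1 u') +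
       (hamming x y + d s.+1 + psi' s.+1 e))%R.
  move=> Wu Wu'; apply: (@le_trans _ _ (avg (blk s.+1 e) (upd y s.+1 u') +
     (hamming (upd x s.+1 u) (upd y s.+1 u') + psi' s.+1 e)))%R.
    apply: IHn; [done|done|exact: adm_upd|exact: adm_upd|exact: agr|done|done].
  by rewrite !lerD2l lerD2r.
have W_ t (z : vec R m) : margs t ind z \is a fin_num -> margs t ind z != 0 -> 0 < margs t ind z < +oo.
  move=> fz z0; rewrite lt0e z0 -ge0_fin_numE ?fz ?andbT /=;
  by apply: margs_ge0; exact: mnn_ind.
have psis : psi' s e = psi s by rewrite /psi' se.
(* With a single coordinate left, its disagreement is the whole cost. *)
have [e1|e2] := leqP e s.+1.
  have psi1 : psi' s.+1 e = 0%R by rewrite /psi' ifF//; lia.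
  suff : (avg (blk s e) x - (hamming x y + d s.+1) <= avg (blk s e) y)%R.
    have := psi_step s; have := psi0 s.+1; have := psi0 s.+2; have := d0 s.+2.
    by rewrite psis; lra.
  apply: avg_ge => // u' Wu'; rewrite lerBlDr; apply: avg_le => //.
    by rewrite addr_ge0 ?avg_ge0// addr_ge0.
  by move=> u Wu; have := step1 _ _ Wu Wu'; rewrite psi1 addr0.
have s2m : (0 < s.+2 <= m)%N by lia.
have s2b : s.+2 \notin blk s.+2 e by rewrite mem_blk; lia.
have [a0 b0 g0] := coefs (ltac:(lia) : (s.+1 <= m)%N).
(* The largest values that the constraint between the coordinates [s.+1] and [s.+2] allows to each
   of them alone. Half of [U] together with half of [Z] makes it an equality. *)
pose U := (ga s.+1 / al s.+1)%R; pose Z := (ga s.+1 / be s.+1)%R.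
have U0 : (0 <= U)%R by rewrite divr_ge0// ltW.
have Z0 : (0 <= Z)%R by rewrite divr_ge0// ltW.
have capU (z : vec R m) u : margs (blk s.+1 e) ind (upd z s.+1 u) != 0 -> (u <= U)%R.
  move=> Wu; have [_ h _] := margs_ind_upd_neq0 coefs (cb _) sm sb Wu.
  by rewrite /U ler_pdivlMr// mulrC.
have capZ (z : vec R m) u : margs (blk s.+2 e) ind (upd z s.+2 u) != 0 -> (u <= Z)%R.
  move=> Wu; have [_ _ h] := margs_ind_upd_neq0 coefs (cb _) s2m s2b Wu.
  by rewrite /Z ler_pdivlMr// mulrC.
have step2 u u' : (0 <= u <= U / 2)%R -> (0 <= u' <= U / 2)%R ->
    margs (blk s.+1 e) ind (upd x s.+1 u) != 0 ->
    margs (blk s.+1 e) ind (upd y s.+1 u') != 0 ->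
    (avg (blk s.+1 e) (upd x s.+1 u) <= avg (blk s.+1 e) (upd y s.+1 u') +
       (hamming x y + d s.+1 + (d s.+2 + psi' s.+2 e) / 2))%R.
  move=> /andP[u0 uU] /andP[u'0 u'U] Wu Wu'.
  have := adm_upd sem ax Wu; have := adm_upd sem ay Wu'; have := hu u u'.
  have := agr u u'.
  have : crd (upd x s.+1 u) s.+1 = u by rewrite crd_upd// eqxx.
  have : crd (upd y s.+1 u') s.+1 = u' by rewrite crd_upd// eqxx.
  move: (upd x s.+1 u) (upd y s.+1 u') Wu Wu' => x1 y1 Wu Wu' y1s x1s agr1 h1 ay1 ax1.
  have H0 := hamming_ge0 x1 y1.
  have s1em : (s.+1 < e <= m)%N by rewrite e2.
  suff : (avg (blk s.+1 e) x1 <= avg (blk s.+1 e) y1 +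
     (hamming x1 y1 + (hamming x1 y1 + d s.+2 + psi' s.+2 e)) / 2)%R by lra.
  have hz z z' : (hamming (upd x1 s.+2 z) (upd y1 s.+2 z') <= hamming x1 y1 + d s.+2)%R.
    exact: hamming_upd.
  have agrz z z' i : (e < i)%N -> crd (upd x1 s.+2 z) i = crd (upd y1 s.+2 z') i.
    move=> ei; rewrite !crd_upd// (gtn_eqF (leq_ltn_trans e2 ei)).
    exact: agr1.
  (* For such [z] the linking constraint holds in both slices whatever the earlier coordinates are,
     so the remaining volumes agree and no new disagreement arises. *)
  have cmp z : (0 <= z <= Z / 2)%R ->
      margs (blk s.+2 e) ind (upd x1 s.+2 z) = margs (blk s.+2 e) ind (upd y1 s.+2 z) /\
      margs (blk s.+2 e) Find (upd x1 s.+2 z) <=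
      margs (blk s.+2 e) Find (upd y1 s.+2 z) +
        (hamming x1 y1)%:E * margs (blk s.+2 e) ind (upd y1 s.+2 z).
    move=> /andP[z0 zZ].
    have cross v : (v <= U / 2)%R -> (al s.+1 * v + be s.+1 * z <= ga s.+1)%R.
      move=> vU.
      have : (al s.+1 * v <= al s.+1 * (U / 2))%R by rewrite ler_pM2l.
      have : (be s.+1 * z <= be s.+1 * (Z / 2))%R by rewrite ler_pM2l.
      have -> : (al s.+1 * (U / 2) = ga s.+1 / 2)%R by rewrite /U; field; rewrite gt_eqF.
      have -> : (be s.+1 * (Z / 2) = ga s.+1 / 2)%R by rewrite /Z; field; rewrite gt_eqF.
      lra.
    have [] := @cut_compare s.+1 s.+2 e (upd x1 s.+2 z) (upd y1 s.+2 z) x1 y1.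
    - exact: leqnSn.
    - by rewrite e2.
    - by case: ax1.
    - by case: ay1.
    - by move=> i ih; rewrite crd_upd// ltn_eqF.
    - by move=> i ih; rewrite crd_upd// ltn_eqF.
    - move=> i /orP[|ei]; last exact: agrz.
      by rewrite -eqn_leq => /eqP <-; rewrite !crd_upd// eqxx.
    - move=> v _ ->; rewrite !crd_upd// eqxx ltn_eqF// x1s y1s.
      by split; apply: cross.
    - by move=> /n_Sn.
    move=> -> cmp; split => //; apply: (le_trans cmp).
    apply: leeD => //; apply: lee_wpmul2r.
      by apply: margs_ge0; exact: mnn_ind.
    by rewrite lee_fin hamming_upd_same.
  apply: (@two_scale_same_weight _ `[0%R, (Z / 2)%R]
    (fun z => margs (blk s.+2 e) Find (upd x1 s.+2 z))
    (fun z => margs (blk s.+2 e) ind (upd x1 s.+2 z))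
    (fun z => margs (blk s.+2 e) Find (upd y1 s.+2 z))
    (fun z => margs (blk s.+2 e) ind (upd y1 s.+2 z))
    (fun z => avg (blk s.+2 e) (upd x1 s.+2 z))
    (fun z => avg (blk s.+2 e) (upd y1 s.+2 z)));
    [exact: measurable_itv|exact: mnn1_Find|exact: mnn1_ind|exact: mnn1_Find|
     exact: mnn1_ind|by move=> z; exact: avgE|by move=> z; exact: avgE|
     by move=> z; exact: avg_ge0|by move=> z; exact: avg_ge0|done|
     by rewrite !addr_ge0|idtac..].
  - by rewrite -margs_blkS//; apply: W_ => //; exact: margs_ind_fin_num.
  - by rewrite -margs_blkS//; apply: W_ => //; exact: margs_ind_fin_num.
  - by apply: half_blk => // z; exact: capZ.
  - by apply: half_blk => // z; exact: capZ.
  - by rewrite -!margs_blkS// avgE.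
  - by rewrite -!margs_blkS// avgE.
  - move=> z z' Wz Wz'; apply: (@le_trans _ _ (avg (blk s.+2 e) (upd y1 s.+2 z') +
      (hamming (upd x1 s.+2 z) (upd y1 s.+2 z') + psi' s.+2 e)))%R.
      apply: IHn; [exact: en2|by rewrite e2|exact: adm_upd|exact: adm_upd|
        exact: agrz|done|done].
    by rewrite !lerD2l lerD2r.
  - by move=> z; rewrite /= in_itv/= => /cmp[].
  - by move=> z; rewrite /= in_itv/= => /cmp[].
have : (avg (blk s e) x <= avg (blk s e) y +
   ((hamming x y + d s.+1 + (d s.+2 + psi' s.+2 e) / 2) +
    (hamming x y + d s.+1 + psi' s.+1 e)) / 2)%R.
  (* The weights of coordinate [s.+1] differ in the two slices, even on the lower half; hence the
     pointwise version here and the version with a common weight inside [step2]. *)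
  apply: (@two_scale_pointwise _ `[0%R, (U / 2)%R]
    (fun z => margs (blk s.+1 e) Find (upd x s.+1 z))
    (fun z => margs (blk s.+1 e) ind (upd x s.+1 z))
    (fun z => margs (blk s.+1 e) Find (upd y s.+1 z))
    (fun z => margs (blk s.+1 e) ind (upd y s.+1 z))
    (fun z => avg (blk s.+1 e) (upd x s.+1 z))
    (fun z => avg (blk s.+1 e) (upd y s.+1 z)));
    [exact: measurable_itv|exact: mnn1_Find|exact: mnn1_ind|exact: mnn1_Find|
     exact: mnn1_ind|by move=> z; exact: avgE|by move=> z; exact: avgE|
     by move=> z; exact: avg_ge0|by move=> z; exact: avg_ge0|
     by rewrite !addr_ge0// divr_ge0// addr_ge0|by rewrite !addr_ge0|idtac..].
  - by rewrite -margs_blkS//; apply: W_ => //; exact: margs_ind_fin_num.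
  - by rewrite -margs_blkS//; apply: W_ => //; exact: margs_ind_fin_num.
  - by apply: half_blk => // z; exact: capU.
  - by apply: half_blk => // z; exact: capU.
  - by rewrite -!margs_blkS// avgE.
  - by rewrite -!margs_blkS// avgE.
  - exact: step1.
  - by move=> u u'; rewrite /= !in_itv/=; exact: step2.
move=> h; have := psi_step s; have := psi'_le s.+1 e; have := psi'_le s.+2 e.
by rewrite psis; lra.
Qed.

Lemma chain_influence s e x y : (s <= e <= m)%N -> adm s e x -> adm s e y ->
  (forall i, (e < i)%N -> crd x i = crd y i) ->
  margs (blk s e) ind x != 0 -> margs (blk s e) ind y != 0 ->
  (avg (blk s e) x <= avg (blk s e) y + (hamming x y + psi s))%R.
Proof.
move=> sem ax ay xy Wx Wy; apply: (le_trans (chain_influence' sem ax ay xy Wx Wy)).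
by rewrite !lerD2l.
Qed.

End chain.

(** * Slices *)

Section slices.
Context {R : realType} (m : nat) (al be ga : nat -> R).
Implicit Types (x y p : vec R m) (i j s e : nat) (t : seq nat).
Hypothesis coefs : pos_coefs m al be ga.
Local Notation poly := (poly al be ga).
Local Notation ind := (ind al be ga).

(** A coordinate of a down-set can always be lowered to 0, so it is nonconstant on the slice exactly
    when it is positive somewhere on it. A coordinate of [t] that is not free is thus pinned to
    0. *)
Definition free_in t x : pred nat := fun j =>
  (j \in t) && `[< exists p, [/\ poly p, agree_off t p x & 0 < crd p j] >].

Lemma free_in_forced t x p j : poly p -> agree_off t p x -> j \in t ->
  ~~ free_in t x j -> crd p j = 0.
Proof.
move=> pp px jt; rewrite /free_in jt /= => /asboolPn nf.
apply/eqP; rewrite eq_le (poly_ge0 _ pp) andbT leNgt; apply/negP => pj.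
by apply: nf; exists p.
Qed.

Lemma agree_free_in t x p : poly x -> poly p -> agree_off t p x ->
  forall j, ~~ free_in t x j -> crd p j = crd x j.
Proof.
move=> px pp pxt j; have [jt nf|/pxt//] := boolP (j \in t).
by rewrite (free_in_forced pp pxt jt nf) (free_in_forced px _ jt nf).
Qed.

Definition zero_on t x : vec R m := [tuple (if i.+1 \in t then 0 else tnth x i) | i < m].

Lemma crd_zero_on t x i : crd (zero_on t x) i = if i \in t then 0 else crd x i.
Proof.
case: i => [|i]; first by rewrite !crd0 if_same.
have [im|mi] := ltnP i m; last by rewrite !crd_out ?if_same.
by rewrite (_ : i = Ordinal im :> nat)// !crdS tnth_mktuple.
Qed.

Lemma poly_zero_on t x : poly x -> poly (zero_on t x).
Proof.
move=> px; apply: (poly_down coefs px) => i _; rewrite crd_zero_on.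
by case: ifP; rewrite ?lexx ?(poly_ge0 _ px).
Qed.

Local Open Scope ereal_scope.

(* The box with sides [0, p_j / 2], where p_j > 0 is the value at a free
   coordinate j of some point p of the slice, is contained in the slice. *)
Lemma free_box_gt0 t x : poly x ->
  0 < margs [seq j <- iota 1 m | free_in t x j] ind x.
Proof.
move=> px; rewrite -integral_flat; last exact: mnn_ind.
rewrite integral_indic ?setIT//; last exact: measurable_poly.
have /choice[P hP] : forall j, exists p, free_in t x j ->
    [/\ poly p, agree_off t p x & (0 < crd p j)%R].
  move=> j; have [/andP[_ /asboolP[p hp]]|nf] := boolP (free_in t x j).
    by exists p.
  by exists x.
pose A (i : 'I_m) : set R := if free_in t x i.+1
  then `[0%R, (crd (P i.+1) i.+1 / 2)%R]%classic else [set tnth x i].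
have mA (i : 'I_m) : measurable (A i).
  rewrite /A; case: (free_in t x i.+1); first exact: measurable_itv.
  exact: measurable_set1.
pose box := [set y : vec R m | forall i : 'I_m, A i (tnth y i)].
have boxE (y : vec R m) j : box y -> (0 < j <= m)%N ->
    if free_in t x j then is_true (0 <= crd y j <= crd (P j) j / 2)%R
    else crd y j = crd x j.
  move=> yb; case: j => // j jm; have := yb (Ordinal jm); rewrite /A /=.
  rewrite -!crdS /=; case: ifP => _; last by [].
  by rewrite ?in_itv.
have box_poly : box `<=` poly.
  move=> y yb.
  have y_le j : (0 <= crd y j <= (if free_in t x j then crd (P j) j / 2
      else crd x j))%R.
    case: (posnP j) => [->|j0].
      by rewrite !crd0 mul0r if_same lexx.
    have [jm|mj] := leqP j m.
      have := boxE y j yb; rewrite j0 jm => /(_ isT); case: ifP => // _ ->.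
      by rewrite lexx andbT (poly_ge0 _ px).
    rewrite crd_out// lexx; case: ifP => [/hP[pp _ _]|_].
      by rewrite divr_ge0// (poly_ge0 _ pp).
    by rewrite (poly_ge0 _ px).
  split=> [j jm|i im]; first by case/andP: (y_le j).
  have [a0 b0 g0] := coefs im.
  have /andP[y0 y1] := y_le i; have /andP[y'0 y'1] := y_le i.+1.
  apply: (@le_trans _ _ (al i * (if free_in t x i then crd (P i) i / 2 else crd x i)
    + be i * (if free_in t x i.+1 then crd (P i.+1) i.+1 / 2 else crd x i.+1)))%R.
    by apply: lerD; rewrite ler_pM2l.
  (* Two free neighbours: the halves of their separate maximal values add up to at most [ga i]. One
     free neighbour: its witness point satisfies the constraint and agrees with [x] at the other
     coordinate. None: the constraint of [x] itself. *)
  move: (y'1) (y1).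
  have [fi|fi] := boolP (free_in t x i); have [fi'|fi'] := boolP (free_in t x i.+1).
  - have [pp _ _] := hP _ fi; have [pp' _ _] := hP _ fi'.
    have := poly_lcap coefs pp im; have := poly_rcap coefs pp' im; lra.
  - have [pp ppx p0] := hP _ fi.
    rewrite -(agree_free_in px pp ppx fi').
    have : (al i * (crd (P i) i / 2) <= al i * crd (P i) i)%R by rewrite ler_pM2l//; lra.
    by case: pp => _ /(_ _ im); lra.
  - have [pp ppx p0] := hP _ fi'.
    rewrite -(agree_free_in px pp ppx fi).
    have : (be i * (crd (P i.+1) i.+1 / 2) <= be i * crd (P i.+1) i.+1)%R by rewrite ler_pM2l//; lra.
    by case: pp => _ /(_ _ im); lra.
  - by case: px => _ /(_ _ im).
have mbox : measurable box.
  rewrite (_ : box = \bigcap_(i in [set: 'I_m])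
    ((fun y : vec R m => tnth y i) @^-1` A i)); last first.
    by apply/seteqP; split => y /= H i; [move=> _; exact: H|exact: (H i)].
  apply: fin_bigcap_measurable => // i _.
  by rewrite -[X in measurable X]setTI; apply: measurable_tnth => //; exact: mA.
apply: (@lt_le_trans _ _ (flat_lebesgue (fun i : 'I_m => free_in t x i.+1) x box)); last first.
  by apply: le_measure => //; rewrite inE//; exact: measurable_poly.
rewrite flat_box//; apply: (big_ind (fun z => 0 < z)) => [|y z|i _].
- exact: lte01.
- exact: mule_gt0.
rewrite /A; case: ifPn => [fi|_] /=; last by rewrite diracE mem_set// lte01.
have [_ _ p0] := hP _ fi.
rewrite lebesgue_measure_itv/= lte_fin divr_gt0// -EFinB lte_fin subr0.
by rewrite divr_gt0.
Qed.

End slices.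

(** * Reversal of the order of the coordinates *)

Section reversal.
Context {R : realType} {m : nat}.
Implicit Types (x y : vec R m) (j : nat) (t : seq nat).
Local Open Scope ereal_scope.

Definition rv x : vec R m := [tuple crd x (m.+1 - i.+1) | i < m].

Lemma crd_rv x j : crd (rv x) j = crd x (m.+1 - j).
Proof.
case: j => [|j]; first by rewrite crd0 crd_out.
have [jm|mj] := ltnP j m.
  by rewrite (_ : j = Ordinal jm :> nat)// crdS tnth_mktuple.
by rewrite crd_out// (_ : m.+1 - j.+1 = 0)%N ?crd0//; lia.
Qed.

Lemma rvK : involutive rv.
Proof.
move=> x; apply: vecP => i im; rewrite !crd_rv.
by congr crd; lia.
Qed.

Lemma measurable_rv : measurable_fun setT rv.
Proof.
apply/measurable_fun_tnthP => i.
apply: (@eq_measurable_fun _ _ _ _ _ (fun x : vec R m => crd x (m.+1 - i.+1))).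
  by move=> p _ /=; rewrite tnth_mktuple.
exact: measurable_crd.
Qed.

Lemma upd_rv x j u : (0 < j <= m)%N -> upd (rv x) j u = rv (upd x (m.+1 - j) u).
Proof.
move=> jm; apply: vecP => i im; rewrite crd_rv !crd_upd//; last by lia.
rewrite crd_rv (_ : (i == j) = (m.+1 - i == m.+1 - j)%N)//.
by apply/eqP/eqP; lia.
Qed.

Lemma margs_rv t (F : vec R m -> \bar R) x : coords (m := m) t ->
  margs [seq (m.+1 - j)%N | j <- t] F x = margs t (F \o rv) (rv x).
Proof.
elim: t x => [|j t IHt] x /=; first by rewrite rvK.
move=> /andP[jm tm]; apply: eq_integral => u _.
by rewrite IHt// upd_rv.
Qed.

End reversal.

(** * Averages over a block whose ends may be pinned by the neighbours *)

Section block_average.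
Context {R : realType} (m : nat) (al be ga : nat -> R).
Implicit Types (x y p : vec R m) (i j s e : nat) (t : seq nat).
Hypothesis coefs : pos_coefs m al be ga.
Local Notation poly := (poly al be ga).
Local Notation ind := (ind al be ga).

(* The value of the coordinate next to the block forces the first, resp. the
   last, coordinate of the block {s+1, ..., e} to be 0. *)
Definition ldeg s x : bool := ga s <= al s * crd x s.
Definition rdeg e x : bool := ga e <= be e * crd x e.+1.

Definition fblk s e x := blk (s + ldeg s x) (e - rdeg e x).

Lemma fblk_sub s e x j : j \in fblk s e x -> j \in blk s e.
Proof. by rewrite !mem_blk; lia. Qed.

Lemma coords_fblk s e x : (e <= m)%N -> coords (m := m) (fblk s e x).
Proof. by move=> em; apply: coords_blk; lia. Qed.

Lemma poly_ldeg s x : (s < m)%N -> poly x -> ldeg s x -> crd x s.+1 = 0.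
Proof.
move=> sm px dx; have [_ b0 _] := coefs (ltnW sm).
have x0 := poly_ge0 s.+1 px; case: px => _ /(_ _ (ltnW sm)).
move: dx; rewrite /ldeg => h1 h2.
have : be s * crd x s.+1 <= 0 by lra.
by rewrite pmulr_rle0// => h; apply/le_anti; rewrite h x0.
Qed.

Lemma poly_rdeg e x : (0 < e <= m)%N -> poly x -> rdeg e x -> crd x e = 0.
Proof.
move=> /andP[e0 em] px dx; have [a0 _ _] := coefs em.
have x0 := poly_ge0 e px; case: px => _ /(_ _ em).
move: dx; rewrite /rdeg => h1 h2.
have : al e * crd x e <= 0 by lra.
by rewrite pmulr_rle0// => h; apply/le_anti; rewrite h x0.
Qed.

Lemma poly_forced s e x j : (s < e <= m)%N -> poly x ->
  j \in blk s e -> j \notin fblk s e x -> crd x j = 0.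
Proof.
move=> /andP[se em] px; rewrite !mem_blk => js jf.
have [dx|ndx] := boolP (ldeg s x).
  have [->|js'] := eqVneq j s.+1; first by apply: poly_ldeg => //; lia.
  move: jf; rewrite dx; have [dr|_] := boolP (rdeg e x) => jf; last by lia.
  have -> : j = e by lia.
  by apply: poly_rdeg => //; lia.
move: jf; rewrite (negbTE ndx); have [dr|_] := boolP (rdeg e x) => jf; last by lia.
have -> : j = e by lia.
by apply: poly_rdeg => //; lia.
Qed.

Lemma ldeg_agree s e x p : agree_off (blk s e) p x -> ldeg s p = ldeg s x.
Proof. by move=> px; rewrite /ldeg px// mem_blk ltnn. Qed.

Lemma rdeg_agree s e x p : agree_off (blk s e) p x -> rdeg e p = rdeg e x.
Proof. by move=> px; rewrite /rdeg px// mem_blk ltnn andbF. Qed.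

Lemma fblk_agree s e x p : agree_off (blk s e) p x -> fblk s e p = fblk s e x.
Proof. by move=> px; rewrite /fblk (ldeg_agree px) (rdeg_agree px). Qed.

(** With the rest of the block at 0, coordinate [j] can be raised up to the smaller of its two
    slacks. A slack can vanish only through an outer neighbour, and [fblk] has removed the end
    coordinate concerned. *)
Lemma free_in_blk s e x j : (s.+2 <= e <= m)%N -> poly x ->
  free_in al be ga (blk s e) x j = (j \in fblk s e x).
Proof.
move=> /andP[se em] px; apply/idP/idP.
  move=> /andP[jb /asboolP[p [pp ppx pj]]].
  apply: contraLR pj => nf; rewrite -leNgt (@poly_forced s e p j)//; first by lia.
  by rewrite (fblk_agree ppx).
move=> jf; have jb := fblk_sub jf; rewrite /free_in jb /=; apply/asboolP.
have jm : (0 < j <= m)%N by move: jb; rewrite mem_blk; lia.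
have [j0 jm'] := andP jm.
pose z := zero_on (blk s e) x; have pz : poly z by exact: poly_zero_on.
have [a0 b0 g0] := coefs jm'.
have [a0' b0' g0'] := coefs (leq_trans (leq_pred j) jm').
pose s1 := ga j.-1 - al j.-1 * crd z j.-1.
pose s2 := ga j - be j * crd z j.+1.
have s1_gt0 : 0 < s1.
  rewrite subr_gt0 crd_zero_on; case: ifP => [_|jn]; first by rewrite mulr0.
  have js : j.-1 = s by move: jn jb; rewrite !mem_blk; lia.
  rewrite js ltNge; apply/negP => dx.
  by move: jf; rewrite mem_blk /ldeg dx; lia.
have s2_gt0 : 0 < s2.
  rewrite subr_gt0 crd_zero_on; case: ifP => [_|jn]; first by rewrite mulr0.
  have js : j = e by move: jn jb; rewrite !mem_blk; lia.
  rewrite js ltNge; apply/negP => dx.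
  by move: jf; rewrite mem_blk /rdeg dx; lia.
pose v := Num.min (s1 / be j.-1) (s2 / al j).
have v0 : 0 < v by rewrite lt_min !divr_gt0.
have vs1 : be j.-1 * v <= s1.
  by rewrite mulrC -ler_pdivlMr// /v ge_min lexx.
have vs2 : al j * v <= s2.
  by rewrite mulrC -ler_pdivlMr// /v ge_min lexx orbT.
exists (upd z j v); split.
- split=> [i im|i im].
    rewrite crd_upd//; case: eqP => [_|_]; first exact: ltW.
    exact: poly_ge0 pz.
  rewrite !crd_upd//; have [->|ij] := eqVneq i j.
    rewrite gtn_eqF// /s2 in vs2 *; lra.
  have [ij'|_] := eqVneq i.+1 j; last by case: pz => _; exact.
  by move: vs1; rewrite /s1 -ij' /=; lra.
- move=> i ib; rewrite crd_upd//; case: eqP => [ij|_].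
    by move: ib; rewrite ij jb.
  by rewrite crd_zero_on (negbTE ib).
- by rewrite crd_upd// eqxx.
Qed.

Local Open Scope ereal_scope.

Lemma margs_free s e x F : (s.+2 <= e <= m)%N -> poly x -> mnn F ->
  margs [seq j <- iota 1 m | free_in al be ga (blk s e) x j] F x =
  margs (fblk s e x) F x.
Proof.
move=> sem px mF; apply: (congr1 (fun G => G x)); apply: perm_margs => //.
  by apply/allP => j; rewrite mem_filter mem_iota; lia.
apply: uniq_perm; [exact/filter_uniq/iota_uniq|exact: iota_uniq|move=> j].
rewrite mem_filter (free_in_blk j sem px) mem_iota.
by rewrite mem_blk; lia.
Qed.

Lemma margs_fblk_neq0 s e x : (s.+2 <= e <= m)%N -> poly x ->
  margs (fblk s e x) ind x != 0.
Proof.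
move=> sem px; rewrite -margs_free//; last exact: mnn_ind.
by rewrite gt_eqF// free_box_gt0.
Qed.

Definition block_avg F s e x := avg al be ga F (fblk s e x) x.

End block_average.

(** * Influence of a coordinate on a block *)

Section influence.
Context {R : realType} (m : nat).
Implicit Types (al be ga : nat -> R) (d psi : nat -> R) (x y p : vec R m)
  (i j s e : nat) (F : vec R m -> \bar R).

Definition lipschitz al be ga d F := forall x y, poly al be ga x -> poly al be ga y ->
  (F x <= F y + (hamming d x y)%:E)%E.

Definition unit_mnn F := mnn F /\ forall x, (F x <= 1)%E.

(* [psi s] dominates the total weight [d] of the disagreements that a change of
   the coordinate [s] spreads to its right. *)
Definition influence_bound d psi := (forall s, 0 <= psi s) /\
  forall s, d s.+1 + psi s.+1 / 2 + (d s.+2 + psi s.+2) / 4 <= psi s.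

(** The two conditions on [r] correspond to two situations. If neither slice is pinned at its left
    end, the chain starts at [s] and costs [psi s]. If exactly one is pinned, coordinate [s.+1] is 0
    there and random in the other slice, and the chain starts one step later, at cost
    [d s.+1 + psi s.+1]. *)
Lemma left_influence al be ga d psi F (r : R) s e x y :
  pos_coefs m al be ga -> unit_mnn F -> (forall i, 0 <= d i) ->
  lipschitz al be ga d F -> influence_bound d psi ->
  psi s <= r -> d s.+1 + psi s.+1 <= r -> (s.+2 <= e <= m)%N ->
  poly al be ga x -> poly al be ga y ->
  (forall i, (s < i)%N -> crd x i = crd y i) ->
  block_avg al be ga F s e x <=
  block_avg al be ga F s e y + (hamming d x y + (if crd x s == crd y s then 0 else r)).
Proof.
move=> coefs [mF F1] d0 lipF [psi0 psi_step] psir dpsir sem px py xy.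
have [se em] := andP sem.
(* Emptying the block does not change the averages, since the coordinates that are not integrated
   were already 0; it provides the points required by [adm]. *)
pose b := blk s e; pose x' := zero_on b x; pose y' := zero_on b y.
have px' : poly al be ga x' by exact: (poly_zero_on coefs).
have py' : poly al be ga y' by exact: (poly_zero_on coefs).
have xx' : agree_off b x' x.
  by move=> i ib; rewrite crd_zero_on (negbTE ib).
have yy' : agree_off b y' y.
  by move=> i ib; rewrite crd_zero_on (negbTE ib).
have avg_zero (z : vec R m) : poly al be ga z ->
    block_avg al be ga F s e z = avg al be ga F (fblk al be ga s e z) (zero_on b z).
  move=> pz; rewrite /block_avg /avg; congr (fine _ / fine _);
    (apply: margs_agree; first exact: coords_fblk) => i ni;
    (rewrite crd_zero_on; case: ifP => // ib;
     by apply: (poly_forced coefs _ pz ib ni); lia).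
have Wneq0 (z : vec R m) : poly al be ga z ->
    margs (fblk al be ga s e z) (ind al be ga) (zero_on b z) != 0%E.
  move=> pz; have zz : agree_off b (zero_on b z) z.
    by move=> i ib; rewrite crd_zero_on (negbTE ib).
  rewrite -(fblk_agree _ _ _ zz); apply: (margs_fblk_neq0 coefs sem).
  exact: (poly_zero_on coefs).
have hxy : hamming d x' y' <= hamming d x y.
  by apply: le_hamming => // i im; rewrite !crd_zero_on; case: ifP.
have rE : rdeg be ga e y = rdeg be ga e x by rewrite /rdeg xy//; lia.
rewrite !avg_zero//; have := Wneq0 _ px; have := Wneq0 _ py.
have zx i : (s < i <= e)%N -> crd x' i = 0.
  by move=> ie; rewrite crd_zero_on mem_blk ie.
have zy i : (s < i <= e)%N -> crd y' i = 0.
  by move=> ie; rewrite crd_zero_on mem_blk ie.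
have xy' i : (s < i)%N -> crd x' i = crd y' i.
  by move=> si; rewrite !crd_zero_on xy.
have xs : crd x' s = crd x s by rewrite xx'// mem_blk ltnn.
have ys : crd y' s = crd y s by rewrite yy'// mem_blk ltnn.
rewrite /fblk rE -/x' -/y'.
set e' := (e - rdeg be ga e x)%N.
have e'e : (s < e' <= e)%N by rewrite /e'; case: rdeg; rewrite ?subn1 ?subn0; lia.
have e'm : (e' <= m)%N by lia.
case: (eqVneq (crd x s) (crd y s)) => [xys|xys].
  have -> : ldeg al ga s y = ldeg al ga s x by rewrite /ldeg xys.
  set s' := (s + ldeg al ga s x)%N => Wy Wx; rewrite addr0.
  have s's : (s <= s' <= e')%N by rewrite /s'; case: ldeg; rewrite ?addn1 ?addn0; lia.
  have [] := @cut_compare _ _ _ _ _ F d mF d0 lipF s s' e' x' y' x' y'.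
  - by lia.
  - by lia.
  - done.
  - done.
  - done.
  - done.
  - by move=> i hi; apply: xy'; lia.
  - move=> v ss' ->; rewrite (zx s.+1); last by lia.
    by rewrite mulr0 !addr0; split; apply: (poly_lcap coefs) => //; lia.
  - by rewrite xs ys.
  move=> WE VE.
  apply: (@le_trans _ _ (avg al be ga F (blk s' e') y' + hamming d x' y')); last first.
    by rewrite lerD2l.
  have cb := coords_blk s' e'm; have ub := uniq_blk s' e'.
  have Wy0 : (0 < margs (blk s' e') (ind al be ga) y')%E.
    by rewrite lt0e Wy; apply: margs_ge0; exact: mnn_ind.
  have fW : margs (blk s' e') (ind al be ga) y' \is a fin_num.
    exact: (margs_ind_fin_num coefs).
  rewrite -lee_fin -(lee_pmul2r fW Wy0) EFinD muleDl ?fin_num_adde_defr//.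
  by rewrite -{1}WE -(avgE coefs mF F1 x')// -(avgE coefs mF F1 y').
move=> Wy Wx.
have lxy : crd x s <> crd y s by apply/eqP.
have sm : (s <= m)%N by lia.
(* Both pinned would mean that coordinate [s] has its maximal value [ga s / al s] in [x] and in [y],
   which differ there. *)
have dd : ldeg al ga s x -> ldeg al ga s y -> False.
  rewrite /ldeg => h1 h2; apply: lxy.
  have := poly_lcap coefs px sm; have := poly_lcap coefs py sm => h3 h4.
  have [a0 _ _] := coefs _ sm.
  by apply: (mulfI (lt0r_neq0 a0)); apply/le_anti; apply/andP; split; lra.
move: Wx Wy dd.
have s1m : (0 < s.+1 <= m)%N by lia.
have y'E : y' = upd y' s.+1 0.
  by apply: vecP => i im; rewrite crd_upd//; case: eqP => // ->; rewrite zy//; lia.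
have x'E : x' = upd x' s.+1 0.
  by apply: vecP => i im; rewrite crd_upd//; case: eqP => // ->; rewrite zx//; lia.
have sem' : (s < e' <= m)%N by lia.
have ax : adm al be ga s e' x' by split => // i ie; apply: zx; lia.
have ay : adm al be ga s e' y' by split => // i ie; apply: zy; lia.
have agr u u' i : (e' < i)%N -> crd (upd x' s.+1 u) i = crd (upd y' s.+1 u') i.
  move=> ei; rewrite !crd_upd// gtn_eqF; last by lia.
  by apply: xy'; lia.
have step u u' : margs (blk s.+1 e') (ind al be ga) (upd x' s.+1 u) != 0%E ->
    margs (blk s.+1 e') (ind al be ga) (upd y' s.+1 u') != 0%E ->
    avg al be ga F (blk s.+1 e') (upd x' s.+1 u) <=
    avg al be ga F (blk s.+1 e') (upd y' s.+1 u') + (hamming d x y + r).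
  move=> Wu Wu'.
  apply: le_trans (@chain_influence _ _ _ _ _ coefs F d mF F1 d0 lipF psi psi0 psi_step
    s.+1 e' _ _ _ _ _ _ Wu Wu') _.
  - by lia.
  - exact: adm_upd.
  - exact: adm_upd.
  - exact: agr.
  have := @hamming_upd _ _ d d0 x' y' s.+1 u u' s1m; lra.
(* In the mixed cases the pinned side is rewritten as an update of coordinate [s.+1] by 0, and the
   other side is averaged over the values of that coordinate. *)
case: (ldeg al ga s x); case: (ldeg al ga s y); rewrite ?addn0 ?addn1 => Wx Wy dd.
- by case: (dd isT isT).
- rewrite x'E in Wx *; rewrite -lerBlDr; apply: avg_ge => // u Wu.
  by rewrite lerBlDr; exact: step.
- rewrite y'E in Wy *; apply: avg_le => //.
    by rewrite !addr_ge0 ?avg_ge0 ?hamming_ge0// (le_trans (psi0 s)).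
  by move=> u Wu; exact: step.
- apply: le_trans (@chain_influence _ _ _ _ _ coefs F d mF F1 d0 lipF psi psi0 psi_step
    s e' _ _ _ _ _ _ Wx Wy) _ => //.
  + by lia.
  + by move=> i ei; apply: xy'; lia.
  by lra.
Qed.

End influence.

(** * Influence from the right, deduced by reversal *)

Section reversed_influence.
Context {R : realType} (m : nat).
Implicit Types (al be ga : nat -> R) (d psi : nat -> R) (x y p : vec R m)
  (i j s e : nat) (F : vec R m -> \bar R).

(** Under reversal coordinate [i] becomes [m.+1 - i], whereas constraint [i], which sits between two
    coordinates, becomes constraint [m - i] with [al] and [be] exchanged. *)
Let mirror al i := al (m - i)%N.

Let pos_coefs_mirror al be ga : pos_coefs m al be ga ->
  pos_coefs m (mirror be) (mirror al) (mirror ga).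
Proof. by move=> c i im; have [] := c (m - i)%N (leq_subr _ _). Qed.

Let poly_rv al be ga x :
  poly (mirror be) (mirror al) (mirror ga) (rv x) <-> poly al be ga x.
Proof.
split=> -[x0 xg]; split=> i im.
- have := x0 (m.+1 - i)%N; rewrite crd_rv (_ : m.+1 - (m.+1 - i) = i)%N; last by lia.
  by apply; lia.
- have := xg (m - i)%N (leq_subr _ _); rewrite /mirror !crd_rv.
  rewrite (_ : m - (m - i) = i)%N; last by lia.
  rewrite (_ : m.+1 - (m - i) = i.+1)%N; last by lia.
  by rewrite (_ : m.+1 - (m - i).+1 = i)%N 1?addrC//; lia.
- by rewrite crd_rv; apply: x0; lia.
- have := xg (m - i)%N (leq_subr _ _); rewrite /mirror !crd_rv.
  rewrite (_ : m.+1 - i = (m - i).+1)%N; last by lia.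
  by rewrite (_ : m.+1 - i.+1 = m - i)%N 1?addrC//; lia.
Qed.

Let block_avg_rv al be ga F s e x : pos_coefs m al be ga -> mnn F ->
  (s < e <= m)%N ->
  block_avg al be ga F s e x =
  block_avg (mirror be) (mirror al) (mirror ga) (F \o rv) (m - e) (m - s) (rv x).
Proof.
move=> coefs mF sem; rewrite /block_avg /avg.
set t := fblk al be ga s e x; set t' := fblk _ _ _ _ _ (rv x).
have tm : coords (m := m) t by apply: coords_fblk; lia.
have t'm : coords (m := m) t' by apply: coords_fblk; lia.
have mem_t' i : (0 < i <= m)%N -> ((m.+1 - i)%N \in t') = (i \in t).
  move=> im; rewrite /t /t' /fblk /ldeg /rdeg !mem_blk /mirror !crd_rv.
  rewrite (_ : m - (m - e) = e)%N; last by lia.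
  rewrite (_ : m - (m - s) = s)%N; last by lia.
  rewrite (_ : m.+1 - (m - e) = e.+1)%N; last by lia.
  rewrite (_ : m.+1 - (m - s).+1 = s)%N; last by lia.
  case: (_ <= _); case: (_ <= _); rewrite ?addn0 ?addn1 ?subn0 ?subn1; lia.
have perm_t : perm_eq t [seq (m.+1 - i)%N | i <- t'].
  apply: uniq_perm; first exact: iota_uniq.
    rewrite map_inj_in_uniq ?iota_uniq// => i j.
    by move=> /(allP t'm) im /(allP t'm) jm; lia.
  move=> i; apply/idP/mapP => [it|[j jt ->]].
    have im := allP tm _ it; exists (m.+1 - i)%N; last by lia.
    by rewrite mem_t'.
  have jm := allP t'm _ jt; rewrite -mem_t'; last by lia.
  by rewrite (_ : m.+1 - (m.+1 - j) = j)%N//; lia.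
have rvE G : mnn G -> margs t G x = margs t' (G \o rv) (rv x).
  by move=> mG; rewrite (perm_margs tm perm_t mG) margs_rv.
have indE : ind al be ga \o (@rv R m) = ind (mirror be) (mirror al) (mirror ga).
  apply/funext => y /=; have [py|py] := pselect (poly al be ga (rv y)).
    by rewrite !ind1// -(rvK y); apply/poly_rv.
  by rewrite !ind0// => py'; apply: py; apply/poly_rv; rewrite rvK.
congr (fine _ / fine _).
- have FE : Find al be ga F \o rv =
      Find (mirror be) (mirror al) (mirror ga) (F \o rv).
    by apply/funext => y; rewrite /Find -indE.
  by rewrite rvE ?FE//; exact: mnn_Find.
- by rewrite rvE ?indE//; exact: mnn_ind.
Qed.

Let hamming_rv d x y : hamming (fun i => d (m.+1 - i)%N) (rv x) (rv y) = hamming d x y.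
Proof.
rewrite /hamming (reindex_inj rev_ord_inj) /=; apply: eq_bigr => i _.
have im := ltn_ord i; rewrite !crd_rv.
by rewrite (_ : m.+1 - (m - i.+1).+1 = i.+1)%N//; lia.
Qed.

Lemma right_influence al be ga d psi F (r : R) s e x y :
  pos_coefs m al be ga -> unit_mnn F -> (forall i, 0 <= d i) ->
  lipschitz al be ga d F -> influence_bound (fun i => d (m.+1 - i)%N) psi ->
  psi (m - e)%N <= r -> d e + psi (m - e).+1 <= r -> (s.+2 <= e <= m)%N ->
  poly al be ga x -> poly al be ga y ->
  (forall i, (i <= e)%N -> crd x i = crd y i) ->
  block_avg al be ga F s e x <=
  block_avg al be ga F s e y +
    (hamming d x y + (if crd x e.+1 == crd y e.+1 then 0 else r)).
Proof.
move=> coefs [mF F1] d0 lipF psiP psir dpsir sem px py xy.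
have mrv : mnn (F \o rv).
  case: mF => mF' F0; split; last by move=> z; exact: F0.
  exact: (measurableT_comp mF' measurable_rv).
have sem' : (s < e <= m)%N by lia.
rewrite !(block_avg_rv _ coefs mF sem') -hamming_rv.
have := @left_influence R m (mirror be) (mirror al) (mirror ga)
  (fun i => d (m.+1 - i)%N) psi (F \o rv) r (m - e) (m - s) (rv x) (rv y).
rewrite !crd_rv (_ : m.+1 - (m - e) = e.+1)%N; last by lia.
apply.
- exact: pos_coefs_mirror.
- by split => // z; exact: F1.
- by move=> i; exact: d0.
- move=> z z' pz pz' /=.
  have -> : hamming (fun i => d (m.+1 - i)%N) z z' = hamming d (rv z) (rv z').
    by rewrite -[RHS]hamming_rv !rvK.
  by apply: lipF; apply/poly_rv; rewrite rvK.
- exact: psiP.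
- exact: psir.
- by rewrite (_ : m.+1 - (m - e).+1 = e)%N//; lia.
- by lia.
- exact/poly_rv.
- exact/poly_rv.
- by move=> i ei; rewrite !crd_rv; apply: xy; lia.
Qed.

Lemma block_avg_agree al be ga F s e x y : pos_coefs m al be ga ->
  (s < e <= m)%N -> poly al be ga x -> poly al be ga y ->
  agree_off (blk s e) x y -> block_avg al be ga F s e x = block_avg al be ga F s e y.
Proof.
move=> coefs sem px py xy; rewrite /block_avg (fblk_agree _ _ _ xy) /avg.
have em : (e <= m)%N by lia.
congr (fine _ / fine _); apply: margs_agree; rewrite ?coords_fblk// => i ni;
  (have [ib|/xy//] := boolP (i \in blk s e));
  (rewrite (poly_forced coefs sem py ib ni);
   by apply: (poly_forced coefs sem px ib); rewrite (fblk_agree _ _ _ xy)).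
Qed.

(** * From single-coordinate changes to the Hamming distance *)

Section path.
Variables (al be ga : nat -> R) (v : nat -> R) (H : vec R m -> R).
Hypothesis coefs : pos_coefs m al be ga.
Hypothesis v0 : forall i, 0 <= v i.
Hypothesis H1 : forall j x y, (0 < j <= m)%N -> poly al be ga x -> poly al be ga y ->
  (forall i, i != j -> crd x i = crd y i) -> H x <= H y + v j.

Let interp x y k : vec R m := [tuple (if (i < k)%N then tnth y i else tnth x i) | i < m].

Let crd_interp x y k i : crd (interp x y k) i = if (i <= k)%N then crd y i else crd x i.
Proof.
case: i => [|i]; first by rewrite !crd0.
have [im|mi] := ltnP i m; last by rewrite !crd_out// if_same.
by rewrite (_ : i = Ordinal im :> nat)// !crdS tnth_mktuple.
Qed.

Let path_interp x y : poly al be ga x -> poly al be ga y ->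
  (forall k, poly al be ga (interp x y k)) -> H x <= H y + hamming v x y.
Proof.
move=> px py pxy.
have step k : (k <= m)%N -> H x <= H (interp x y k) +
    \sum_(i < m | (i < k)%N) v i.+1 * (crd x i.+1 != crd y i.+1)%:R.
  elim: k => [|k IHk] km.
    rewrite big_pred0 ?addr0; last by move=> i.
    have -> // : interp x y 0 = x.
    by apply: vecP => i im; rewrite crd_interp leqNgt; case/andP: im => ->.
  apply: (le_trans (IHk (ltnW km))).
  rewrite [in leRHS](bigD1 (Ordinal km))//= addrA.
  have -> : \sum_(i < m | (i < k)%N) v i.+1 * (crd x i.+1 != crd y i.+1)%:R =
    \sum_(i < m | (i < k.+1)%N && (i != Ordinal km)) v i.+1 * (crd x i.+1 != crd y i.+1)%:R.
    apply: eq_bigl => i; rewrite -val_eqE /= ltnS; lia.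
  rewrite lerD2r; have [xyk|xyk] := eqVneq (crd x k.+1) (crd y k.+1).
    rewrite mulr0 addr0 (_ : interp x y k = interp x y k.+1)//.
    apply: vecP => i im; rewrite !crd_interp.
    have [->|ik] := eqVneq i k.+1; first by rewrite ltnn leqnn.
    by rewrite [in RHS]leq_eqVlt (negbTE ik).
  rewrite mulr1; apply: H1 => // i ik; rewrite !crd_interp.
  by rewrite [in RHS]leq_eqVlt (negbTE ik).
have := step m (leqnn m); rewrite (_ : interp x y m = y); last first.
  by apply: vecP => i /andP[_ im]; rewrite crd_interp im.
move/le_trans; apply; rewrite lerD2l /hamming.
by rewrite le_eqVlt; apply/orP; left; apply/eqP/eq_bigl => i; rewrite ltn_ord.
Qed.

(** Changing the coordinates of [x] into those of [y] one at a time may leave the polytope. The path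
    through the coordinatewise minimum does not, and it changes each coordinate at most once, so
    that no distance is lost. *)
Lemma path_lipschitz x y : poly al be ga x -> poly al be ga y ->
  H x <= H y + hamming v x y.
Proof.
move=> px py.
pose z : vec R m := [tuple Num.min (tnth x i) (tnth y i) | i < m].
have crd_z i : crd z i = Num.min (crd x i) (crd y i).
  case: i => [|i]; first by rewrite !crd0 minxx.
  have [im|mi] := ltnP i m; last by rewrite !crd_out// minxx.
  by rewrite (_ : i = Ordinal im :> nat)// !crdS tnth_mktuple.
have z0 i : 0 <= crd z i by rewrite crd_z le_min !(poly_ge0 _ px, poly_ge0 _ py).
have pz : poly al be ga z.
  by apply: (poly_down coefs px) => i _; rewrite z0 crd_z ge_min lexx.
have xz : H x <= H z + hamming v x z.
  apply: path_interp => // k; apply: (poly_down coefs px) => i _.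
  rewrite crd_interp; case: ifP => _; first by rewrite z0 crd_z ge_min lexx.
  by rewrite (poly_ge0 _ px) lexx.
have zy : H z <= H y + hamming v z y.
  apply: path_interp => // k; apply: (poly_down coefs py) => i _.
  rewrite crd_interp; case: ifP => _; first by rewrite (poly_ge0 _ py) lexx.
  by rewrite z0 crd_z ge_min lexx orbT.
suff : hamming v x z + hamming v z y <= hamming v x y by lra.
rewrite /hamming -big_split /=; apply: ler_sum => i _.
rewrite -mulrDr; apply: ler_wpM2l => //; rewrite crd_z -natrD ler_nat.
have [h|h] := leP (crd x i.+1) (crd y i.+1).
  by rewrite eqxx.
by rewrite eqxx addn0.
Qed.

End path.

End reversed_influence.

(** * Contraction of the weighted Hamming distance *)

Section weights.
Local Open Scope nat_scope.

(* Weighted Hamming distance: the coordinates 56 and n - 56, which are the outer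
   neighbours of the two extreme blocks, are given the weight 13 because the
   extreme blocks are chosen with the larger weight 55. *)
Definition heavy n j : nat := if (j == 56) || (j == n - 56) then 13 else 1.

(* [decay p] is twice a bound on the influence at distance [p]; the influence of
   a disagreement on a neighbouring block is at most 6 plus 12 times the decay
   at each of the heavy coordinates. *)
Definition decay p : nat := if p <= 8 then 2 else 1.

Definition rspread n j : nat :=
  12 + 12 * ((j < 56) * decay (56 - j) + (j < n - 56) * decay (n - 56 - j)).

Definition lspread n j : nat :=
  12 + 12 * ((56 < j) * decay (j - 56) + (n - 56 < j) * decay (j - (n - 56))).

Definition multiplicity n i : nat := if (i == 1) || (i == n - 55) then 55 else 1.

(** Divided by [n + 53], this is the probability that coordinate [j] is resampled in one step. *)
Definition cover n j : nat := \sum_(1 <= i < n - 54 | i <= j <= i + 54) multiplicity n i.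

Lemma sum_nat_itv N lo hi : \sum_(1 <= i < N | lo <= i < hi) 1 = minn hi N - maxn 1 lo.
Proof.
elim: N => [|N IHN]; first by rewrite big_geq//; lia.
have [->|N0] := posnP N; first by rewrite big_geq//; lia.
by rewrite big_mkcond big_nat_recr//= -big_mkcond IHN /=; case: ifP; lia.
Qed.

Let sum_pick N a (P : pred nat) c :
  \sum_(1 <= i < N | P i) (if i == a then c else 0) = ((1 <= a < N) && P a) * c.
Proof.
rewrite -big_mkcondr /=; case Pa: (P a).
  rewrite (eq_bigl (fun i => i == a)); last first.
    by move=> i; have [->|] := eqVneq i a; rewrite ?Pa ?andbF.
  by rewrite big_nat1_eq; case: ifP; lia.
rewrite big_pred0; first by lia.
by move=> i; have [->|] := eqVneq i a; rewrite ?Pa ?andbF.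
Qed.

Lemma coverE n j : 58 < n -> 0 < j < n ->
  cover n j = (minn j (n - 55)).+1 - maxn 1 (j - 54) + 54 * (j <= 55) + 54 * (n - 55 <= j).
Proof.
move=> n58 jn; rewrite /cover.
rewrite (eq_bigr (fun i => 1 + (if i == 1 then 54 else 0) + (if i == n - 55 then 54 else 0))); last first.
  by move=> i _; rewrite /multiplicity; case: eqP => [->|_]; case: eqP => //; lia.
rewrite !big_split /= !sum_pick.
rewrite (eq_bigl (fun i => j - 54 <= i < j.+1)); last by move=> i; lia.
by rewrite sum_nat_itv; lia.
Qed.

Lemma sum_multiplicity n : 58 < n ->
  \sum_(1 <= i < n - 54) multiplicity n i = n + 53.
Proof.
move=> n58.
rewrite (eq_bigr (fun i => 1 + (if i == 1 then 54 else 0) + (if i == n - 55 then 54 else 0))); last first.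
  by move=> i _; rewrite /multiplicity; case: eqP => [->|_]; case: eqP => //; lia.
rewrite !big_split /= !sum_pick sum_nat_const_nat /=. lia.
Qed.

(** Everything is doubled to remain in [nat]; [4 * heavy n j] is the margin that becomes the rate 2.
    For an ordinary [j] the losses are at most 24 + 48, and the gain is at least 110. Only 56 and
    [n - 56] border an extreme block and see the multiplicity 55, against a gain multiplied by 13.
    Small [n] is where the decay matters: for [j = n - 56 = 3] the gain 26 * 57 exceeds 55 * 24 + 52
    but not 55 * 36. *)
Lemma weights_contract n j : 58 < n -> 0 < j < n ->
  (j <= n - 56) * multiplicity n j.+1 * rspread n j +
  (56 <= j) * multiplicity n (j - 55) * lspread n j + 4 * heavy n j <=
  2 * cover n j * heavy n j.
Proof.
move=> n58 jn; rewrite coverE// /rspread /lspread /multiplicity /heavy.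
have dec1 p : 0 < decay p <= 2 by rewrite /decay; case: ifP.
have dec2 p : 8 < p -> decay p = 1 by move=> h; rewrite /decay leqNgt h.
move: (dec1 (56 - j)) (dec1 (n - 56 - j)) (dec1 (j - 56)) (dec1 (j - (n - 56))).
move: (@dec2 (56 - j)) (@dec2 (n - 56 - j)) (@dec2 (j - 56)) (@dec2 (j - (n - 56))).
move: (decay _) (decay _) (decay _) (decay _) => p q r t.
have [j1|j1|j1] := ltngtP j 56; have [j2|j2|j2] := ltngtP j (n - 56);
  rewrite /= ?mul0n ?mul1n ?add0n ?addn0 ?muln0; do ?[case: ifP => ?]; lia.
Qed.

End weights.

(** * One step of the sampler contracts Lipschitz constants *)

Section contraction.
Context {R : realType}.
Implicit Types (n i j s e p : nat) (pi : nat -> R).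

(* The value [pi 0] is not constrained by [full_support_distribution]; since it
   only multiplies the coordinate 0, it is replaced by 1. *)
Definition wal pi i : R := if i == 0%N then 1 else pi i.
Definition wbe pi i : R := pi i.+1.

Lemma pos_coefs_pi n pi : (0 < n)%N -> full_support_distribution n pi ->
  pos_coefs n.-1 (wal pi) (wbe pi) (wbe pi).
Proof.
move=> n0 [p0 _] i im; rewrite /wal /wbe.
have pS : 0 < pi i.+1 by apply: p0; lia.
split=> //; case: eqP => [_|i0]; first exact: ltr01.
by apply: p0; lia.
Qed.

(** Cleared of denominators, the two upper bounds on [X[i]] are the constraints [i.-1] and [i]; each
    inner constraint thus appears twice in [gibbs_body]. *)
Lemma gibbs_bodyE n pi : (0 < n)%N -> full_support_distribution n pi ->
  gibbs_body n pi = poly (wal pi) (wbe pi) (wbe pi) :> set (vec R n.-1).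
Proof.
move=> n0 fs; have coefs := pos_coefs_pi n0 fs; have [p0 _] := fs.
apply/seteqP; split=> x.
- move=> bx; split=> [i im|i im]; first by have /andP[] := bx i im.
  rewrite /wal /wbe; have [->|i0] := eqVneq i 0%N.
    rewrite crd0 mulr0 add0r.
    have pi1 : 0 < pi 1%N by apply: p0; lia.
    have [m0|m0] := posnP n.-1.
      by rewrite crd_out ?m0// mulr0 ltW.
    have /andP[_] := bx 1%N m0; rewrite le_min => /andP[+ _].
    by rewrite /= crd0 mulr0 subr0 => h; rewrite -[leRHS]mulr1 ler_pM2l.
  have im' : (0 < i <= n.-1)%N by lia.
  have pi0 : 0 < pi i by apply: p0; lia.
  have /andP[_] := bx i im'; rewrite le_min => /andP[_ h].
  have : pi i * crd x i <= pi i * (pi i.+1 / pi i * (1 - crd x i.+1)) by rewrite ler_pM2l.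
  rewrite (_ : pi i * (pi i.+1 / pi i * (1 - crd x i.+1)) = pi i.+1 * (1 - crd x i.+1)); last first.
    by field; rewrite gt_eqF.
  lra.
- move=> [x0 xg] i im; rewrite x0//= le_min.
  have pi0 : 0 < pi i by apply: p0; lia.
  have pi1 : 0 < pi i.+1 by apply: p0; lia.
  apply/andP; split.
    rewrite -(ler_pM2l pi0) (_ : pi i * (1 - pi i.-1 / pi i * crd x i.-1) =
      pi i - pi i.-1 * crd x i.-1); last by field; rewrite gt_eqF.
    case: i im pi0 pi1 => // i im pi0 pi1 /=.
    have := xg i; rewrite /wal /wbe; have [->|_] := eqVneq i 0%N.
      by rewrite !crd0 !mulr0 subr0 add0r; apply.
    by move=> /(_ ltac:(lia)); lra.
  rewrite -(ler_pM2l pi0) (_ : pi i * (pi i.+1 / pi i * (1 - crd x i.+1)) =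
    pi i.+1 * (1 - crd x i.+1)); last by field; rewrite gt_eqF.
  have := xg i ltac:(lia); rewrite /wal /wbe ifF; last by lia.
  by move=> h; lra.
Qed.

(** A supersolution of the influence recursion for a unit weight at [p] alone. The ratio 9/10
    satisfies [r / 2 + 1 / 4 <= r ^+ 2], and the value 1 at [s = p - 1] pays exactly for the
    disagreement at [p]. *)
Let impulse p s : R := if (s < p)%N then (9 / 10) ^+ (p - 1 - s) else 0.

Let impulse_ge0 p s : 0 <= impulse p s.
Proof. by rewrite /impulse; case: ifP => // _; apply: exprn_ge0; lra. Qed.

Let impulse_step p s : (s.+1 == p)%:R + impulse p s.+1 / 2 +
  ((s.+2 == p)%:R + impulse p s.+2) / 4 <= impulse p s.
Proof.
rewrite /impulse; have [ps|sp] := leqP p s.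
  by rewrite !ifF ?gtn_eqF//=; lia || lra.
have [e1|e1] := eqVneq s.+1 p.
  rewrite -e1 ltnn ltnNge leqnSn /= gtn_eqF// subn1 /= subnn expr0; lra.
have [e2|e2] := eqVneq s.+2 p.
  rewrite -e2 !ltnS leqnn ltnn /= (_ : s.+2 - 1 - s.+1 = 0)%N; last by lia.
  rewrite (_ : s.+2 - 1 - s = 1)%N; last by lia.
  rewrite expr0 expr1; lra.
have -> : (s.+1 < p)%N by lia.
have -> : (s.+2 < p)%N by lia.
have [q qE] : exists q, (p - 1 - s.+2)%N = q by exists (p - 1 - s.+2)%N.
rewrite qE (_ : p - 1 - s.+1 = q.+1)%N; last by lia.
rewrite (_ : p - 1 - s = q.+2)%N; last by lia.
rewrite !exprS; have : 0 <= (9 / 10 : R) ^+ q by apply: exprn_ge0; lra.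
by move: ((9 / 10 : R) ^+ q) => z z0 /=; lra.
Qed.

(** Origin of the threshold 8 in [decay]: at distance at least 9 the exponent [p - s - 2] in
    [impulse_decay1] is at least 7. *)
Let pow7 : (9 / 10 : R) ^+ 7 <= 1 / 2.
Proof. by rewrite !exprS expr0; lra. Qed.

Let impulse_decay p s : impulse p s <= ((s < p) * decay (p - s))%:R / 2.
Proof.
rewrite /impulse /decay; case: ifP => [sp|_]; last by rewrite mul0n mul0r.
rewrite mul1n; case: ifP => h.
  rewrite divff ?pnatr_eq0//; apply: exprn_ile1; lra.
rewrite (_ : p - 1 - s = 7 + (p - s - 8))%N; last by lia.
rewrite exprD; have : (9 / 10 : R) ^+ (p - s - 8) <= 1 by apply: exprn_ile1; lra.
have : 0 <= (9 / 10 : R) ^+ (p - s - 8) by apply: exprn_ge0; lra.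
move: pow7; have : 0 <= (9 / 10 : R) ^+ 7 by apply: exprn_ge0; lra.
by move: (_ ^+ _) (_ ^+ _) => a b; nra.
Qed.

Let impulse_decay1 p s :
  (s.+1 == p)%:R + impulse p s.+1 <= ((s < p) * decay (p - s))%:R / 2.
Proof.
have [<-|sp] := eqVneq s.+1 p.
  rewrite /impulse ltnn addr0 leqnn mul1n /decay subSnn /=; lra.
rewrite add0r /impulse; case: ifP => [sp1|_]; last by rewrite divr_ge0.
have -> : (s < p)%N by lia.
rewrite mul1n /decay; case: ifP => h.
  rewrite divff ?pnatr_eq0//; apply: exprn_ile1; lra.
rewrite (_ : p - 1 - s.+1 = 7 + (p - s - 9))%N; last by lia.
rewrite exprD; have : (9 / 10 : R) ^+ (p - s - 9) <= 1 by apply: exprn_ile1; lra.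
have : 0 <= (9 / 10 : R) ^+ (p - s - 9) by apply: exprn_ge0; lra.
move: pow7; have : 0 <= (9 / 10 : R) ^+ 7 by apply: exprn_ge0; lra.
by move: (_ ^+ _) (_ ^+ _) => a b; nra.
Qed.

Variables (n : nat) (pi : nat -> R).
Hypothesis n58 : (58 < n)%N.
Hypothesis fs : full_support_distribution n pi.
Let n0 : (0 < n)%N. Proof. by lia. Qed.
Let coefs := pos_coefs_pi n0 fs.
Local Notation poly := (@poly R n.-1 (wal pi) (wbe pi) (wbe pi)).
Implicit Types (c : R) (F : vec R n.-1 -> \bar R).

Let heavyE j : (heavy n j)%:R <= 1 + 12 * ((j == 56)%:R + (j == n - 56)%N%:R) :> R.
Proof.
rewrite /heavy; case: eqP => _; case: eqP => _ /=; lra.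
Qed.

(** The recursion is linear in the weights. The constant 5 solves [1 + z / 2 + (1 + z) / 4 = z], the
    case of unit weights; 12 is the excess of the weight 13 over 1. *)
Let psi c s : R := c * (5 + 12 * (impulse 56 s + impulse (n - 56) s)).

Let psi_bound c : 0 <= c -> influence_bound (fun j => c * (heavy n j)%:R) (psi c).
Proof.
move=> c0; split=> s.
  by rewrite mulr_ge0// addr_ge0// mulr_ge0// addr_ge0.
suff : (heavy n s.+1)%:R + (5 + 12 * (impulse 56 s.+1 + impulse (n - 56) s.+1)) / 2 +
  ((heavy n s.+2)%:R + (5 + 12 * (impulse 56 s.+2 + impulse (n - 56) s.+2))) / 4 <=
  5 + 12 * (impulse 56 s + impulse (n - 56) s).
  by move=> /(ler_wpM2l c0); rewrite /psi; lra.
have := impulse_step 56 s; have := impulse_step (n - 56) s.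
have := heavyE s.+1; have := heavyE s.+2; lra.
Qed.

Let psi_spread c s : 0 <= c -> psi c s <= c * ((rspread n s)%:R / 2).
Proof.
move=> c0; apply: ler_wpM2l => //; rewrite /rspread natrD natrM natrD.
by have := impulse_decay 56 s; have := impulse_decay (n - 56) s; lra.
Qed.

Let psi_spread1 c s : 0 <= c ->
  c * (heavy n s.+1)%:R + psi c s.+1 <= c * ((rspread n s)%:R / 2).
Proof.
move=> c0; rewrite -mulrDr; apply: ler_wpM2l => //; rewrite /rspread natrD natrM natrD.
have := impulse_decay1 56 s; have := impulse_decay1 (n - 56) s.
have := heavyE s.+1; lra.
Qed.

Let heavy_sym j : heavy n (n - j)%N = heavy n j.
Proof. by rewrite /heavy; congr (if _ then _ else _); lia. Qed.

Let spread_sym j : (j <= n)%N -> rspread n (n - j)%N = lspread n j.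
Proof.
move=> jn; rewrite /rspread /lspread.
rewrite (_ : (n - j < 56)%N = (n - 56 < j)%N); last by lia.
rewrite (_ : (n - j < n - 56)%N = (56 < j)%N); last by lia.
rewrite (_ : 56 - (n - j) = j - (n - 56))%N; last by lia.
rewrite (_ : n - 56 - (n - j) = j - 56)%N; last by lia.
by lia.
Qed.

Definition gibbs_op F x : R := \sum_(1 <= i < (n - 54)%N)
  block_weight n 55 55 i * block_avg (wal pi) (wbe pi) (wbe pi) F i.-1 (i + 54) x.

Let weightE i : (1 <= i < n - 54)%N ->
  block_weight n 55 (55 : R) i = (multiplicity n i)%:R / (n + 53)%:R.
Proof.
move=> im; rewrite /block_weight ifT; last by lia.
rewrite /multiplicity (fun_if (fun k => k%:R)); congr (_ / _).
rewrite natrB; last by lia.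
rewrite natrD; lra.
Qed.

(* A difference in the single coordinate [j] disappears when [j] belongs to the
   resampled block, and spreads only when the block is adjacent to [j]. *)
Let block_avg_single c F i j x y : 0 <= c -> unit_mnn F ->
  lipschitz (wal pi) (wbe pi) (wbe pi) (fun j => c * (heavy n j)%:R) F ->
  (1 <= i < n - 54)%N -> (0 < j < n)%N -> poly x -> poly y ->
  (forall l, l != j -> crd x l = crd y l) ->
  block_avg (wal pi) (wbe pi) (wbe pi) F i.-1 (i + 54) x <=
  block_avg (wal pi) (wbe pi) (wbe pi) F i.-1 (i + 54) y +
   c * ((heavy n j)%:R * (~~ (i <= j <= i + 54)%N)%:R +
        (i == j.+1)%:R * ((rspread n j)%:R / 2) +
        ((56 <= j)%N && (i == j - 55)%N)%:R * ((lspread n j)%:R / 2)).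
Proof.
move=> c0 uF lipF im jn px py xy.
have d0 l : 0 <= c * (heavy n l)%:R by rewrite mulr_ge0.
have ham : hamming (fun j => c * (heavy n j)%:R) x y <= c * (heavy n j)%:R.
  have jm : (j.-1 < n.-1)%N by lia.
  rewrite /hamming (bigD1 (Ordinal jm))//= big1 ?addr0.
    rewrite (_ : j.-1.+1 = j); last by lia.
    by rewrite -[leRHS]mulr1 ler_wpM2l// lern1 leq_b1.
  move=> l lj; rewrite xy ?eqxx ?mulr0//.
  by apply: contraNneq lj => lj; apply/eqP/val_inj => /=; lia.
have [jb|jb] := boolP (i <= j <= i + 54)%N.
  rewrite (@block_avg_agree _ _ _ _ _ _ _ _ x y coefs)//.
  - rewrite lerDl mulr_ge0// !addr_ge0// mulr_ge0//.
  - by lia.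
  - move=> l; rewrite mem_blk => lb; apply: xy; apply: contraNneq lb => ->.
    by lia.
have sem : (i.-1.+2 <= i + 54 <= n.-1)%N by lia.
have [ji|ij] := ltnP j i.
  have := @left_influence _ _ _ _ _ _ (psi c) F (c * ((rspread n i.-1)%:R / 2))
    i.-1 (i + 54) x y coefs uF d0 lipF (psi_bound c0) (psi_spread _ c0)
    (psi_spread1 _ c0) sem px py.
  move=> /(_ _)/le_trans; apply; first by move=> l il; apply: xy; lia.
  rewrite lerD2l mulr1 !mulrDr.
  have -> : (56 <= j)%N && (i == j - 55)%N = false by lia.
  rewrite mul0r mulr0 addr0; apply: lerD => //.
  have [->|ij1] := eqVneq i j.+1; first by rewrite mul1r /=; case: ifP => // _; rewrite mulr_ge0.
  by rewrite mul0r mulr0 xy ?eqxx//; lia.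
have := @right_influence _ _ _ _ _ _ (psi c) F (c * ((lspread n (i + 54).+1)%:R / 2))
    i.-1 (i + 54) x y coefs uF d0 lipF.
have nE : n.-1.+1 = n by lia.
have rE : (n.-1 - (i + 54) = n - (i + 54).+1)%N by lia.
rewrite nE rE => /(_ _ _ _ sem px py _)/le_trans; apply.
- rewrite (_ : (fun l => _) = (fun l => c * (heavy n l)%:R)); last first.
    by apply/funext => l; rewrite heavy_sym.
  exact: psi_bound.
- rewrite -spread_sym; last by lia.
  exact: psi_spread.
- rewrite -spread_sym; last by lia.
  rewrite -heavy_sym (_ : (n - (i + 54) = (n - (i + 54).+1).+1)%N); last by lia.
  exact: psi_spread1.
- by move=> l il; apply: xy; lia.
rewrite lerD2l mulr1 !mulrDr.
have -> : (i == j.+1) = false by lia.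
rewrite mul0r mulr0 addr0; apply: lerD => //.
have [ijE|ij1] := eqVneq (i + 54).+1 j.
  have -> : (56 <= j)%N && (i == j - 55)%N by lia.
  by rewrite mul1r ijE; case: ifP => // _; rewrite mulr_ge0.
by rewrite xy// eqxx mulr_ge0// mulr_ge0.
Qed.

Lemma gibbs_op_lipschitz c F x y : 0 <= c -> unit_mnn F ->
  lipschitz (wal pi) (wbe pi) (wbe pi) (fun j => c * (heavy n j)%:R) F ->
  poly x -> poly y ->
  gibbs_op F x <= gibbs_op F y +
    hamming (fun j => (c * (1 - 2 / (n + 53)%:R)) * (heavy n j)%:R) x y.
Proof.
move=> c0 uF lipF.
have Z0 : 0 < (n + 53)%:R :> R by rewrite ltr0n; lia.
have r0 : 0 <= 1 - 2 / (n + 53)%:R :> R.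
  by rewrite subr_ge0 ler_pdivrMr// mul1r ler_nat; lia.
apply: (path_lipschitz coefs) => [i|j {}x {}y jm px py xy].
  by rewrite !mulr_ge0.
have jn : (0 < j < n)%N by lia.
pose g i : R := (heavy n j)%:R * (~~ (i <= j <= i + 54)%N)%:R +
        (i == j.+1)%:R * ((rspread n j)%:R / 2) +
        ((56 <= j)%N && (i == j - 55)%N)%:R * ((lspread n j)%:R / 2).
apply: (@le_trans _ _ (gibbs_op F y +
    c / (n + 53)%:R * \sum_(1 <= i < n - 54) (multiplicity n i)%:R * g i)).
  rewrite /gibbs_op mulr_sumr -big_split /=.
  rewrite 2!big_seq; apply: ler_sum => i; rewrite mem_index_iota => im.
  rewrite weightE//; apply: (@le_trans _ _ ((multiplicity n i)%:R / (n + 53)%:R *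
    (block_avg (wal pi) (wbe pi) (wbe pi) F i.-1 (i + 54) y + c * g i))).
    by apply: ler_wpM2l; [rewrite divr_ge0|exact: block_avg_single].
  by rewrite mulrDr lerD2l le_eqVlt; apply/orP; left; apply/eqP; field; rewrite gt_eqF.
rewrite lerD2l.
suff h : \sum_(1 <= i < n - 54) (multiplicity n i)%:R * g i <=
    ((n + 53)%:R - 2) * (heavy n j)%:R.
  apply: (@le_trans _ _ (c / (n + 53)%:R * (((n + 53)%:R - 2) * (heavy n j)%:R))).
    by apply: ler_wpM2l => //; rewrite divr_ge0.
  by rewrite le_eqVlt; apply/orP; left; apply/eqP; field; rewrite gt_eqF.
have pick (a : nat) (b : bool) (X : R) :
    \sum_(1 <= i < n - 54) (multiplicity n i)%:R * ((b && (i == a))%:R * X) =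
    ((b && (1 <= a < n - 54))%N * multiplicity n a)%:R * X.
  case: b => /=; last first.
    by rewrite big1 => [|i _]; rewrite ?mul0n ?mulr0n ?mul0r ?mulr0.
  rewrite (eq_bigr (fun i => if i == a then (multiplicity n a)%:R * X else 0)); last first.
    by move=> i _; case: eqP => [->|_]; rewrite ?mul1r// mul0r mulr0.
  by rewrite -big_mkcond big_nat1_eq; case: ifP => _; rewrite ?mul1n// mul0n mul0r.
(* Positions covering [j] erase the disagreement. It spreads only at position [j.+1], whose block
   starts right after [j], and at position [j - 55], whose block ends right before [j]. *)
have -> : \sum_(1 <= i < n - 54) (multiplicity n i)%:R * g i =
  (heavy n j)%:R * ((n + 53)%:R - (cover n j)%:R) +
  (((j <= n - 56)%N * multiplicity n j.+1)%:R * ((rspread n j)%:R / 2) +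
   ((56 <= j)%N * multiplicity n (j - 55)%N)%:R * ((lspread n j)%:R / 2)).
  rewrite (eq_bigr (fun i => (heavy n j)%:R * ((multiplicity n i)%:R * (~~ (i <= j <= i + 54)%N)%:R) +
    ((multiplicity n i)%:R * ((true && (i == j.+1))%:R * ((rspread n j)%:R / 2)) +
     (multiplicity n i)%:R * (((56 <= j)%N && (i == j - 55)%N)%:R * ((lspread n j)%:R / 2))))); last first.
    by move=> i _; rewrite /g /=; ring.
  rewrite !big_split /= (pick j.+1 true) pick -mulr_sumr; congr (_ * _ + (_ * _ + _ * _)).
  - apply/eqP; rewrite eq_sym subr_eq -(sum_multiplicity n58) /cover !natr_sum.
    rewrite [X in _ + X]big_mkcond -big_split /=; apply/eqP/eq_bigr => i _.
    by case: ifP => _; rewrite ?mulr0 ?mulr1 ?add0r ?addr0.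
  - by congr (_ * _)%:R; congr nat_of_bool; lia.
  - by congr (_ * _)%:R; congr nat_of_bool; lia.
have := weights_contract n58 jn.
move: (rspread n j) (lspread n j) (cover n j) (heavy n j) => p q r h.
move: (multiplicity n _) (multiplicity n _) (j <= _)%N (56 <= j)%N => a a' b b'.
by rewrite -(ler_nat R) !natrD !natrM; lra.
Qed.

End contraction.

(** * The transition kernel *)

Section mixture.
Context d d' (T : measurableType d) (T' : measurableType d') (R : realType).
Local Open Scope ereal_scope.
Variables (mu : {measure set T -> \bar R}) (l : T -> {measure set T' -> \bar R}).
Variables (D : set T) (nu : {measure set T' -> \bar R}).
Hypothesis mD : measurable D.
Hypothesis ml : forall U, measurable U -> measurable_fun setT (l ^~ U).
Hypothesis nuE : forall U, measurable U -> nu U = \int[mu]_(x in D) l x U.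

Import HBNNSimple.

Let mixture_nnsfun (f : {nnsfun T' >-> R}) :
  \int[nu]_z (f z)%:E = \int[mu]_(x in D) \int[l x]_z (f z)%:E.
Proof.
under [in LHS]eq_integral do rewrite fimfunE -fsumEFin//.
rewrite ge0_integral_fsum//; last 2 first.
  by move=> r; exact/measurable_EFinP/measurableT_comp.
  by move=> r z _; rewrite EFinM nnfun_muleindic_ge0.
under [in RHS]eq_integral.
  move=> y _.
  under eq_integral.
    by move=> z _; rewrite fimfunE -fsumEFin//; over.
  rewrite /= ge0_integral_fsum//; last 2 first.
    by move=> r; exact/measurable_EFinP/measurableT_comp.
    by move=> r z _; rewrite EFinM nnfun_muleindic_ge0.
  under eq_fsbigr.
    move=> r _.
    rewrite (integralZl_indic _ (fun r => f @^-1` [set r]))//; last first.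
      by move=> r0; rewrite preimage_nnfun0.
    rewrite integral_indic// setIT.
    over.
  over.
rewrite /= ge0_integral_fsum//; last 2 first.
  by move=> r; apply: measurable_funeM; apply: measurable_funTS; exact: ml.
  move=> n y _; have := mulemu_ge0 (fun n => f @^-1` [set n]).
  by apply; exact: preimage_nnfun0.
apply: eq_fsbigr => r _.
rewrite (integralZl_indic _ (fun r => f @^-1` [set r]))//; last first.
  exact: preimage_nnfun0.
rewrite integral_indic// setIT nuE//.
have [r0|r0] := leP 0%R r.
  by rewrite ge0_integralZl_EFin//; apply: measurable_funTS; exact: ml.
rewrite !integral0_eq ?mule0// => y _; rewrite preimage_nnfun0// measure0 ?mule0//.
Qed.

(** Simple functions and monotone convergence. This passes from the transition probabilities of
    sets, which define the sampler, to expectations of test functions. *)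
Lemma integral_mixture (f : T' -> \bar R) : (forall z, 0 <= f z) ->
  measurable_fun setT f ->
  \int[nu]_z f z = \int[mu]_(x in D) \int[l x]_z f z.
Proof.
move=> f0 mf; pose f_ := nnsfun_approx measurableT mf.
have fE (m : {measure set T' -> \bar R}) :
    \int[m]_z f z = limn (fun n => \int[m]_z (f_ n z)%:E).
  rewrite -monotone_convergence//.
  - by apply: eq_integral => z _; apply/esym/cvg_lim => //; exact: cvg_nnsfun_approx.
  - by move=> n; exact/measurable_EFinP.
  - by move=> n z _; rewrite lee_fin.
  - by move=> z _ a b ab; rewrite lee_fin; exact/lefP/nd_nnsfun_approx.
rewrite fE; under eq_integral do rewrite fE.
rewrite monotone_convergence//.
- by congr (limn _); apply/funext => n; exact: mixture_nnsfun.
- move=> n; apply: measurable_funTS; apply: measurable_fun_integral_kernel => //.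
    by move=> z; rewrite lee_fin.
  exact/measurable_EFinP.
- by move=> n x _; apply: integral_ge0 => z _; rewrite lee_fin.
- move=> x _ a b ab; apply: ge0_le_integral => //.
  + by move=> z _; rewrite lee_fin.
  + exact/measurable_EFinP.
  + exact/measurable_EFinP.
  + by move=> z _; rewrite lee_fin; exact/lefP/nd_nnsfun_approx.
Qed.

End mixture.

(** The restriction of [mu] to [D] is the mixture of the Dirac masses at the points of [D]. *)
Lemma ge0_integral_mrestr d (T : measurableType d) (R : realType)
    (mu : {measure set T -> \bar R}) (D : set T) (mD : measurable D) (f : T -> \bar R) :
  (forall x, (0 <= f x)%E) -> measurable_fun setT f ->
  (\int[mrestr mu mD]_x f x = \int[mu]_(x in D) f x)%E.
Proof.
move=> f0 mf; rewrite (@integral_mixture _ _ _ _ _ mu (fun x : T => \d_x) D)//.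
- by apply: eq_integral => x _; rewrite integral_dirac// diracT mul1e.
- by move=> U mU; exact: measurable_fun_dirac.
- move=> U mU; transitivity (\int[mu]_(z in D) (\1_U z)%:E)%E; last by [].
  by rewrite integral_indic.
Qed.

(** * The uniform laws on slices as a measurable family of measures *)

Section slice_measures.
Context {R : realType} (m : nat) (al be ga : nat -> R).
Implicit Types (x y u : vec R m) (i j k s e : nat) (t : seq nat).
Hypothesis coefs : pos_coefs m al be ga.
Local Notation poly := (poly al be ga : set (vec R m)).
Local Notation ind := (ind al be ga).
Local Open Scope ereal_scope.

Let mpoly : measurable poly := @measurable_poly R m al be ga.

Lemma mnn_indic (U : set (vec R m)) : measurable U -> mnn (fun y => (\1_U y)%:E).
Proof.
move=> mU; split; last by move=> y; rewrite lee_fin.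
by apply/measurable_EFinP; exact: measurable_indic.
Qed.

Lemma flat_setI (free : pred nat) x (U : set (vec R m)) : measurable U ->
  flat_lebesgue (fun i : 'I_m => free i.+1) x (U `&` poly) =
  margs [seq j <- iota 1 m | free j] (fun y => (\1_U y)%:E * ind y) x.
Proof.
move=> mU; have mUp : measurable (U `&` poly) by exact: measurableI.
transitivity (\int[flat_lebesgue (fun i : 'I_m => free i.+1) x]_y (\1_(U `&` poly) y)%:E).
  by rewrite integral_indic// setIT.
rewrite integral_flat; last exact: mnn_indic.
by congr margs; apply/funext => y; rewrite indicI EFinM.
Qed.

Lemma block_sliceE k i x u : (0 < i)%N ->
  block_slice poly k i x u <-> poly u /\ agree_off (blk i.-1 (i + k).-1) u x.
Proof.
move=> i0; split=> -[pu ux]; split => // j jb; apply: ux; move: jb.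
  by rewrite mem_blk; lia.
by apply: contra; rewrite mem_blk; lia.
Qed.

Lemma measurable_block_slice k i x : measurable (block_slice poly k i x).
Proof.
rewrite (_ : block_slice poly k i x = poly `&`
    \bigcap_(j in [set j | ~~ (i <= j < i + k)%N]) [set u | crd u j = crd x j]); last first.
  by apply/seteqP; split => u [pu ux]; split.
apply: measurableI => //; apply: bigcap_measurableType => j _.
rewrite (_ : [set u | _] = (fun u : vec R m => crd u j) @^-1` [set crd x j])//.
rewrite -[X in measurable X]setTI; exact: measurable_crd.
Qed.

Lemma free_coordinateE k i x : (0 < i)%N ->
  free_coordinate (block_slice poly k i x) =
  (fun j : 'I_m => free_in al be ga (blk i.-1 (i + k).-1) x j.+1).
Proof.
move=> i0; apply/funext => j; apply/idP/idP.
  move=> /asboolP[u [v [/(block_sliceE _ _ _ i0)[pu ux] /(block_sliceE _ _ _ i0)[pv vx]]]].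
  rewrite -!crdS => uv; have jb : j.+1 \in blk i.-1 (i + k).-1.
    by apply: contra_notT uv => jb; rewrite ux ?vx.
  rewrite /free_in jb /=; apply/asboolP.
  have [u0|u0] := eqVneq (crd u j.+1) 0%R.
    exists v; split=> //; rewrite lt0r (poly_ge0 _ pv) andbT.
    by apply/eqP => v0; apply: uv; rewrite u0 v0.
  by exists u; split=> //; rewrite lt0r (poly_ge0 _ pu) u0.
move=> /andP[jb /asboolP[p [pp px pj]]]; apply/asboolP.
have jm : (0 < j.+1 <= m)%N by rewrite /= ltn_ord.
exists p, (upd p j.+1 0%R); rewrite -!crdS crd_upd// eqxx; split.
- exact/block_sliceE.
- apply/block_sliceE => //; split.
    apply: (poly_down coefs pp) => l _; rewrite crd_upd//.
    by case: eqP => _; rewrite ?lexx (poly_ge0 _ pp).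
  move=> l lb; rewrite crd_upd//; case: eqP => [lj|_]; last exact: px.
  by move: lb; rewrite lj jb.
- by move=> p0; move: pj; rewrite p0 ltxx.
Qed.

Lemma flat_block_slice k i x (U : set (vec R m)) : (0 < i)%N -> poly x ->
  measurable U ->
  flat_lebesgue (free_coordinate (block_slice poly k i x)) x (U `&` block_slice poly k i x) =
  margs [seq j <- iota 1 m | free_in al be ga (blk i.-1 (i + k).-1) x j]
    (fun y => (\1_U y)%:E * ind y) x.
Proof.
move=> i0 px mU; rewrite free_coordinateE//.
set S := block_slice _ _ _ _; set free := free_in _ _ _ _ _.
have mS : measurable S by exact: measurable_block_slice.
have mUS : measurable (U `&` S) by exact: measurableI.
transitivity (\int[flat_lebesgue (fun j : 'I_m => free j.+1) x]_y (\1_(U `&` S) y)%:E).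
  by rewrite integral_indic// setIT.
rewrite integral_flat; last exact: mnn_indic.
apply: eq_margs; first by apply/allP => j; rewrite mem_filter mem_iota; lia.
move=> y yx; rewrite indicI EFinM; congr (_ * _).
rewrite /ind !indicE; congr (nat_of_bool _)%:R%:E; apply/idP/idP; rewrite !inE.
  by case.
move=> py; apply/block_sliceE => //; split => // j jb; apply: yx.
by rewrite mem_filter /free /free_in (negbTE jb).
Qed.

Let free_coords x k i : coords (m := m)
  [seq j <- iota 1 m | free_in al be ga (blk i.-1 (i + k).-1) x j].
Proof. by apply/allP => j; rewrite mem_filter mem_iota; lia. Qed.

Lemma flat_block_slice_fin k i x : (0 < i)%N -> poly x ->
  0 < flat_lebesgue (free_coordinate (block_slice poly k i x)) x (block_slice poly k i x) < +oo.
Proof.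
move=> i0 px; rewrite -[X in flat_lebesgue _ _ X]setTI flat_block_slice//.
rewrite (_ : (fun y => _) = ind); last first.
  by apply/funext => y; rewrite indicT mul1e.
rewrite free_box_gt0//= margs_ind_lty// ?free_coords//.
exact/filter_uniq/iota_uniq.
Qed.

Lemma uniform_flat_sub k i x (U : set (vec R m)) : (0 < i)%N -> poly x ->
  block_slice poly k i x `<=` U ->
  uniform_flat (block_slice poly k i x) x U = 1.
Proof.
move=> i0 px SU; rewrite /uniform_flat /normalized (setIidr SU).
have /andP[S0 Soo] := flat_block_slice_fin k i0 px.
by rewrite divee// ?gt0_fin_numE// gt_eqF.
Qed.

(** The reciprocal of the volume as a real power: a measurable function of the base that equals the
    inverse on nonnegative numbers, with value 0 at 0. *)
Definition slice_coef s e x : R := fine (margs (fblk al be ga s e x) ind x) `^ (-1).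

Let slice_coef_ge0 s e x : (0 <= slice_coef s e x)%R. Proof. exact: powR_ge0. Qed.

(** Unlike [uniform_flat], whose free coordinates are found by an existence statement about the
    slice, this family is explicit in [x], and it is a measure at every [x], also outside the
    polytope. The two agree on the polytope by [uniform_flatE]. *)
Definition slice_measure s e x : {measure set (vec R m) -> \bar R} :=
  mscale (NngNum (slice_coef_ge0 s e x))
    (mrestr (flat_lebesgue (fun i : 'I_m => i.+1 \in fblk al be ga s e x) x) mpoly).

Let margs_fblk_filter s e x (F : vec R m -> \bar R) : (e <= m)%N -> mnn F ->
  margs [seq j <- iota 1 m | j \in fblk al be ga s e x] F = margs (fblk al be ga s e x) F.
Proof.
move=> em mF; apply: perm_margs => //.
  by apply/allP => j; rewrite mem_filter mem_iota; lia.
apply: uniq_perm; [exact/filter_uniq/iota_uniq|exact: iota_uniq|move=> j].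
by rewrite mem_filter mem_iota mem_blk; lia.
Qed.

Lemma slice_measureE s e x (U : set (vec R m)) : (e <= m)%N -> measurable U ->
  slice_measure s e x U = (slice_coef s e x)%:E *
    margs (fblk al be ga s e x) (fun y => (\1_U y)%:E * ind y) x.
Proof.
move=> em mU; rewrite /slice_measure /= /mscale /= /mrestr.
rewrite -margs_fblk_filter//.
  by congr (_ * _); exact: (flat_setI (fun j => j \in fblk al be ga s e x)).
have [mf f0] := mnn_ind m al be ga; have [mg g0] := mnn_indic mU.
by split => [|y]; [exact: emeasurable_funM|exact: mule_ge0].
Qed.

Lemma integral_slice_measure s e x F : (e <= m)%N -> mnn F ->
  \int[slice_measure s e x]_y F y =
  (slice_coef s e x)%:E * margs (fblk al be ga s e x) (Find al be ga F) x.
Proof.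
move=> em [mF F0]; rewrite ge0_integral_mscale//=; congr (_ * _).
rewrite ge0_integral_mrestr//.
rewrite integral_mkcond -(margs_fblk_filter _ _ em); last exact: mnn_Find.
rewrite -integral_flat; last exact: mnn_Find.
apply: eq_integral => y _; rewrite /Find /patch; case: ifPn.
  by rewrite inE => py; rewrite ind1 ?mule1.
by rewrite notin_setE => py; rewrite ind0 ?mule0.
Qed.

Lemma measurable_slice_measure s e (U : set (vec R m)) : (e <= m)%N ->
  measurable U -> measurable_fun setT (fun x => slice_measure s e x U).
Proof.
move=> em mU; have mUi : mnn (fun y : vec R m => (\1_U y)%:E * ind y).
  have [mf f0] := mnn_ind m al be ga; have [mg g0] := mnn_indic mU.
  by split => [|y]; [exact: emeasurable_funM|exact: mule_ge0].
pose g t x := (fine (margs t ind x) `^ (-1))%:E * margs t (fun y => (\1_U y)%:E * ind y) x.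
have mg t : measurable_fun setT (g t).
  apply: emeasurable_funM; last by have [] := mnn_margs t mUi.
  apply/measurable_EFinP; apply: (measurableT_comp (measurable_powR _)).
  apply: (measurableT_comp (fine_measurable measurableT)).
  by have [] := mnn_margs t (mnn_ind m al be ga).
(* The set of integrated coordinates depends on [x] only through two Booleans, so there are four
   measurable pieces. *)
apply: (@eq_measurable_fun _ _ _ _ _ (fun x =>
    if ldeg al ga s x then
      if rdeg be ga e x then g (blk s.+1 e.-1) x else g (blk s.+1 e) x
    else if rdeg be ga e x then g (blk s e.-1) x else g (blk s e) x)).
  move=> x _; rewrite slice_measureE// /slice_coef /fblk /g.
  by case: ldeg; case: rdeg; rewrite ?addn0 ?addn1 ?subn0 ?subn1.
have ml : measurable_fun setT (ldeg al ga s : vec R m -> bool).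
  by apply: measurable_fun_ler => //; apply: measurable_funM => //; exact: measurable_crd.
have mr : measurable_fun setT (rdeg be ga e : vec R m -> bool).
  by apply: measurable_fun_ler => //; apply: measurable_funM => //; exact: measurable_crd.
by apply: measurable_fun_ifT => //; apply: measurable_fun_ifT.
Qed.

Lemma uniform_flatE k i x (U : set (vec R m)) : (0 < i)%N -> (1 < k)%N ->
  (i + k <= m.+1)%N -> poly x -> measurable U ->
  uniform_flat (block_slice poly k i x) x U = slice_measure i.-1 (i + k).-1 x U.
Proof.
move=> i0 k1 ikm px mU; rewrite /uniform_flat /normalized.
have em : ((i + k).-1 <= m)%N by lia.
have sem : (i.-1.+2 <= (i + k).-1 <= m)%N by lia.
have mUi : mnn (fun y : vec R m => (\1_U y)%:E * ind y).
  have [mf f0] := mnn_ind m al be ga; have [mg g0] := mnn_indic mU.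
  by split => [|y]; [exact: emeasurable_funM|exact: mule_ge0].
have mi := mnn_ind m al be ga.
rewrite slice_measureE// flat_block_slice//.
rewrite -[X in _ / flat_lebesgue _ _ X]setTI flat_block_slice//.
rewrite (_ : (fun y => (\1_setT y)%:E * ind y) = ind); last first.
  by apply/funext => y; rewrite indicT mul1e.
rewrite !margs_free// muleC; congr (_ * _); rewrite /slice_coef.
have W0 := margs_fblk_neq0 coefs sem px.
have fW : margs (fblk al be ga i.-1 (i + k).-1 x) ind x \is a fin_num.
  by apply: margs_ind_fin_num => //; [exact: coords_fblk|exact: iota_uniq].
rewrite powR_inv1; last by apply: fine_ge0; exact: margs_ge0.
by rewrite -{1}(fineK fW) inver fine_eq0// (negbTE W0).
Qed.

Lemma integral_slice_measure_avg s e x F : (s < e <= m)%N -> unit_mnn F ->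
  \int[slice_measure s e x]_y F y = (block_avg al be ga F s e x)%:E.
Proof.
move=> /andP[se em] [mF F1]; rewrite integral_slice_measure// /block_avg.
have cb := coords_fblk al be ga s x em; have ub : uniq (fblk al be ga s e x) by exact: iota_uniq.
have fV : margs (fblk al be ga s e x) (Find al be ga F) x \is a fin_num.
  exact: (margs_Find_fin_num coefs).
rewrite -{1}(fineK fV) -EFinM /slice_coef powR_inv1 1?mulrC//.
by apply: fine_ge0; apply: margs_ge0; exact: mnn_ind.
Qed.

End slice_measures.

(** * Histories, block positions and one step of the sampler *)

Section sampler.
Context {R : realType} (n k : nat) (w : R) (pi : nat -> R).
Hypotheses (k0 : (0 < k)%N) (kn : (k.+2 <= n)%N) (w0 : 0 < w).
Hypothesis fs : full_support_distribution n pi.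
Context d (Om : measurableType d) (P : probability Om R).
Variables (X : nat -> {RV P >-> vec R n.-1}) (I : nat -> {RV P >-> nat}).
Hypothesis XI : block_gibbs_sampler n pi k w X I.
Implicit Types (t i s : nat) (Q : pred nat).

Local Notation bw := (block_weight n k w).
Local Notation positions := (index_iota 1 (n - k).+1).
Local Notation body := (gibbs_body n pi).

Let n0 : (0 < n)%N. Proof. by lia. Qed.
Let coefs : pos_coefs n.-1 (wal pi) (wbe pi) (wbe pi) := pos_coefs_pi n0 fs.
Let bodyE : body = poly (wal pi) (wbe pi) (wbe pi) := gibbs_bodyE n0 fs.

Let Z : R := (n - k)%:R - 2 + 2 * w.

Lemma block_weight_norm_gt0 : 0 < (n - k)%:R - 2 + 2 * w.
Proof.
have h : (2 : R) <= (n - k)%:R by rewrite (ler_nat R 2); lia.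
by move: (mulr_gt0 (ltr0Sn R 1) w0); lra.
Qed.

Lemma block_weight_ge0 i : 0 <= bw i.
Proof.
rewrite /block_weight; case: ifP => // _; rewrite divr_ge0//.
  by case: ifP => // _; exact: ltW.
exact/ltW/block_weight_norm_gt0.
Qed.

Lemma sum_block_weight : \sum_(i <- positions) bw i = 1.
Proof.
have [q qE] : exists q, (n - k = q.+2)%N by exists (n - k).-2; lia.
rewrite (eq_big_seq (fun i => (1 + (if i == 1%N then w - 1 else 0) +
    (if i == (n - k)%N then w - 1 else 0)) / Z)); last first.
  move=> i; rewrite mem_index_iota => im; rewrite /block_weight ifT; last by lia.
  congr (_ / _); have [->|i1] := eqVneq i 1%N; last by case: eqP => _ /=; lra.
  have -> : (1 == n - k)%N = false by lia.
  by rewrite /=; lra.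
rewrite -mulr_suml !big_split /= -!big_mkcond /= !big_nat1_eq /=.
rewrite sumr_const_nat qE !ltnS !leqnn /=.
rewrite -/Z (_ : 1 *+ (q.+3 - 1) + (w - 1) + (w - 1) = Z) ?divff//.
  by rewrite gt_eqF// block_weight_norm_gt0.
by rewrite /Z qE -[1 *+ _]/((q.+3 - 1)%:R) subn1 /= -addn2 natrD; lra.
Qed.

Local Open Scope ereal_scope.

Let mX t A : measurable A -> measurable (X t @^-1` A).
Proof. by move=> mA; rewrite -[X in measurable X]setTI; exact: measurable_funP. Qed.

Let mI t (A : set nat) : measurable (I t @^-1` A).
Proof. by rewrite -[X in measurable X]setTI; exact: measurable_funP. Qed.

Let mbody : measurable body.
Proof. by rewrite bodyE; exact: measurable_poly. Qed.

Lemma history_setI t E E' : history X I t E -> history X I t E' ->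
  history X I t (E `&` E').
Proof.
rewrite /history; set G := [set E | _].
exact: (@measurableI _ (g_sigma_algebraType G)).
Qed.

Lemma history_state s t A : (s <= t)%N -> measurable A ->
  history X I t (X s @^-1` A).
Proof. by move=> st mA; apply: sub_sigma_algebra; left; exists s, A. Qed.

Lemma history_position s t Q : (s < t)%N -> history X I t [set om | Q (I s om)].
Proof.
move=> st; rewrite /history; set G := [set E | _].
rewrite (_ : [set _ | _] = \bigcup_(i in [set i | Q i]) (I s @^-1` [set i])); last first.
  by apply/seteqP; split => [om /= Qom|om [i /= Qi /= ->//]]; exists (I s om).
apply: (@bigcup_measurable _ (g_sigma_algebraType G)) => i _.
by apply: sub_sigma_algebra; right; exists s, i.
Qed.

Lemma history_le s t E : (s <= t)%N -> history X I s E -> history X I t E.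
Proof.
move=> st; apply: sub_sigma_algebra2 => _ [[r [A [rs mA ->]]]|[r [i [rs ->]]]].
  by left; exists r, A; split=> //; exact: leq_trans st.
by right; exists r, i; split=> //; exact: leq_trans st.
Qed.

Lemma history_measurable t E : history X I t E -> measurable E.
Proof.
apply: smallest_sub; first exact: sigma_algebra_measurable.
by move=> _ [[s [A [_ mA ->]]]|[s [i [_ ->]]]]; [exact: mX|exact: mI].
Qed.

Let sum_positions (F : nat -> set Om) Q : (forall i, measurable (F i)) ->
  trivIset setT F ->
  P (\bigcup_(i in [set i | i \in positions /\ Q i]) F i) =
  \sum_(i <- positions | Q i) P (F i).
Proof.
move=> mF tF; rewrite -big_filter.
rewrite (_ : \bigcup_(i in _) F i = \big[setU/set0]_(i <- [seq i <- positions | Q i]) F i); last first.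
  rewrite -bigcup_seq; congr (\bigcup_(i in _) F i).
  apply/seteqP; split => i /=; first by case=> ip Qi; rewrite mem_filter Qi.
  by rewrite mem_filter => /andP[].
rewrite -[LHS]mul1e -integral_cst//; last exact: bigsetU_measurable.
rewrite ge0_integral_bigsetU//.
- by apply: eq_bigr => i _; rewrite integral_cst// mul1e.
- exact/filter_uniq/iota_uniq.
- exact: sub_trivIset tF.
Qed.

Let trivIset_positions t (G : set Om) (A : set Om) :
  trivIset setT (fun i => G `&` I t @^-1` [set i] `&` A).
Proof.
apply/trivIsetP => i j _ _ /eqP ij; apply/seteqP; split=> // om.
by move=> [[[_ /= h1] _] [[_ /= h2] _]]; apply: ij; rewrite -h1 -h2.
Qed.

(** A slice contained in [A] gives [A] full mass, so each integral in the definition of the sampler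
    is at least [P E]. Only inclusions of slices enter, which serves every block size in the lower
    bound. *)
Lemma step_ge t E A Q : history X I t E -> E `<=` X t @^-1` body -> measurable A ->
  (forall i om, (0 < i <= n - k)%N -> Q i -> E om ->
     block_slice body k i (X t om) `<=` A) ->
  (\sum_(i <- positions | Q i) bw i)%:E * P E <=
  P (E `&` [set om | Q (I t om)] `&` X t.+1 @^-1` A).
Proof.
move=> hE EB mA QA; have mE := history_measurable hE.
have mF i : measurable (E `&` I t @^-1` [set i] `&` X t.+1 @^-1` A).
  by apply: measurableI; [exact: measurableI|exact: mX].
rewrite -sumEFin ge0_sume_distrl; last by move=> i _; rewrite lee_fin block_weight_ge0.
apply: (@le_trans _ _ (P (\bigcup_(i in [set i | i \in positions /\ Q i])
    (E `&` I t @^-1` [set i] `&` X t.+1 @^-1` A)))); last first.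
  apply: le_measure; rewrite ?inE.
  - by apply: bigcup_measurable => i _; exact: mF.
  - apply: measurableI; last exact: mX.
    by apply: measurableI => //; exact: (mI t [set i | Q i]).
  - by move=> om [i [_ Qi] [[Eom /= IE] Aom]]; split => //; split => //=; rewrite IE.
rewrite (sum_positions Q mF (@trivIset_positions t E (X t.+1 @^-1` A))).
rewrite big_seq_cond [leRHS]big_seq_cond; apply: lee_sum => i.
rewrite mem_index_iota => /andP[im Qi]; case: XI => _ /(_ t i E A hE mA) ->.
apply: lee_wpmul2l; first by rewrite lee_fin block_weight_ge0.
rewrite le_eqVlt; apply/orP; left; apply/eqP.
rewrite -[LHS]mul1e -integral_cst//; apply: eq_integral => om; rewrite inE => Eom.
have i0 : (0 < i)%N by lia.
rewrite bodyE uniform_flat_sub//; first by have := EB _ Eom; rewrite /= bodyE.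
by rewrite -bodyE; apply: QA => //; lia.
Qed.

Lemma sampler_body t : P (X t @^-1` body) = 1.
Proof.
elim: t => [|t IHt]; first by case: XI.
apply/eqP; rewrite eq_le probability_le1 /=; last exact: (mX _ mbody).
have hE : history X I t (X t @^-1` body) by exact: history_state.
have sl i om : (0 < i <= n - k)%N -> predT i -> (X t @^-1` body) om ->
  block_slice body k i (X t om) `<=` body by move=> _ _ _ u [].
have := step_ge hE (fun _ h => h) mbody sl.
rewrite sum_block_weight mul1e IHt => h; apply: le_trans h _.
apply: le_measure; rewrite ?inE; [|exact: (mX _ mbody)|by move=> om []].
apply: measurableI; last exact: (mX _ mbody).
apply: measurableI; first exact: (mX _ mbody).
exact: (mI t [set i | predT i]).
Qed.

End sampler.

(** * The transition kernel as an operator on test functions *)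

Section gibbs_kernel.
Context {R : realType} (n k : nat) (w : R) (pi : nat -> R).
Hypotheses (k1 : (1 < k)%N) (kn : (k.+2 <= n)%N) (w0 : 0 < w).
Hypothesis fs : full_support_distribution n pi.
Implicit Types (t i s : nat) (F : vec R n.-1 -> \bar R).

Local Notation bw := (block_weight n k w).
Local Notation positions := (index_iota 1 (n - k).+1).
Local Notation body := (gibbs_body n pi).
(* The minimum only serves to have a measurable family for every [i]. *)
Local Notation slice i :=
  (slice_measure (wal pi) (wbe pi) (wbe pi) i.-1 (minn (i + k).-1 n.-1)).

Let n0 : (0 < n)%N. Proof. by lia. Qed.
Let coefs : pos_coefs n.-1 (wal pi) (wbe pi) (wbe pi) := pos_coefs_pi n0 fs.
Let bodyE : body = poly (wal pi) (wbe pi) (wbe pi) := gibbs_bodyE n0 fs.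
Let k0 : (0 < k)%N. Proof. by lia. Qed.

Local Open Scope ereal_scope.

Definition gibbs_kernel F (x : vec R n.-1) : \bar R :=
  \sum_(i <- positions) (bw i)%:E * \int[slice i x]_y F y.

Let bw0 i : (0 <= bw i)%R. Proof. exact: block_weight_ge0. Qed.

Let position_block i : i \in positions -> (i.-1.+2 <= (i + k).-1 <= n.-1)%N.
Proof. by rewrite mem_index_iota; lia. Qed.

Let position_end i : i \in positions -> minn (i + k).-1 n.-1 = (i + k).-1.
Proof. by move=> /position_block ib; apply/minn_idPl; lia. Qed.

Let measurable_slice i (U : set (vec R n.-1)) : measurable U ->
  measurable_fun setT (fun x => slice i x U).
Proof. by move=> mU; apply: measurable_slice_measure => //; rewrite geq_minr. Qed.

Let measurable_slice_integral i F : mnn F ->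
  measurable_fun setT (fun x => \int[slice i x]_y F y).
Proof.
move=> [mF F0]; apply: measurable_fun_integral_kernel => // U.
exact: measurable_slice.
Qed.

Lemma mnn_gibbs_kernel F : mnn F -> mnn (gibbs_kernel F).
Proof.
move=> [mF F0]; split; last first.
  by move=> x; apply: sume_ge0 => i _; rewrite mule_ge0 ?lee_fin// integral_ge0.
apply: emeasurable_sum => i.
by apply: measurable_funeM; exact: (measurable_slice_integral i (conj mF F0)).
Qed.

Lemma gibbs_kernel_unit F : unit_mnn F -> unit_mnn (gibbs_kernel F).
Proof.
move=> uF; have [mF F1] := uF; split => [|x]; first exact: mnn_gibbs_kernel.
have <- : \sum_(i <- positions) (bw i)%:E = 1 :> \bar R by rewrite sumEFin sum_block_weight.
rewrite /gibbs_kernel big_seq [leRHS]big_seq; apply: lee_sum => i ip'.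
have ip := position_block ip'; rewrite position_end//.
rewrite -[leRHS]mule1; apply: lee_wpmul2l; first by rewrite lee_fin.
rewrite (integral_slice_measure_avg coefs)//; last by lia.
have em : ((i + k).-1 <= n.-1)%N by lia.
rewrite lee_fin /block_avg /avg.
have cb := coords_fblk (wal pi) (wbe pi) (wbe pi) i.-1 x em.
have ub : uniq (fblk (wal pi) (wbe pi) (wbe pi) i.-1 (i + k).-1 x) by exact: iota_uniq.
set V := margs _ _ _; set W := margs _ _ _.
have fW : W \is a fin_num by exact: (margs_ind_fin_num coefs).
have fV : V \is a fin_num by exact: (margs_Find_fin_num coefs).
have W0 : (0 <= fine W)%R by apply: fine_ge0; apply: margs_ge0; exact: mnn_ind.
have VW : (fine V <= fine W)%R by apply: fine_le => //; exact: margs_le_ind.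
have [->|W1] := eqVneq (fine W) 0%R; first by rewrite invr0 mulr0.
by rewrite ler_pdivrMr ?mul1r// lt0r W1.
Qed.

Lemma gibbs_kernelE F x : unit_mnn F -> gibbs_kernel F x =
  (\sum_(i <- positions)
     bw i * block_avg (wal pi) (wbe pi) (wbe pi) F i.-1 (i + k).-1 x)%:E.
Proof.
move=> uF; rewrite -sumEFin /gibbs_kernel; apply: eq_big_seq => i ip.
have ib := position_block ip; rewrite position_end//.
by rewrite (integral_slice_measure_avg coefs)//; lia.
Qed.

Section expectation.
Context d (Om : measurableType d) (P : probability Om R).
Variables (X : nat -> {RV P >-> vec R n.-1}) (I : nat -> {RV P >-> nat}).
Hypothesis XI : block_gibbs_sampler n pi k w X I.

Let mX t A : measurable A -> measurable (X t @^-1` A).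
Proof. by move=> mA; rewrite -[X in measurable X]setTI; exact: measurable_funP. Qed.

Let mI t (A : set nat) : measurable (I t @^-1` A).
Proof. by rewrite -[X in measurable X]setTI; exact: measurable_funP. Qed.

Let mbody : measurable body.
Proof. by rewrite bodyE; exact: measurable_poly. Qed.

Let part t i : set Om := X t @^-1` body `&` I t @^-1` [set i].

Let mpart t i : measurable (part t i).
Proof. by apply: measurableI => //; exact: mX. Qed.

Let trivIset_part t (D : set nat) : trivIset D (part t).
Proof.
apply/trivIsetP => i j _ _ /eqP ij; apply/seteqP; split=> // om.
by move=> [[_ /= h1] [_ /= h2]]; apply: ij; rewrite -h1 -h2.
Qed.

Let part_step t i U : i \in positions -> measurable U ->
  P (part t i `&` X t.+1 @^-1` U) = (bw i)%:E * \int[P]_(om in X t @^-1` body) slice i (X t om) U.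
Proof.
move=> ip mU; rewrite position_end//; have := position_block ip.
move: ip; rewrite mem_index_iota => ip ib.
case: XI => _ ->//; last by apply: history_state.
congr (_ * _); apply: eq_integral => om; rewrite inE /= bodyE => Bom.
by rewrite uniform_flatE//; lia.
Qed.

Let part_mass t i : i \in positions -> P (part t i) = (bw i)%:E.
Proof.
move=> ip; rewrite -[part t i]setIT -(preimage_setT (X t.+1)) part_step//.
rewrite [X in _ * X](_ : _ = 1) ?mule1//.
rewrite -(sampler_body k0 kn w0 fs XI t) -[RHS]mul1e -integral_cst; last exact: mX.
apply: eq_integral => om; rewrite inE /= bodyE => Bom.
rewrite position_end//; have := position_block ip.
move: ip; rewrite mem_index_iota => ip ib.
by rewrite -uniform_flatE//; [apply: uniform_flat_sub => //; lia|lia|lia].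
Qed.

Let parts t := \big[setU/set0]_(i <- positions) part t i.

Let parts_mass t : P (~` parts t) = 0.
Proof.
have mp : measurable (parts t) by exact: bigsetU_measurable.
rewrite probability_setC// (_ : P (parts t) = 1) ?subee//.
rewrite -[LHS]mul1e -integral_cst// ge0_integral_bigsetU//; last exact: iota_uniq.
rewrite (eq_big_seq (fun i => (bw i)%:E)); last first.
  move=> i ip; transitivity (P (part t i)); last exact: part_mass.
  by rewrite integral_cst// mul1e.
by rewrite sumEFin sum_block_weight.
Qed.

Let body_null t : P (~` (X t @^-1` body)) = 0.
Proof.
rewrite probability_setC; last exact: mX.
by rewrite (sampler_body k0 kn w0 fs XI t) subee.
Qed.

(** The space is split according to the position [I t]. The parts with a position in range have
    total mass 1, because the block weights sum to 1; on each of them the law of the new state is a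
    mixture of slice measures. *)
Lemma expectation_step t F : unit_mnn F ->
  \int[P]_om F (X t.+1 om) = \int[P]_om gibbs_kernel F (X t om).
Proof.
move=> [mF F1]; have [mF' F0] := mF.
have mFX s : measurable_fun setT (fun om => F (X s om)).
  by apply: measurableT_comp => //; exact: measurable_funPT.
have mp : measurable (parts t) by exact: bigsetU_measurable.
rewrite (@ge0_negligible_integral _ _ _ P setT (~` parts t))//; last 2 first.
- exact: measurableC.
- exact: parts_mass.
rewrite setTD setCK ge0_integral_bigsetU//; last 2 first.
- exact: iota_uniq.
- exact: measurable_funTS.
have [mK K0] := mnn_gibbs_kernel mF.
have mKX : measurable_fun setT (fun om => gibbs_kernel F (X t om)).
  by apply: measurableT_comp => //; exact: measurable_funPT.
have mB : measurable (X t @^-1` body) by exact: mX.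
rewrite [RHS](@ge0_negligible_integral _ _ _ P setT (~` (X t @^-1` body)))//; last 2 first.
- exact: measurableC.
- exact: body_null.
rewrite setTD setCK /gibbs_kernel.
transitivity (\sum_(i <- positions) \int[P]_(om in X t @^-1` body)
    ((bw i)%:E * \int[slice i (X t om)]_y F y)).
  apply: eq_big_seq => i ip.
  have mS : measurable_fun setT (fun om => \int[slice i (X t om)]_y F y).
    by apply: (measurableT_comp (measurable_slice_integral i mF)); exact: measurable_funPT.
  rewrite ge0_integralZl_EFin//; last 2 first.
  - by move=> om _; exact: integral_ge0.
  - exact: measurable_funTS.
  pose nu := measure_function_pushforward__canonical__measure_function_Measure
    (mrestr P (mpart t i)) (measurable_funPT (X t.+1)).
  have -> : \int[P]_(om in part t i) F (X t.+1 om) = \int[nu]_y F y.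
    rewrite (ge0_integral_pushforward (measurable_funPT (X t.+1))
      (mrestr P (mpart t i)) measurableT mF'); last by move=> y _; exact: F0.
    rewrite preimage_setT; apply/esym.
    apply: ge0_integral_mrestr; last exact: mFX.
    by move=> om; exact: F0.
  pose c := NngNum (bw0 i).
  (* The mixing measure is [P] scaled by the weight of position [i], over the event that the current
     state is in the body. *)
  rewrite (@integral_mixture _ _ _ _ _ (mscale c P) (fun om => slice i (X t om))
    (X t @^-1` body))//.
  - rewrite ge0_integral_mscale//; last by move=> om _; exact: integral_ge0.
    exact: measurable_funTS.
  - move=> U mU; apply: (measurableT_comp (measurable_slice i mU)).
    exact: measurable_funPT.
  - move=> U mU; rewrite ge0_integral_mscale//; last first.
      apply: measurable_funTS.
      apply: (measurableT_comp (measurable_slice i mU)).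
      exact: measurable_funPT.
    rewrite -part_step//.
    by rewrite /nu /= /pushforward /mrestr setIC.
rewrite -ge0_integral_sum//.
- move=> i; apply: measurable_funTS; apply: measurable_funeM.
  apply: (measurableT_comp (measurable_slice_integral i mF)).
  exact: measurable_funPT.
- by move=> i om _; rewrite mule_ge0 ?lee_fin// integral_ge0.
Qed.

End expectation.

End gibbs_kernel.

(** * Stationarity *)

Section stationarity.
Context {R : realType} (m : nat) (al be ga : nat -> R).
Implicit Types (x y : vec R m) (i j s e : nat) (t : seq nat) (F H : vec R m -> \bar R).
Hypothesis coefs : pos_coefs m al be ga.
Local Notation poly := (poly al be ga : set (vec R m)).
Local Notation ind := (ind al be ga).
Local Notation Find := (Find al be ga).
Local Open Scope ereal_scope.

(** On the slice, [H] lives on a hyperplane orthogonal to an integrated direction. *)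
Lemma margs_null (c : R) j t H x : coords (m := m) (j :: t) -> j \notin t -> mnn H ->
  (forall y, agree_off (j :: t) y x -> H y != 0 -> crd y j = c) ->
  margs (j :: t) H x = 0.
Proof.
move=> /= /andP[jm tm] jt mH H0; rewrite /marg.
rewrite (@ge0_negligible_integral _ _ _ _ setT [set (c : measurableTypeR R)]) //; last 3 first.
- by apply: measurable_fun_upd; exact: mnn_margs.
- by move=> u _; exact: margs_ge0.
- exact: lebesgue_measure_set1.
apply: integral0_eq => u [_ /= /eqP u0]; apply: margs_eq0 => // y yx.
apply: contraNeq u0 => Hy; rewrite -(H0 y (agree_off_upd jm yx) Hy).
by rewrite yx// crd_upd// eqxx.
Qed.

Let Find_neq0 F y : Find F y != 0 -> poly y.
Proof. by rewrite /Find mule_eq0 negb_or => /andP[_ /ind_neq0]. Qed.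

Let degenerate s e H x : (s.+2 <= e <= m)%N -> mnn H ->
  (forall y, H y != 0 -> poly y) -> ldeg al ga s x || rdeg be ga e x ->
  margs (blk s e) H x = 0.
Proof.
move=> /andP[se em] mH Hp; have cb := coords_blk s em.
move=> /orP[dx|dx].
  have bE := @blk_cons s e ltac:(lia).
  rewrite bE; apply: (margs_null (c := 0%R)) => //; first by rewrite -bE.
    by rewrite mem_blk ltnn.
  move=> y; rewrite -bE => yx /Hp py; apply: (poly_ldeg coefs _ py); first by lia.
  by rewrite (ldeg_agree _ _ yx).
have pe : perm_eq (blk s e) (e :: blk s e.-1).
  apply: uniq_perm; [exact: iota_uniq|rewrite /= iota_uniq mem_blk; lia|].
  by move=> j; rewrite inE !mem_blk; lia.
rewrite (perm_margs cb pe mH); apply: (margs_null (c := 0%R)) => //.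
- by rewrite /coords -(perm_all _ pe).
- by rewrite mem_blk; lia.
move=> y yx' /Hp py; have yx : agree_off (blk s e) y x.
  by move=> j jb; apply: yx'; rewrite -(perm_mem pe).
apply: (poly_rdeg coefs _ py); first by lia.
by rewrite (rdeg_agree _ _ yx).
Qed.

Lemma mnn_slice_integral s e F : (e <= m)%N -> mnn F ->
  mnn (fun x => \int[slice_measure al be ga s e x]_y F y).
Proof.
move=> em [mF F0]; split; last by move=> x; exact: integral_ge0.
apply: measurable_fun_integral_kernel => // U.
exact: measurable_slice_measure.
Qed.

(** If a neighbour pins an end of the block, both sides vanish by [degenerate]. Otherwise the slice
    integral is constant along the block and factors out; the remaining volume cancels its
    normalization. *)
Lemma block_stationary s e F x : (s.+2 <= e <= m)%N -> unit_mnn F ->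
  margs (blk s e) (Find (fun y => \int[slice_measure al be ga s e y]_z F z)) x =
  margs (blk s e) (Find F) x.
Proof.
move=> sem [mF F1]; have /andP[se em] := sem; have cb := coords_blk s em.
have [dx|] := boolP (ldeg al ga s x || rdeg be ga e x).
  rewrite !degenerate//; [exact: mnn_Find|exact: Find_neq0| |exact: Find_neq0].
  exact/mnn_Find/mnn_slice_integral.
rewrite negb_or => /andP[nl nr].
have fE y : agree_off (blk s e) y x -> fblk al be ga s e y = blk s e.
  by move=> /fblk_agree ->; rewrite /fblk (negbTE nl) (negbTE nr) addn0 subn0.
pose W : vec R m -> _ := margs (blk s e) ind; pose V := margs (blk s e) (Find F).
have mi := mnn_ind m al be ga.
have W0 : 0 <= W x by exact: margs_ge0.
have V0 : 0 <= V x by apply: (@margs_ge0 _ _ (blk s e)); exact: mnn_Find.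
have fW : W x \is a fin_num by apply: (margs_ind_fin_num coefs) => //; exact: iota_uniq.
have c0 : 0 <= (fine (W x) `^ (-1))%:E * V x.
  by rewrite mule_ge0// lee_fin powR_ge0.
rewrite (@eq_margs _ _ _ _ (fun y => ((fine (W x) `^ (-1))%:E * V x) * ind y))//; last first.
  move=> y yx; rewrite /Find integral_slice_measure// /slice_coef fE//.
  congr ((fine _ `^ _)%:E * _ * _); first by apply: margs_agree.
  by apply: margs_agree.
rewrite (margsM (G := cst _))//= -/W.
have VW : V x <= W x by exact: margs_le_ind.
have [W00|Wn0] := eqVneq (W x) 0.
  by rewrite W00 mule0; apply/esym/eqP; rewrite eq_le V0 andbT -W00 VW.
rewrite muleAC -{2}(fineK fW) -EFinM powR_inv1 ?fine_ge0//.
by rewrite mulVf ?mul1e// fine_eq0.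
Qed.

Lemma slice_stationary s e F x : (s.+2 <= e <= m)%N -> unit_mnn F ->
  margs (iota 1 m) (Find (fun y => \int[slice_measure al be ga s e y]_z F z)) x =
  margs (iota 1 m) (Find F) x.
Proof.
move=> sem uF; have [mF F1] := uF; have /andP[se em] := sem.
set G := fun y => _; have mG : mnn G by exact: mnn_slice_integral.
pose rest := [seq j <- iota 1 m | j \notin blk s e].
have cm : coords (m := m) (iota 1 m) by apply/allP => j; rewrite mem_iota; lia.
have pe : perm_eq (iota 1 m) (rest ++ blk s e).
  apply: uniq_perm; first exact: iota_uniq.
    rewrite cat_uniq filter_uniq ?iota_uniq//= andbT.
    by apply/hasPn => j jb /=; rewrite mem_filter jb.
  move=> j; rewrite mem_cat mem_filter mem_iota mem_blk; lia.
rewrite !(perm_margs cm pe) ?margs_cat; [|exact: mnn_Find|exact: mnn_Find].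
by congr margs; apply/funext => y; exact: block_stationary.
Qed.

End stationarity.

(** * The uniform distribution as an average over all coordinates *)

Section uniform.
Context {R : realType} (n : nat) (pi : nat -> R).
Hypotheses (n0 : (0 < n)%N) (fs : full_support_distribution n pi).
Implicit Types (F : vec R n.-1 -> \bar R) (x y : vec R n.-1).
Local Open Scope ereal_scope.
Local Notation m := n.-1.
Local Notation body := (gibbs_body n pi).
Local Notation poly := (poly (wal pi) (wbe pi) (wbe pi) : set (vec R n.-1)).
Local Notation ind := (ind (wal pi) (wbe pi) (wbe pi)).
Local Notation FindB := (Find (wal pi) (wbe pi) (wbe pi)).

Let coefs : pos_coefs m (wal pi) (wbe pi) (wbe pi) := pos_coefs_pi n0 fs.
Let bodyE : body = poly := gibbs_bodyE n0 fs.

Let zero : vec R m := [tuple 0%R | _ < m].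

Let crd_zero i : crd zero i = 0%R.
Proof.
have [->|i0] := posnP i; first by rewrite crd0.
have [im|mi] := leqP i m; last by rewrite crd_out.
by rewrite (crd_mktuple (fun=> 0%R))// i0.
Qed.

Let cm : coords (m := m) (iota 1 m).
Proof. by apply/allP => j; rewrite mem_iota; lia. Qed.

Let poly_zero : poly zero.
Proof.
split=> [i im|i im]; first by rewrite crd_zero.
by rewrite !crd_zero !mulr0 addr0; have [_ _ /ltW] := coefs im.
Qed.

(** The positive box of [free_box_gt0] for the block of all coordinates at the origin, where each
    coordinate can be raised on its own. *)
Lemma body_volume_gt0 x : 0 < margs (iota 1 m) ind x.
Proof.
have -> : margs (iota 1 m) ind x = margs (iota 1 m) ind zero.
  apply: margs_agree => // i; rewrite mem_iota => im.
  have [->|i0] := posnP i; first by rewrite !crd0.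
  by rewrite !crd_out//; lia.
rewrite [ltRHS](_ : _ = margs [seq j <- iota 1 m |
    free_in (wal pi) (wbe pi) (wbe pi) (iota 1 m) zero j] ind zero).
  exact: free_box_gt0.
congr margs; apply/esym/all_filterP/allP => j jm; rewrite /free_in jm /=.
have jm' : (0 < j <= m)%N by move: jm; rewrite mem_iota; lia.
apply/asboolP.
have [a0 _ g0] := coefs (proj2 (andP jm')).
have [_ b0' g0'] := coefs (leq_trans (leq_pred j) (proj2 (andP jm'))).
pose v : R := Num.min (wbe pi j.-1 / wbe pi j.-1)%R (wbe pi j / wal pi j)%R.
have v0 : (0 < v)%R by rewrite lt_min !divr_gt0.
exists (upd zero j v); split.
- split=> [i im|i im].
    by rewrite crd_upd// crd_zero; case: eqP => // _; exact: ltW.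
  rewrite !crd_upd// !crd_zero; have [->|ij] := eqVneq i j.
    rewrite gtn_eqF// mulr0 addr0 mulrC -ler_pdivlMr// ge_min lexx orbT//.
  rewrite mulr0 add0r; have [ij'|_] := eqVneq i.+1 j.
    have -> : i = j.-1 by lia.
    by rewrite mulrC -ler_pdivlMr// ge_min lexx.
  by rewrite mulr0; have [_ _ /ltW] := coefs im.
- move=> i ib; rewrite crd_upd// ifF//; apply: contraNF ib => /eqP ->//.
- by rewrite crd_upd// eqxx.
Qed.

(** All coordinates are integrated, so the value is the same at every [x]. *)
Definition body_avg F x : R := avg (wal pi) (wbe pi) (wbe pi) F (iota 1 m) x.

Let fin_ind x : margs (iota 1 m) ind x \is a fin_num.
Proof. by apply: margs_ind_fin_num => //; exact: iota_uniq. Qed.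

Lemma uniform_bodyE x (A : set (vec R m)) : measurable A ->
  uniform_body n pi A = (body_avg (fun y => (\1_A y)%:E) x)%:E.
Proof.
move=> mA.
have lE B : measurable B ->
    @lebesgue_tuple R m (B `&` poly) = margs (iota 1 m) (fun y => (\1_B y)%:E * ind y) x.
  move=> mB; rewrite -[in RHS](filter_predT (iota 1 m)).
  exact: (@flat_setI _ _ (wal pi) (wbe pi) (wbe pi) predT x B mB).
rewrite /uniform_body /normalized bodyE lE//.
rewrite -[X in _ / lebesgue_tuple X]setTI lE//.
rewrite (_ : (fun y => (\1_setT y)%:E * ind y) = ind); last first.
  by apply/funext => y; rewrite indicT mul1e.
have fV : margs (iota 1 m) (FindB (fun y => (\1_A y)%:E)) x \is a fin_num.
  apply: (margs_Find_fin_num coefs) => //; [exact: mnn_indic| |exact: iota_uniq].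
  by move=> y; rewrite lee_fin indicE lern1 leq_b1.
have W0 := body_volume_gt0 x; rewrite /body_avg /avg -/(FindB _).
rewrite EFinM fineK//; congr (_ * _).
by rewrite -[in LHS](fineK (fin_ind x)) inver fine_eq0// gt_eqF.
Qed.

Let mnn_cst_ind (c : R) : (0 <= c)%R -> mnn (fun y => c%:E * ind y).
Proof.
move=> c0; have [mi i0] := mnn_ind m (wal pi) (wbe pi) (wbe pi).
by split=> [|y]; [exact: emeasurable_funM|rewrite mule_ge0].
Qed.

Lemma body_avg_le F (c : R) x : unit_mnn F -> (0 <= c)%R ->
  (forall y, poly y -> F y <= c%:E) -> (body_avg F x <= c)%R.
Proof.
move=> [mF F1] c0 Fc; have W0 := body_volume_gt0 x.
have mi := mnn_ind m (wal pi) (wbe pi) (wbe pi).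
have -> : (body_avg F x <= c)%R = ((body_avg F x)%:E * margs (iota 1 m) ind x <=
    c%:E * margs (iota 1 m) ind x) by rewrite lee_pmul2r ?fin_ind ?lee_fin.
rewrite -(avgE coefs)//; last exact: iota_uniq.
rewrite -(margsM (G := cst c%:E))//.
apply: le_margs => //; [exact: mnn_Find|exact: mnn_cst_ind|].
move=> y _ /=; rewrite /Find; have [py|py] := pselect (poly y).
  by rewrite ind1// !mule1 Fc.
by rewrite ind0// !mule0.
Qed.

Lemma body_avg_ge F (c : R) x : unit_mnn F ->
  (forall y, poly y -> c%:E <= F y) -> (c <= body_avg F x)%R.
Proof.
move=> [mF F1] Fc; have [c0|/ltW c0] := leP 0%R c; last first.
  by apply: (le_trans c0); exact: avg_ge0.
have W0 := body_volume_gt0 x; have mi := mnn_ind m (wal pi) (wbe pi) (wbe pi).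
have -> : (c <= body_avg F x)%R = (c%:E * margs (iota 1 m) ind x <=
    (body_avg F x)%:E * margs (iota 1 m) ind x) by rewrite lee_pmul2r ?fin_ind ?lee_fin.
rewrite -(avgE coefs)//; last exact: iota_uniq.
rewrite -(margsM (G := cst c%:E))//.
apply: le_margs => //; [exact: mnn_cst_ind|exact: mnn_Find|].
move=> y _ /=; rewrite /Find; have [py|py] := pselect (poly y).
  by rewrite ind1// !mule1 Fc.
by rewrite ind0// !mule0.
Qed.

End uniform.

(** * The upper bound *)

Section stationary_kernel.
Context {R : realType} (n k : nat) (w : R) (pi : nat -> R).
Hypotheses (k1 : (1 < k)%N) (kn : (k.+2 <= n)%N) (w0 : 0 < w).
Hypothesis fs : full_support_distribution n pi.
Local Open Scope ereal_scope.
Local Notation FindB := (Find (wal pi) (wbe pi) (wbe pi)).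
Local Notation positions := (index_iota 1 (n - k).+1).
Local Notation bw := (block_weight n k w).

Let n0 : (0 < n)%N. Proof. by lia. Qed.
Let k0 : (0 < k)%N. Proof. by lia. Qed.
Let coefs : pos_coefs n.-1 (wal pi) (wbe pi) (wbe pi) := pos_coefs_pi n0 fs.

Lemma gibbs_kernel_stationary (F : vec R n.-1 -> \bar R) x : unit_mnn F ->
  body_avg pi (gibbs_kernel k w pi F) x = body_avg pi F x.
Proof.
move=> uF; have [mF F1] := uF; rewrite /body_avg /avg; congr (fine _ / _)%R.
pose G i y := \int[slice_measure (wal pi) (wbe pi) (wbe pi) i.-1
  (minn (i + k).-1 n.-1) y]_z F z.
have mG i : mnn (G i : vec R n.-1 -> \bar R).
  by apply: mnn_slice_integral => //; rewrite geq_minr.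
have flatE H : mnn H -> margs (iota 1 n.-1) (FindB H) x =
    \int[flat_lebesgue (fun i : 'I_n.-1 => predT i.+1) x]_y FindB H y.
  move=> mH; rewrite (integral_flat predT); last exact: mnn_Find.
  by rewrite filter_predT.
rewrite flatE; last exact: mnn_gibbs_kernel.
(* As a single integral with all coordinates free, the average commutes with the sum over positions,
   and each summand is then stationary separately. *)
transitivity (\int[flat_lebesgue (fun i : 'I_n.-1 => predT i.+1) x]_y
    \sum_(i <- positions) (bw i)%:E * FindB (G i) y).
  apply: eq_integral => y _; rewrite /Find /gibbs_kernel ge0_sume_distrl.
    by apply: eq_bigr => i _; rewrite muleA.
  move=> i _; rewrite mule_ge0 ?lee_fin ?block_weight_ge0//.
  by have [_] := mG i; exact.
have mFG i : mnn (FindB (G i)) by exact: mnn_Find.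
have bw0 i : (0 <= bw i)%R by exact: block_weight_ge0.
rewrite ge0_integral_sum//; last 2 first.
- by move=> i; apply: measurable_funeM; case: (mFG i).
- by move=> i y _; rewrite mule_ge0 ?lee_fin//; case: (mFG i).
rewrite (eq_big_seq (fun i => (bw i)%:E * margs (iota 1 n.-1) (FindB F) x)); last first.
  move=> i; rewrite mem_index_iota => im.
  rewrite ge0_integralZl_EFin//; last 2 first.
  - by move=> y _; case: (mFG i).
  - by case: (mFG i).
  congr (_ * _); rewrite -flatE// /G.
  rewrite (_ : minn (i + k).-1 n.-1 = (i + k).-1); last by lia.
  by apply: (slice_stationary coefs) => //; lia.
rewrite -ge0_sume_distrl; last by move=> i _; rewrite lee_fin.
by rewrite sumEFin sum_block_weight// mul1e.
Qed.

End stationary_kernel.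

Section upper_bound.
Context {R : realType} (n : nat) (pi : nat -> R).
Hypotheses (n58 : (58 < n)%N) (fs : full_support_distribution n pi).
Implicit Types (F : vec R n.-1 -> \bar R) (x y : vec R n.-1) (t : nat).
Local Notation body := (gibbs_body n pi).
Local Notation kernel := (gibbs_kernel 55 55 pi).
Local Notation polyB := (poly (wal pi) (wbe pi) (wbe pi) : set (vec R n.-1)).

Let n0 : (0 < n)%N. Proof. by lia. Qed.
Let kn : (57 <= n)%N. Proof. by lia. Qed.
Let w0 : 0 < 55 :> R. Proof. by []. Qed.
Let coefs : pos_coefs n.-1 (wal pi) (wbe pi) (wbe pi) := pos_coefs_pi n0 fs.
Let bodyE : body = polyB := gibbs_bodyE n0 fs.

Let rate : R := 1 - 2 / (n + 53)%:R.

Let Z0 : 0 < (n + 53)%:R :> R. Proof. by rewrite ltr0n; lia. Qed.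

Let rate_ge0 : 0 <= rate.
Proof. by rewrite /rate subr_ge0 ler_pdivrMr// mul1r ler_nat; lia. Qed.

Let evolve t F := iter t kernel F.

Let evolve_unit t F : unit_mnn F -> unit_mnn (evolve t F).
Proof. by move=> uF; elim: t => //= t IHt; exact: gibbs_kernel_unit. Qed.

Let evolve_lipschitz t F : unit_mnn F ->
  lipschitz (wal pi) (wbe pi) (wbe pi) (fun j => (heavy n j)%:R) F ->
  lipschitz (wal pi) (wbe pi) (wbe pi) (fun j => rate ^+ t * (heavy n j)%:R) (evolve t F).
Proof.
move=> uF lF; elim: t => [|t IHt].
  rewrite (_ : (fun _ => _) = (fun j => (heavy n j)%:R))//.
  by apply/funext => j; rewrite expr0 mul1r.
move=> x y px py; have ut := evolve_unit t uF.
rewrite [evolve _ _ x]/= [evolve _ _ y]/= !(gibbs_kernelE _ _ _ _ _ ut)//.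
have E z : \sum_(i <- index_iota 1 (n - 55).+1) block_weight n 55 55 i *
    block_avg (wal pi) (wbe pi) (wbe pi) (evolve t F) i.-1 (i + 55).-1 z =
    gibbs_op pi (evolve t F) z.
  rewrite /gibbs_op (_ : (n - 55).+1 = n - 54)%N; last by lia.
  by apply: eq_bigr => i _; rewrite addnS.
rewrite !E -EFinD lee_fin exprSr.
by apply: gibbs_op_lipschitz => //; exact: exprn_ge0.
Qed.

Let indic_unit (A : set (vec R n.-1)) : measurable A -> unit_mnn (fun y => (\1_A y)%:E).
Proof.
move=> mA; split=> [|y]; first exact: mnn_indic.
by rewrite lee_fin indicE lern1 leq_b1.
Qed.

Let indic_lipschitz (A : set (vec R n.-1)) :
  lipschitz (wal pi) (wbe pi) (wbe pi) (fun j => (heavy n j)%:R) (fun y => (\1_A y)%:E).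
Proof.
move=> x y _ _; rewrite -EFinD lee_fin.
have h0 (z z' : vec R n.-1) : 0 <= hamming (fun j => (heavy n j)%:R) z z' by apply: hamming_ge0 => i; rewrite ler0n.
have [->|xy] := eqVneq x y; first by rewrite lerDl.
have [i im xyi] : exists2 i : 'I_n.-1, true & crd x i.+1 != crd y i.+1.
  apply: contra_neqP xy => nox; apply: vecP => -[//|i] im.
  apply/eqP; apply: contrapT => /negP xyi; apply: nox.
  by exists (Ordinal (im : (i < n.-1)%N)).
apply: (@le_trans _ _ 1); first by rewrite indicE lern1 leq_b1.
apply: (@le_trans _ _ (hamming (fun j => (heavy n j)%:R) x y)); last first.
  by rewrite lerDr.
rewrite /hamming (bigD1 i)//= xyi mulr1 -[leLHS]addr0; apply: lerD.
  by rewrite ler1n /heavy; case: ifP.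
by apply: sumr_ge0 => j _; rewrite mulr_ge0.
Qed.

(** There are [n - 1] coordinates, and the two heavy ones contribute at most 12 extra each. *)
Let hamming_total (c : R) x y : 0 <= c ->
  hamming (fun j => c * (heavy n j)%:R) x y <= c * (n + 23)%:R.
Proof.
move=> c0; apply: (@le_trans _ _ (\sum_(i < n.-1) c * (heavy n i.+1)%:R)).
  apply: ler_sum => i _; rewrite -[leRHS]mulr1; apply: ler_wpM2l.
    by rewrite mulr_ge0.
  by rewrite lern1 leq_b1.
rewrite -mulr_sumr; apply: ler_wpM2l => //; rewrite -natr_sum ler_nat.
have h N : (\sum_(i < N) heavy n i.+1 <= N + 12 * ((55 < N) + (n - 57 < N)))%N.
  elim: N => [|N IHN]; first by rewrite big_ord0.
  rewrite big_ord_recr /=. move: IHN; move: (\sum_(i < N) _)%N => S IHN.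
  rewrite /heavy; case: ifP; lia.
by apply: leq_trans (h n.-1) _; lia.
Qed.

Section chain.
Context d (Om : measurableType d) (P : probability Om R).
Variables (X : nat -> {RV P >-> vec R n.-1}) (I : nat -> {RV P >-> nat}).
Hypothesis XI : block_gibbs_sampler n pi 55 55 X I.
Local Open Scope ereal_scope.

Let expectation_evolve s t F : unit_mnn F ->
  \int[P]_om F (X (s + t)%N om) = \int[P]_om evolve t F (X s om).
Proof.
move=> uF; elim: t s => [|t IHt] s; first by rewrite addn0.
rewrite addnS -addSn IHt /=.
exact: (expectation_step _ kn w0 fs XI _ (evolve_unit t uF)).
Qed.

Let measurable_start : measurable (X 0%N @^-1` body).
Proof.
rewrite -[X in measurable X]setTI; apply: measurable_funP => //.
by rewrite bodyE; exact: measurable_poly.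
Qed.

Let start_body : P (X 0%N @^-1` body) = 1.
Proof. by case: XI. Qed.

Let start_integral F : mnn F ->
  \int[P]_om F (X 0%N om) = \int[P]_(om in X 0%N @^-1` body) F (X 0%N om).
Proof.
move=> [mF F0].
rewrite (@ge0_negligible_integral _ _ _ P setT (~` (X 0%N @^-1` body)))//.
- by rewrite setTD setCK.
- exact: measurableC.
- by apply: measurableT_comp => //; exact: measurable_funPT.
- by rewrite [LHS]probability_setC// start_body subee.
Qed.

(** The evolved indicator has the same uniform mean [a] as the original one and oscillates by at
    most [eps] on the body. Hence all its values there, and their mean under the initial law, are
    within [eps] of [a]. *)
Lemma upper_event t (A : set (vec R n.-1)) : measurable A ->
  `|distribution P (X t) A - uniform_body n pi A| <= (rate ^+ t * (n + 23)%:R)%:E.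
Proof.
move=> mA; pose F : vec R n.-1 -> \bar R := fun y => (\1_A y)%:E.
have uF : unit_mnn F := indic_unit mA.
have uFt := evolve_unit t uF; have [mFt Ft1] := uFt; have [mFt' Ft0] := mFt.
have r0 : (0 <= rate ^+ t)%R by exact: exprn_ge0.
set eps := (rate ^+ t * (n + 23)%:R)%R; have e0 : (0 <= eps)%R by rewrite mulr_ge0.
have osc (x y : vec R n.-1) : polyB x -> polyB y -> evolve t F x <= evolve t F y + eps%:E.
  move=> px py; apply: le_trans (evolve_lipschitz t uF (@indic_lipschitz A) px py) _.
  by rewrite leeD2l// lee_fin; exact: hamming_total.
have fin x : evolve t F x \is a fin_num.
  by rewrite ge0_fin_numE// (le_lt_trans (Ft1 x))// ltry.
pose x0 : vec R n.-1 := [tuple 0%R | _ < n.-1].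
set a := body_avg pi F x0.
have UE : uniform_body n pi A = a%:E by exact: uniform_bodyE.
have aE : a = body_avg pi (evolve t F) x0.
  rewrite /a; elim: t {r0 eps e0 osc uFt mFt Ft1 mFt' Ft0 fin} => //= t ->.
  by rewrite gibbs_kernel_stationary//; exact: evolve_unit.
have a0 : (0 <= a)%R by rewrite aE; exact: avg_ge0.
have Fa (y : vec R n.-1) : polyB y -> evolve t F y <= (a + eps)%:E.
  move=> py; rewrite -(fineK (fin y)) lee_fin -lerBlDr aE.
  apply: body_avg_ge => // z pz; rewrite EFinB leeBlDr// fineK//.
  exact: osc.
have aF (y : vec R n.-1) : polyB y -> a%:E <= evolve t F y + eps%:E.
  move=> py; rewrite -(fineK (fin y)) -EFinD lee_fin aE.
  apply: body_avg_le => //; first by rewrite addr_ge0// fine_ge0.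
  by move=> z pz; rewrite EFinD fineK//; exact: osc.
have mX0 : measurable_fun setT (fun om => evolve t F (X 0%N om)).
  by apply: measurableT_comp => //; exact: measurable_funPT.
have PE : distribution P (X t) A = \int[P]_(om in X 0%N @^-1` body) evolve t F (X 0%N om).
  rewrite -start_integral// -expectation_evolve// add0n.
  have mXA : measurable (X t @^-1` A).
    by rewrite -[X in measurable X]setTI; exact: measurable_funP.
  transitivity (\int[P]_om (\1_(X t @^-1` A) om)%:E); last exact: eq_integral.
  by rewrite integral_indic// setIT.
have cstE (r : R) : \int[P]_(om in X 0%N @^-1` body) r%:E = r%:E.
  by rewrite integral_cst// [X in _ * X]start_body mule1.
have mFX : measurable_fun (X 0%N @^-1` body) (fun om => evolve t F (X 0%N om)).
  exact: measurable_funTS.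
have le1 : distribution P (X t) A <= (a + eps)%:E.
  rewrite PE -cstE; apply: ge0_le_integral => //.
  by move=> om om0; apply: Fa; move: om0; rewrite /= bodyE.
have le2 : a%:E <= distribution P (X t) A + eps%:E.
  rewrite PE -[in leLHS]cstE -[in leRHS](cstE eps) -ge0_integralD//.
  apply: ge0_le_integral => //.
  - exact: emeasurable_funD.
  - by move=> om om0; apply: aF; move: om0; rewrite /= bodyE.
have fp : distribution P (X t) A \is a fin_num by exact: fin_num_measure.
move: le1 le2; rewrite UE -(fineK fp) -EFinD !lee_fin => le1 le2.
by rewrite ler_norml; lra.
Qed.

Lemma gibbs_upper_bound (c : R) t : (0 < c)%R -> (2 * c * n%:R * ln n%:R < t%:R)%R ->
  tv_distance (distribution P (X t)) (uniform_body n pi) <= (n%:R `^ (1 - c))%:E.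
Proof.
move=> c0 tc; apply: ge_ereal_sup => _ [A mA <-].
have n1 : (1 <= n%:R :> R)%R by rewrite ler1n.
(* For [c <= 1] the claimed bound is at least 1. For [c > 1] there is room to lose: the estimate
   obtained is [n ^ (2 - 2c)]. *)
have [c1|c1] := leP c 1%R.
  apply: (@le_trans _ _ 1); last first.
    by rewrite lee_fin -[leLHS](powRr0 n%:R) ler_powR// subr_ge0.
  pose x0 : vec R n.-1 := [tuple 0%R | _ < n.-1].
  have fp : distribution P (X t) A \is a fin_num by exact: fin_num_measure.
  have p1 : distribution P (X t) A <= 1 by exact: probability_le1.
  have p0 : 0 <= distribution P (X t) A by exact: measure_ge0.
  have uF := indic_unit mA.
  rewrite (uniform_bodyE n0 fs x0 mA); set a := body_avg _ _ _.
  have a0 : (0 <= a)%R by apply: (avg_ge0 _ _ _ uF.1).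
  have a1 : (a <= 1)%R by apply: body_avg_le => // y _; have [_] := uF; exact.
  move: p0 p1; rewrite -(fineK fp) !lee_fin => p0 p1.
  by rewrite ler_norml; lra.
apply: (le_trans (upper_event t mA)); rewrite lee_fin.
set L : R := ln n%:R; have nE : n%:R = expR L by rewrite lnK// posrE; lra.
have L0 : (0 <= L)%R by exact: ln_ge0.
have -> : (n%:R `^ (1 - c) = expR ((1 - c) * L))%R.
  by rewrite /powR ifF// gt_eqF//; lra.
(* The first factor bounds [rate ^+ t], the second bounds [n + 23] crudely by the square of [n]. *)
apply: (@le_trans _ _ (expR (- (2 * c * L)) * expR (2 * L)))%R; last first.
  rewrite -expRD ler_expR.
  have : (0 <= (c - 1) * L)%R by rewrite mulr_ge0//; lra.
  lra.
have n59 : (59 <= n%:R :> R)%R by rewrite (ler_nat R 59).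
have r_le : (rate <= expR (- (2 / (n + 53)%:R)))%R by exact: expR_ge1Dx.
apply: ler_pM => //.
- exact: exprn_ge0.
- apply: (@le_trans _ _ (expR (- (2 / (n + 53)%:R)) ^+ t)%R).
    by apply: lerXn2r => //; rewrite ?nnegrE ?expR_ge0.
  rewrite -expRM_natr ler_expR mulNr lerN2.
  rewrite [leRHS]mulrAC ler_pdivlMr// natrD.
  (* This is [2 * c * L * (n + 53) <= 4 * c * n * L], and the right side is less than [2 * t]. *)
  have h : (0 <= c * L * (n%:R - 53))%R.
    by rewrite !mulr_ge0//; [exact: ltW|lra].
  move: tc h; rewrite -/L; move: (n%:R : R) (t%:R : R) => N T.
  lra.
- rewrite (_ : 2 * L = L + L)%R; last by ring.
  rewrite expRD -nE natrD.
  nra.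
Qed.

End chain.

End upper_bound.

(** * The lower bound *)

Section second_moment.
Context d (T : measurableType d) (R : realType) (P : probability T R).
Local Open Scope ereal_scope.

(* Integrate [2 l N <= 1_(N > 0) + l^2 N^2], where [N] counts the events that
   occur and [l = (1 + M a)^-1]. *)
Lemma second_moment M (G : 'I_M -> set T) (a : R) :
  (forall i, measurable (G i)) -> (0 <= a)%R ->
  (forall i, a%:E <= P (G i)) ->
  (forall i j, i != j -> P (G i `&` G j) <= (a ^+ 2)%:E) ->
  (1 - (1 + M%:R * a)^-1)%:E <= P (\bigcup_i G i).
Proof.
move=> mG a0 Ga Gaa; set y : R := (M%:R * a)%R; set l : R := ((1 + y)^-1)%R.
have y0 : (0 <= y)%R by rewrite mulr_ge0.
have l0 : (0 < l)%R by rewrite invr_gt0; lra.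
have ly : (l * (1 + y) = 1)%R by rewrite mulVf// gt_eqF//; lra.
have mU : measurable (\bigcup_i G i) by exact: fin_bigcup_measurable.
have mGG i j : measurable (G i `&` G j) by exact: measurableI.
pose g i := fine (P (G i)); pose h i j := fine (P (G i `&` G j)); pose p := fine (P (\bigcup_i G i)).
have gE i : P (G i) = (g i)%:E by rewrite fineK// fin_num_measure.
have hE i j : P (G i `&` G j) = (h i j)%:E by rewrite fineK// fin_num_measure.
have pE : P (\bigcup_i G i) = p%:E by rewrite fineK// fin_num_measure.
have pointwise x : (\sum_(i < M) 2 * l * \1_(G i) x <=
    \1_(\bigcup_i G i) x + \sum_(i < M) \sum_(j < M) l ^+ 2 * \1_(G i `&` G j) x)%R.
  rewrite -mulr_sumr; set N : R := (\sum_(i < M) \1_(G i) x)%R.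
  have -> : (\sum_(i < M) \sum_(j < M) l ^+ 2 * \1_(G i `&` G j) x = l ^+ 2 * (N * N))%R.
    rewrite /N mulr_suml mulr_sumr; apply: eq_bigr => i _.
    by rewrite !mulr_sumr; apply: eq_bigr => j _; rewrite indicI.
  have [[i _ xi]|xU] := pselect ((\bigcup_i G i) x).
    rewrite [X in (_ <= X + _)%R]indicE mem_set; last by exists i.
    by rewrite /=; have := sqr_ge0 (1 - l * N)%R; rewrite !expr2; lra.
  rewrite (_ : N = 0)%R; last first.
    rewrite /N big1// => i _; rewrite indicE memNset// => xi; apply: xU.
    by exists i.
  by rewrite !mulr0 addr0 indicE.
have mind (A : set T) : measurable A -> measurable_fun setT (fun x => (\1_A x)%:E : \bar R).
  by move=> mA; apply/measurable_EFinP; exact: measurable_indic.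
have : \int[P]_x (\sum_(i < M) (2 * l)%:E * (\1_(G i) x)%:E) <=
    \int[P]_x ((\1_(\bigcup_i G i) x)%:E +
      \sum_(i < M) \sum_(j < M) (l ^+ 2)%:E * (\1_(G i `&` G j) x)%:E).
  apply: ge0_le_integral => //.
  - by move=> x _; apply: sume_ge0 => i _; rewrite mule_ge0 ?lee_fin// mulr_ge0// ltW.
  - by apply: emeasurable_sum => i; apply: measurable_funeM; exact: mind.
  - apply: emeasurable_funD; first exact: mind.
    apply: emeasurable_sum => i; apply: emeasurable_sum => j.
    by apply: measurable_funeM; exact: mind.
  - move=> x _; move: (pointwise x); rewrite -lee_fin EFinD -!sumEFin.
    move=> h1; apply: le_trans (le_trans _ h1) _.
      by rewrite le_eqVlt; apply/orP; left; apply/eqP; apply: eq_bigr.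
    rewrite leeD2l// le_eqVlt; apply/orP; left; apply/eqP.
    by apply: eq_bigr => i _; rewrite -sumEFin.
have int1 (A : set T) (c : R) : measurable A -> (0 <= c)%R ->
    \int[P]_x (c%:E * (\1_A x)%:E) = c%:E * P A.
  move=> mA c0; rewrite ge0_integralZl_EFin//; last exact: mind.
  by rewrite integral_indic// setIT.
rewrite ge0_integralD//; last 3 first.
- exact: mind.
- by move=> x _; do 2 (apply: sume_ge0 => ? _); rewrite mule_ge0 ?lee_fin// sqr_ge0.
- apply: emeasurable_sum => i; apply: emeasurable_sum => j.
  by apply: measurable_funeM; exact: mind.
rewrite ge0_integral_sum//; last 2 first.
- by move=> i; apply: measurable_funeM; exact: mind.
- by move=> i x _; rewrite mule_ge0 ?lee_fin// mulr_ge0// ltW.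
rewrite ge0_integral_sum//; last 2 first.
- by move=> i; apply: emeasurable_sum => j; apply: measurable_funeM; exact: mind.
- by move=> i x _; apply: sume_ge0 => j _; rewrite mule_ge0 ?lee_fin// sqr_ge0.
have -> : \int[P]_x (\1_(\bigcup_i G i) x)%:E = p%:E.
  by rewrite integral_indic// setIT; exact: pE.
rewrite pE.
rewrite (eq_bigr (fun i => (2 * l * g i)%:E)); last first.
  by move=> i _; rewrite int1// ?mulr_ge0// ?gE// ltW.
rewrite [X in _ <= _ + X](eq_bigr (fun i => (\sum_(j < M) l ^+ 2 * h i j)%:E)); last first.
  move=> i _; rewrite -sumEFin ge0_integral_sum//; last 2 first.
  - by move=> j; apply: measurable_funeM; exact: mind.
  - by move=> j x _; rewrite mule_ge0 ?lee_fin// sqr_ge0.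
  by apply: eq_bigr => j _; rewrite int1// ?sqr_ge0// hE.
rewrite !sumEFin -EFinD !lee_fin => main.
have hle i : (\sum_(j < M) l ^+ 2 * h i j <= l ^+ 2 * (g i + M%:R * a ^+ 2))%R.
  rewrite -mulr_sumr; apply: ler_wpM2l; first exact: sqr_ge0.
  rewrite (bigD1 i)//=; apply: lerD; first by rewrite /h setIid.
  apply: (@le_trans _ _ (\sum_(j < M) a ^+ 2)%R); last first.
    by rewrite sumr_const card_ord mulr_natl.
  rewrite [leRHS](bigD1 i)//= -[leLHS]add0r; apply: lerD; first exact: sqr_ge0.
  by apply: ler_sum => j ji; rewrite -lee_fin -hE Gaa// eq_sym.
have hsum : (\sum_(i < M) \sum_(j < M) l ^+ 2 * h i j <=
    l ^+ 2 * (\sum_(i < M) g i + y ^+ 2))%R.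
  apply: le_trans (ler_sum _ (fun i _ => hle i)) _.
  rewrite -mulr_sumr big_split /= sumr_const card_ord /y.
  by rewrite -[(_ *+ M)%R]mulr_natl le_eqVlt; apply/orP; left; apply/eqP; ring.
have gsum : (y <= \sum_(i < M) g i)%R.
  rewrite /y mulr_natl -[leLHS](_ : \sum_(i < M) a = _)%R; last by rewrite sumr_const card_ord.
  by apply: ler_sum => i _; rewrite -lee_fin -gE.
move: main; rewrite -mulr_sumr; move: gsum hsum; move: (\sum_(i < M) g i)%R => S.
move: (\sum_(i < M) _)%R => V yS VS SV.
have l1 : (l <= 1)%R by rewrite invf_le1; lra.
(* The diagonal terms contribute the sum [S] of the probabilities, which has no upper bound in terms
   of [a]. Its total coefficient [2 * l - l ^+ 2] is nonnegative, so [S] may be replaced by its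
   lower bound [y]. *)
have : (0 <= (l * (2 - l)) * (S - y))%R by rewrite !mulr_ge0//; lra.
have e : (1 - l = l * y)%R by lra.
have e2 : (l ^+ 2 * y + l ^+ 2 * y ^+ 2 = l * y)%R.
  transitivity (l * y * (l * (1 + y)))%R; first by ring.
  by rewrite ly mulr1.
rewrite e; move: SV VS; lra.
Qed.

End second_moment.

(** * Events that a coordinate has never been resampled *)

Section survival.
Context {R : realType} (n k : nat) (w : R) (pi : nat -> R).
Hypotheses (k0 : (0 < k)%N) (kn : (k.+2 <= n)%N) (w0 : 0 < w).
Hypothesis fs : full_support_distribution n pi.
Context d (Om : measurableType d) (P : probability Om R).
Variables (X : nat -> {RV P >-> vec R n.-1}) (I : nat -> {RV P >-> nat}).
Hypothesis XI : block_gibbs_sampler n pi k w X I.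
Implicit Types (t i j : nat) (Q : pred nat) (A : set (vec R n.-1)).

Local Notation bw := (block_weight n k w).
Local Notation positions := (index_iota 1 (n - k).+1).
Local Notation body := (gibbs_body n pi).
Local Notation Z := ((n - k)%:R - 2 + 2 * w).
Local Notation ind := (ind (wal pi) (wbe pi) (wbe pi)).

Let n0 : (0 < n)%N. Proof. by lia. Qed.
Let coefs : pos_coefs n.-1 (wal pi) (wbe pi) (wbe pi) := pos_coefs_pi n0 fs.
Let bodyE : body = (poly (wal pi) (wbe pi) (wbe pi) : set (vec R n.-1)) := gibbs_bodyE n0 fs.

Definition covers j : pred nat := fun i => (i <= j < i + k)%N.

(** This range of [j] keeps the [k] covering positions away from both ends, so each of them has
    weight 1 before normalization. *)
Lemma covers_weight j : (k < j < n - k)%N ->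
  \sum_(i <- positions | covers j i) bw i = k%:R / Z.
Proof.
move=> jk; rewrite (eq_bigl (fun i => (j.+1 - k <= i < j.+1)%N)); last first.
  by move=> i; rewrite /covers; lia.
transitivity (\sum_(i <- positions | (j.+1 - k <= i < j.+1)%N) Z^-1 * 1%:R).
  rewrite big_seq_cond [RHS]big_seq_cond; apply: eq_bigr => i; rewrite mem_index_iota => im.
  rewrite mulr1 /block_weight ifT; last by lia.
  by rewrite ifF ?mul1r//; lia.
rewrite -mulr_sumr -natr_sum sum_nat_itv mulrC; congr (_%:R / _); lia.
Qed.

Local Open Scope ereal_scope.

(** Used with [A] fixing one coordinate and [Q] the positions that miss it. The states are part of
    the event because the sampler is given by its law: a coordinate outside the block is kept only
    almost surely. *)
Fixpoint survival A Q t : set Om :=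
  if t is t'.+1 then survival A Q t' `&` [set om | Q (I t' om)] `&` X t @^-1` A
  else X 0%N @^-1` A.

Lemma survival_history A Q t : measurable A -> history X I t (survival A Q t).
Proof.
move=> mA; elim: t => [|t IHt] /=; first exact: history_state.
apply: history_setI; last exact: history_state.
apply: history_setI; last exact: history_position.
exact: history_le IHt.
Qed.

Lemma survival_state A Q t : survival A Q t `<=` X t @^-1` A.
Proof. by case: t => [|t] om //= []. Qed.

Lemma survivalI A A' Q Q' t :
  survival A Q t `&` survival A' Q' t `<=` survival (A `&` A') (predI Q Q') t.
Proof.
elim: t => [|t IHt] om [] //= [[h1 h2] h3] [[h1' h2'] h3'].
by split; [split; [exact: IHt|rewrite h2 h2']|].
Qed.

Lemma survivalS A A' Q t : A `<=` A' -> survival A Q t `<=` survival A' Q t.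
Proof.
move=> AA'; elim: t => [|t IHt] om /=; first exact: AA'.
by move=> [[h1 h2] h3]; split; [split; [exact: IHt|]|exact: AA'].
Qed.

Let mbody : measurable body.
Proof. by rewrite bodyE; exact: measurable_poly. Qed.

Lemma survival_ge A Q t : measurable A -> A `<=` body -> P (X 0%N @^-1` A) = 1 ->
  (forall i x, (0 < i <= n - k)%N -> Q i -> A x -> block_slice body k i x `<=` A) ->
  ((\sum_(i <- positions | Q i) bw i) ^+ t)%:E <= P (survival A Q t).
Proof.
move=> mA Ab A1 AQ; elim: t => [|t IHt]; first by rewrite /= A1 expr0.
have := step_ge k0 kn w0 fs XI (@survival_history A Q t mA)
  (subset_trans (@survival_state A Q t) (preimage_subset Ab)) mA.
have AQ' i om : (0 < i <= n - k)%N -> Q i -> survival A Q t om ->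
    block_slice body k i (X t om) `<=` A.
  by move=> im Qi /survival_state; exact: AQ.
move=> /(_ Q AQ'); apply: le_trans; rewrite exprS EFinM lee_wpmul2l//.
by rewrite lee_fin; apply: sumr_ge0 => i _; exact: block_weight_ge0.
Qed.

(** Since [step_ge] gives lower bounds only, it is applied to the excluded positions, with no
    condition on the next state, and the result is subtracted from the mass before the step. *)
Lemma survival_le Q t :
  P (survival body Q t) <= ((\sum_(i <- positions | Q i) bw i) ^+ t)%:E.
Proof.
have s0 : (0 <= \sum_(i <- positions | Q i) bw i)%R.
  by apply: sumr_ge0 => i _; exact: block_weight_ge0.
have mS s : measurable (survival body Q s).
  exact: (history_measurable (@survival_history body Q s mbody)).
have mI (A : set nat) s : measurable (I s @^-1` A).
  by rewrite -[X in measurable X]setTI; exact: measurable_funP.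
elim: t => [|t IHt]; first by rewrite expr0 probability_le1//; exact: (mS 0%N).
set S := survival body Q t in IHt *.
have mSQ Q' : measurable (S `&` [set om | Q' (I t om)]).
  by apply: measurableI; [exact: mS|exact: (mI [set i | Q' i])].
apply: (@le_trans _ _ (P (S `&` [set om | Q (I t om)]))).
  apply: le_measure; rewrite ?inE.
  - exact: (mS t.+1).
  - exact: mSQ.
  - by move=> om [].
have split_S : P S = P (S `&` [set om | Q (I t om)]) +
    P (S `&` [set om | ~~ Q (I t om)]).
  have SQC : S `&` [set om | Q (I t om)] `&` (S `&` [set om | ~~ Q (I t om)]) = set0.
    by apply/seteqP; split => om // [[_ /= q] [_ /=]]; rewrite q.
  rewrite -(measureU _ (mSQ Q) (mSQ (predC Q)) SQC).
  congr (P _); rewrite -setIUr; apply/seteqP; split => om /=; last by case.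
  by case: (Q _) => Som; split=> //; [left|right].
have bound : ((1 - \sum_(i <- positions | Q i) bw i)%R)%:E * P S <=
    P (S `&` [set om | ~~ Q (I t om)]).
  have -> : (1 - \sum_(i <- positions | Q i) bw i)%R =
      (\sum_(i <- positions | ~~ Q i) bw i)%R.
    by rewrite -(sum_block_weight k0 kn w0) (bigID Q)/=; lra.
  apply: le_trans (step_ge k0 kn w0 fs XI (@survival_history body Q t mbody)
    (@survival_state body Q t) (@measurableT _ _) _) _ => //.
  by rewrite preimage_setT setIT.
have fS : P S \is a fin_num by apply: fin_num_measure; exact: mS.
have fSQ Q' : P (S `&` [set om | Q' (I t om)]) \is a fin_num.
  by apply: fin_num_measure; exact: mSQ.
move: IHt split_S bound; rewrite -(fineK fS) -(fineK (fSQ Q)) -(fineK (fSQ (predC Q))).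
rewrite -EFinD -EFinM !lee_fin => IHt [e] bound.
rewrite exprS; apply: le_trans (ler_wpM2l s0 IHt).
lra.
Qed.

End survival.

(** * Total variation bound from the surviving coordinates *)

Section lower_bound.
Context {R : realType} (n k : nat) (w : R) (pi : nat -> R).
Hypotheses (k0 : (0 < k)%N) (kn : (k.+2 <= n)%N) (w0 : 0 < w).
Hypothesis fs : full_support_distribution n pi.
Implicit Types (t i j : nat) (x : vec R n.-1).

Local Notation bw := (block_weight n k w).
Local Notation positions := (index_iota 1 (n - k).+1).
Local Notation body := (gibbs_body n pi).
Local Notation Z := ((n - k)%:R - 2 + 2 * w).

Let n0 : (0 < n)%N. Proof. by lia. Qed.
Let bodyE : body = (poly (wal pi) (wbe pi) (wbe pi) : set (vec R n.-1)) := gibbs_bodyE n0 fs.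

Let mbody : measurable body.
Proof. by rewrite bodyE; exact: measurable_poly. Qed.

Local Open Scope ereal_scope.

Definition fiber j (c : R) : set (vec R n.-1) := [set x | crd x j = c].

Lemma measurable_fiber j c : measurable (fiber j c).
Proof.
rewrite (_ : fiber j c = (fun x => crd x j) @^-1` [set c])//.
by rewrite -[X in measurable X]setTI; exact: measurable_crd.
Qed.

Lemma fiber_null j c : (0 < j <= n.-1)%N ->
  @lebesgue_tuple R n.-1 (fiber j c `&` body) = 0.
Proof.
move=> jn; pose x : vec R n.-1 := [tuple 0%R | _ < n.-1]; rewrite bodyE.
apply: (etrans (@flat_setI _ _ (wal pi) (wbe pi) (wbe pi) predT x _ (measurable_fiber j c))).
rewrite filter_predT; set H := fun y => _.
have mH : mnn H.
  have [mf f0] := mnn_ind n.-1 (wal pi) (wbe pi) (wbe pi).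
  have [mg g0] := mnn_indic (measurable_fiber j c).
  by split => [|y]; [exact: emeasurable_funM|exact: mule_ge0].
have cm : coords (m := n.-1) (iota 1 n.-1) by apply/allP => i; rewrite mem_iota; lia.
have jm : j \in iota 1 n.-1 by rewrite mem_iota; lia.
have pe := perm_to_rem jm; rewrite (perm_margs cm pe mH).
apply: (margs_null (c := c)) => //.
- by rewrite /coords -(perm_all _ pe).
- by rewrite mem_rem_uniqF// iota_uniq.
move=> y _; rewrite /H mule_eq0 negb_or => /andP[+ _].
by rewrite indicE; case: (boolP (y \in _)) => [|_]; rewrite ?eqxx// inE.
Qed.

Lemma fibers_null M (j : nat -> nat) (c : nat -> R) :
  (forall a, (a < M)%N -> (0 < j a <= n.-1)%N) ->
  uniform_body n pi (\big[setU/set0]_(a < M) fiber (j a) (c a)) = 0.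
Proof.
move=> jM; rewrite /uniform_body /normalized.
rewrite (_ : lebesgue_tuple _ = 0) ?mul0e//; apply/eqP; rewrite eq_le measure_ge0 andbT.
rewrite big_distrl/=.
pose mu : {measure set (vec R n.-1) -> \bar R} := prod_measure (fun _ : 'I_n.-1 => @lebesgue_measure R).
apply: (@le_trans _ _ (\sum_(a < M) mu (fiber (j a) (c a) `&` body))).
  apply: (@le_mu_bigsetU _ _ _ mu (fun a => fiber (j a) (c a) `&` body)) => a _.
  by apply: measurableI => //; exact: measurable_fiber.
by rewrite big1// => a _; apply: fiber_null; exact: jM.
Qed.

Section chain.
Context d (Om : measurableType d) (P : probability Om R).
Variables (X : nat -> {RV P >-> vec R n.-1}) (I : nat -> {RV P >-> nat}).
Hypothesis XI : block_gibbs_sampler n pi k w X I.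

Lemma gibbs_lower_bound x0 M t : body x0 -> P (X 0%N @^-1` [set x0]) = 1 ->
  (M.+1 * k < n - k)%N -> (k%:R <= Z)%R ->
  (1 - (1 + M%:R * (1 - k%:R / Z) ^+ t)^-1)%:E <=
  tv_distance (distribution P (X t)) (uniform_body n pi).
Proof.
move=> bx0 Xx0 Mn kZ; have Z0 : (0 < Z)%R := block_weight_norm_gt0 k0 kn w0.
set q := (1 - k%:R / Z)%R; have q0 : (0 <= q)%R by rewrite subr_ge0 ler_pdivrMr// mul1r.
(* Coordinate [k] is skipped: it is covered by position 1, which has the edge weight [w]. *)
pose j a := (a.+2 * k)%N; pose c a := crd x0 (j a).
pose A a := fiber (j a) (c a) `&` body; pose Q a := predC (covers k (j a)).
pose G a := survival X I (A a) (Q a) t.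
have jk a : (a < M)%N -> (k < j a < n - k)%N.
  move=> aM; have : (a.+2 * k <= M.+1 * k)%N by rewrite leq_mul2r; lia.
  by rewrite /j; lia.
have mA a : measurable (A a) by apply: measurableI => //; exact: measurable_fiber.
have mS B S : measurable B -> measurable (survival X I B S t).
  move=> mB; apply: (history_measurable (X := X) (I := I) (t := t)).
  exact: survival_history.
have mG a : measurable (G a) by exact: mS.
have mB : measurable (\big[setU/set0]_(a < M) fiber (j a) (c a)).
  by apply: bigsetU_measurable => a _; exact: measurable_fiber.
apply: (@le_trans _ _ (distribution P (X t) (\big[setU/set0]_(a < M) fiber (j a) (c a)))); last first.
  apply: ereal_sup_ubound; exists (\big[setU/set0]_(a < M) fiber (j a) (c a)) => //.
  rewrite fibers_null ?sube0 ?gee0_abs//.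
  by move=> a /jk; lia.
apply: (@le_trans _ _ (P (\bigcup_(a : 'I_M) G a))); last first.
  apply: le_measure; rewrite ?inE.
  - by apply: fin_bigcup_measurable.
  - by rewrite -[X in measurable X]setTI; exact: measurable_funP.
  - move=> om [a _ /survival_state[/= jE _]].
    rewrite -(bigcup_mkord M (fun a => fiber (j a) (c a))).
    by exists (a : nat) => //=; exact: ltn_ord.
have weight_covers a : (a < M)%N ->
    (\sum_(i <- positions | covers k (j a) i) bw i = k%:R / Z)%R.
  by move=> /jk; exact: covers_weight.
have weightQ a : (a < M)%N -> (\sum_(i <- positions | Q a i) bw i = q)%R.
  move=> aM; have := sum_block_weight k0 kn w0.
  by rewrite (bigID (covers k (j a)))/= weight_covers// /q /Q /=; lra.
have mx0 : measurable [set x0].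
  rewrite (_ : [set x0] = \bigcap_(i in [set i | (0 < i <= n.-1)%N]) fiber i (crd x0 i)).
    by apply: bigcap_measurableType => i _; exact: measurable_fiber.
  by apply/seteqP; split => [_ -> //|x xx0]; apply: vecP => i im; exact: xx0.
apply: second_moment => //.
- exact: exprn_ge0.
- move=> a; rewrite -(weightQ a)//; apply: (survival_ge k0 kn w0 fs XI) => //.
  + by move=> x [].
  + apply/eqP; rewrite eq_le probability_le1//=; last first.
      by rewrite -[X in measurable X]setTI; exact: measurable_funP.
    rewrite -Xx0; apply: le_measure; rewrite ?inE.
    * by rewrite -[X in measurable X]setTI; exact: measurable_funP.
    * by rewrite -[X in measurable X]setTI; exact: measurable_funP.
    * by move=> om /= ->.
  + move=> i x im Qi [xj bx] u [bu ux]; split => //.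
    by rewrite /fiber /= ux.
move=> a b ab.
(* For the upper bound on a pair the fibers are dropped and only the avoided positions are kept. The
   coordinates are at least [k] apart, so no block covers both. *)
have h := survivalI (X := X) (I := I) (A := A a) (A' := A b) (Q := Q a) (Q' := Q b) (t := t).
apply: (@le_trans _ _ (P (survival X I body (predI (Q a) (Q b)) t))).
  apply: le_measure; rewrite ?inE.
  - exact: measurableI.
  - exact: mS.
  - by move=> om /h; apply: survivalS => x [[]].
apply: le_trans (survival_le k0 kn w0 fs XI _ _) _.
rewrite lee_fin -exprM mulnC exprM; apply: lerXn2r.
- by rewrite nnegrE; apply: sumr_ge0 => i _; exact: block_weight_ge0.
- by rewrite nnegrE sqr_ge0.
have disj i : covers k (j a) i -> ~~ covers k (j b) i.
  rewrite /covers /j; have : (a : nat) != b by [].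
  rewrite neq_ltn => /orP[ltab|ltab].
    have : (a.+3 * k <= b.+2 * k)%N by rewrite leq_mul2r; lia.
    by rewrite mulSn; lia.
  have : (b.+3 * k <= a.+2 * k)%N by rewrite leq_mul2r; lia.
  by rewrite mulSn; lia.
(* With [p = k / Z], the pair survives a step with probability [1 - 2p <= (1 - p) ^+ 2]: the events
   are negatively correlated in the sense required by [second_moment]. *)
have -> : (\sum_(i <- positions | predI (Q a) (Q b) i) bw i = 1 - k%:R / Z - k%:R / Z)%R.
  have := weightQ a (ltn_ord a); rewrite (bigID (covers k (j b)))/=.
  rewrite (eq_bigl (covers k (j b))) ?weight_covers//; first by rewrite /q; lra.
  by move=> i; rewrite andbC; case: (boolP (covers k (j b) i)) => //= cb; apply: contraL cb; exact: disj.
rewrite /q; have := sqr_ge0 (k%:R / Z)%R; rewrite !expr2; lra.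
Qed.

End chain.

End lower_bound.

(** * Survival probabilities at the prescribed time *)

Section asymptotics.
Context {R : realType}.
Implicit Types (n k : nat) (w c : R).

Lemma survival_rate_ge n k w c : (0 < k)%N -> 0 < w -> (2 * k + 3 <= n)%N ->
  2 * k%:R + 2 <= k%:R * c * n%:R ->
  n%:R^-1 <= (1 - k%:R / ((n - k)%:R - 2 + 2 * w)) ^+
    Num.truncn ((k%:R^-1 - c) * n%:R * ln n%:R).
Proof.
move=> k0 w0 kn nc; set t := Num.truncn _; set Z := _ + 2 * w.
have k1 : (1 <= k%:R :> R) by rewrite ler1n.
have n1 : (1 <= n%:R :> R) by rewrite ler1n; lia.
have L0 : 0 <= ln n%:R :> R by exact: ln_ge0.
have ZE : Z = n%:R - k%:R - 2 + 2 * w by rewrite /Z natrB//; lia.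
have kn' : 2 * k%:R + 3 <= n%:R :> R by rewrite -natrM -natrD ler_nat.
have Zk : 0 < Z - k%:R by lra.
have Z0 : 0 < Z by lra.
(* Since [Z - k] is [n - 2k - 2 + 2w], it is at least [(1 - k * c) * n] once [k * c * n] exceeds
   [2k + 2]. When the prescribed time is negative, [t] is 0. *)
have tk : k%:R * t%:R <= (Z - k%:R) * ln n%:R.
  have [pos|neg] := leP 0 ((k%:R^-1 - c) * n%:R * ln n%:R); last first.
    rewrite (_ : t = 0%N) ?mulr0 ?mulr_ge0//; first exact: ltW.
    by apply/eqP; rewrite -leqn0 truncn_le_nat (lt_trans neg).
  have : t%:R <= (k%:R^-1 - c) * n%:R * ln n%:R by rewrite truncn_le.
  move=> /(ler_wpM2l (ler0n R k)) /le_trans; apply.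
  rewrite !mulrA; apply: ler_wpM2r => //.
  by rewrite mulrBr divff ?gt_eqF//; [rewrite ZE; lra|lra].
(* In this form, [1 + z <= expR z] yields a lower bound on [1 - k / Z]. *)
have qE : 1 - k%:R / Z = (1 + k%:R / (Z - k%:R))^-1.
  by field; rewrite !gt_eqF//; lra.
have q_ge : expR (- (k%:R / (Z - k%:R))) <= 1 - k%:R / Z.
  rewrite qE expRN lef_pV2 ?posrE ?expR_gt0//; first exact: expR_ge1Dx.
  by rewrite ltr_wpDr// divr_ge0// ltW.
apply: (@le_trans _ _ (expR (- (k%:R / (Z - k%:R))) ^+ t)); last first.
  apply: lerXn2r => //; rewrite nnegrE ?expR_ge0//.
  exact: le_trans (expR_ge0 _) q_ge.
rewrite -expRM_natr -[leLHS]lnK ?posrE ?invr_gt0; last by lra.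
rewrite ler_expR lnV ?posrE; last by lra.
by rewrite mulNr lerN2 mulrAC ler_pdivrMr// mulrC [leRHS]mulrC mulrC.
Qed.

Lemma lt0_limn_einf (u : (\bar R)^nat) (v : R) N : 0 < v ->
  (forall n, (N <= n)%N -> (v%:E <= u n)%E) -> (0 < limn_einf u)%E.
Proof.
move=> v0 uv; apply: (@lt_le_trans _ _ v%:E); first by rewrite lte_fin.
rewrite limn_einf_lim; apply: lime_ge; first exact: is_cvg_einfs.
exists N => // n /= Nn; apply: le_ereal_inf_tmp => _ [i /= ni <-].
by apply: uv; exact: leq_trans ni.
Qed.

End asymptotics.
Theorem theorem2 (R : realType) :
  (* upper bound *)
  (forall (c : R) (n : nat) (pi : nat -> R)
     (d : measure_display) (Om : measurableType d) (P : probability Om R)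
     (X : nat -> {RV P >-> vec R n.-1})
     (I : nat -> {RV P >-> nat}) (t : nat),
   0 < c -> (58 < n)%N ->
   full_support_distribution n pi ->
   block_gibbs_sampler n pi 55 55 X I ->
   2 * c * n%:R * ln n%:R < t%:R ->
   (tv_distance (distribution P (X t)) (uniform_body n pi)
      <= (n%:R `^ (1 - c))%:E)%E)
  /\
  (* lower bound *)
  (forall (k : nat) (w c : R) (pi : nat -> nat -> R)
     (x0 : forall n, vec R n.-1)
     (d : nat -> measure_display) (Om : forall n, measurableType (d n))
     (P : forall n, probability (Om n) R)
     (X : forall n, nat -> {RV (P n) >-> vec R n.-1})
     (I : forall n, nat -> {RV (P n) >-> nat}),
   (1 <= k)%N -> 0 < w -> 0 < c ->
   (forall n, (k.+2 <= n)%N ->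
      [/\ full_support_distribution n (pi n),
          gibbs_body n (pi n) (x0 n),
          P n (X n 0%N @^-1` [set x0 n]) = 1%E &
          block_gibbs_sampler n (pi n) k w (X n) (I n)]) ->
   let t n := Num.truncn ((k%:R^-1 - c) * n%:R * ln n%:R) in
   (0 < limn_einf (fun n =>
          tv_distance (distribution (P n) (X n (t n)))
                          (uniform_body n (pi n))))%E).
Proof.
split=> [c n pi d Om P X I t c0 n58 fs XI tc|k w c pi x0 d Om P X I k0 w0 c0 H].
  exact: (gibbs_upper_bound n58 fs XI c0 tc).
have k1 : (1 <= k%:R :> R) by rewrite ler1n.
(* The first part makes [n] large enough for the choice of [M] below, the second ensures
   [2k + 2 <= k * c * n]. *)
pose N := (6 * k + 3 + (Num.truncn ((2 * k%:R + 2) / (k%:R * c))).+1)%N.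
apply: (@lt0_limn_einf _ _ (1 - (1 + (2 * k%:R)^-1)^-1) N).
  have h : 0 < (2 * k%:R)^-1 :> R by rewrite invr_gt0; lra.
  by rewrite subr_gt0 invf_lt1; lra.
move=> n Nn; have nk : (6 * k + 3 <= n)%N by rewrite /N in Nn; lia.
have kn : (k.+2 <= n)%N by lia.
have [fs bx0 Xx0 XI] := H n kn.
have kc0 : 0 < k%:R * c by rewrite mulr_gt0//; lra.
have nc : 2 * k%:R + 2 <= k%:R * c * n%:R.
  rewrite [leRHS]mulrC -ler_pdivrMr//.
  apply: (le_trans (ltW (truncnS_gt _))).
  by rewrite ler_nat; exact: leq_trans (leq_addl _ _) Nn.
(* The largest number of coordinates [2k, 3k, ...] below [n - k]. As [n <= 2 * k * M] and each
   survival probability is at least [1 / n], their expected number is at least [1 / (2k)], whence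
   the uniform bound. *)
pose M := ((n - k - 1) %/ k).-1.
have Mk : (n <= 2 * k * M)%N /\ (M.+1 * k < n - k)%N.
  have := divn_eq (n - k - 1) k; have := ltn_pmod (n - k - 1) k0; rewrite /M.
  case: (_ %/ k)%N => [|q] /=; nia.
have kZ : k%:R <= (n - k)%:R - 2 + 2 * w.
  have h : k%:R + 2 <= (n - k)%:R :> R by rewrite -natrD ler_nat; lia.
  lra.
have rate := @survival_rate_ge R n k w c k0 w0 ltac:(lia) nc.
apply: le_trans (gibbs_lower_bound k0 kn w0 fs XI _ bx0 Xx0 (proj2 Mk) kZ).
rewrite lee_fin lerD2l lerN2 lef_pV2 ?posrE.
- rewrite lerD2l; apply: (@le_trans _ _ (M%:R * n%:R^-1)).
    rewrite ler_pdivlMr ?ltr0n; last by lia.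
    rewrite mulrC ler_pdivrMr; last by lra.
    by rewrite -!natrM ler_nat; lia.
  by apply: ler_wpM2l => //; exact: rate.
- rewrite ltr_wpDr// mulr_ge0//; apply: le_trans rate.
  by rewrite invr_ge0.
- by rewrite ltr_wpDr// invr_ge0; lra.
Qed.
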